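(* Let $(M^{3},\varphi,\xi,\eta,g)$ be a $3$-dimensional almost Kenmotsu generalized $(\kappa,\mu)'$-manifold, with $\kappa,\mu$ smooth functions on $M^3$. Suppose $d\kappa\wedge\eta=0$ and $\kappa<-1$ everywhere, and put $\lambda=\sqrt{-1-\kappa}$. Then: (i) If $\mu=-2$ identically, then $\kappa$ is constant. (ii) If $\mu\neq-2$ at every point, then in a neighbourhood $U$ of every point $p\in M^3$ there exist coordinates $x,y,z$ with $z<-1$ and an orthonormal frame $\{\xi, X, \varphi X\}$ of eigenvectors of $h'$ with $h'X=\lambda X$, such that on $U$ one has $\kappa=z$, $\mu$ only depends on $z$, and $$X=\frac{\partial}{\partial x},\quad \varphi X=\frac{\partial}{\partial y}, \quad \xi=a\frac{\partial}{\partial x}+b \frac{\partial}{\partial y}-2(z+1)(\mu+2)\frac{\partial}{\partial z},$$ where $a=x(1+\sqrt{-1-z})+f$ and $b=y(1-\sqrt{-1-z})+r$, with $f,r$ smooth functions of $z$ on $U$.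
   Context: All manifolds are smooth and connected. An almost contact metric manifold $(M^{2n+1},\varphi,\xi,\eta,g)$ is a manifold with a $(1,1)$-tensor field $\varphi$, a vector field $\xi$, a $1$-form $\eta$ and a Riemannian metric $g$ such that $\varphi^2=-I+\eta\otimes\xi$, $\eta(\xi)=1$ and $g(\varphi X,\varphi Y)=g(X,Y)-\eta(X)\eta(Y)$. Its fundamental $2$-form is $\Phi(X,Y)=g(X,\varphi Y)$. It is almost Kenmotsu if $d\eta=0$ and $d\Phi=2\eta\wedge\Phi$. Put $h:=\frac12\mathcal{L}_{\xi}\varphi$ ($\mathcal L$ the Lie derivative) and $h':=h\circ\varphi$. With $R(X,Y)=[\nabla_X,\nabla_Y]-\nabla_{[X,Y]}$ ($\nabla$ the Levi-Civita connection of $g$), an almost Kenmotsu manifold is called a generalized $(\kappa,\mu)'$-manifold, for smooth functions $\kappa,\mu$ on $M$, if for all vector fields $X,Y$: $R(X,Y)\xi=\kappa(\eta(Y)X-\eta(X)Y)+\mu(\eta(Y)h'X-\eta(X)h'Y)$. *)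

(* Defs.v *)
From mathcomp Require Import all_boot all_order all_algebra.
From mathcomp Require Import all_classical all_reals all_analysis.

Set Implicit Arguments.
Unset Strict Implicit.
Unset Printing Implicit Defensive.

Import Order.TTheory GRing.Theory Num.Theory.
Import numFieldNormedType.Exports.

Local Open Scope classical_set_scope.
Local Open Scope ring_scope.

(* [Ck k A f]: f is C^k on the open set A, the domain V being
   finite-dimensional (so that C^k-ness of the differential can be tested on
   each fixed vector v). *)
Fixpoint Ck (R : realType) (V W : normedModType R) (k : nat) (A : set V)
    (f : V -> W) : Prop :=
  if k is k'.+1 then
    (forall x, A x -> differentiable f x) /\ (forall v : V, Ck k' A ('D_v f))
  else forall x, A x -> {for x, continuous f}.

Definition smooth_on (R : realType) (V W : normedModType R) (A : set V)
    (f : V -> W) : Prop := forall k, Ck k A f.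

(* [chart_map] and [chart_inv] are total functions, only meaningful on
   [chart_dom] and on its image respectively. *)
Record chart (R : realType) (n : nat) (T : topologicalType) := Chart {
  chart_dom : set T;
  chart_map : T -> 'rV[R]_n;
  chart_inv : 'rV[R]_n -> T;
  chart_dom_open : open chart_dom;
  chart_img_open : open (chart_map @` chart_dom);
  chart_mapK : forall p, chart_dom p -> chart_inv (chart_map p) = p;
  chart_map_cont : forall p, chart_dom p -> {for p, continuous chart_map};
  chart_inv_cont : forall u, (chart_map @` chart_dom) u ->
    {for u, continuous chart_inv}
}.

Definition chart_compatible (R : realType) (n : nat) (T : topologicalType)
    (c d : chart R n T) : Prop :=
  smooth_on (chart_map c @` (chart_dom c `&` chart_dom d))
    (chart_map d \o chart_inv c) /\
  smooth_on (chart_map d @` (chart_dom c `&` chart_dom d))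
    (chart_map c \o chart_inv d).

(* The atlas need not be maximal. [chart_at] is a choice, at each point, of a
   chart of the atlas around that point. *)
Record smooth_manifold (R : realType) (n : nat) := SmoothManifold {
  manifold_space :> topologicalType;
  manifold_hausdorff : hausdorff_space manifold_space;
  manifold_second_countable : @second_countable manifold_space;
  atlas : set (chart R n manifold_space);
  atlas_compatible : forall c d, atlas c -> atlas d -> chart_compatible c d;
  chart_at : manifold_space -> chart R n manifold_space;
  chart_at_atlas : forall p, atlas (chart_at p);
  chart_at_dom : forall p, chart_dom (chart_at p) p
}.

(* Membership in the maximal atlas. *)
Definition admissible_chart (R : realType) (n : nat) (M : smooth_manifold R n)
    (c : chart R n M) : Prop :=
  forall d, atlas d -> chart_compatible c d.

(* The tangent space at p is R^n, a vector being identified with its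
   components in the chart [chart_at p]; components in other charts are
   obtained with the Jacobian of the transition map, see [tcoord]. *)
Definition tangent (R : realType) (n : nat) (M : smooth_manifold R n) (p : M)
    : normedModType R := 'rV[R]_n.

Unset Implicit Arguments.

Section tensors.
Context {R : realType} {n : nat} (M : smooth_manifold R n).

Definition vector_field := forall p : M, tangent p.
Definition one_form := forall p : M, tangent p -> R.
Definition two_tensor := forall p : M, tangent p -> tangent p -> R.
Definition endo_field := forall p : M, {linear tangent p -> tangent p}.

End tensors.

Section calculus.
Context {R : realType} {n : nat} {M : smooth_manifold R n}.
Implicit Types (c : chart R n M) (U : set M) (p : M) (f : M -> R).
Implicit Types (X Y Z : vector_field M).

Definition smooth_fun U f : Prop :=
  forall c, atlas c ->
    smooth_on (chart_map c @` (chart_dom c `&` U)) (f \o chart_inv c).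

(* Components, in the chart c, of the tangent vector v at p. *)
Definition tcoord c {p} (v : tangent p) : 'rV[R]_n :=
  'D_v (chart_map c \o chart_inv (chart_at p)) (chart_map (chart_at p) p).

(* The i-th coordinate vector field of the chart c (on the domain of c). *)
Definition coord_field c (i : 'I_n) : vector_field M := fun p =>
  'D_(delta_mx 0 i) (chart_map (chart_at p) \o chart_inv c) (chart_map c p).

Definition field_in c X (u : 'rV[R]_n) : 'rV[R]_n :=
  tcoord c (X (chart_inv c u)).

Definition smooth_field U X : Prop :=
  forall c, atlas c ->
    smooth_on (chart_map c @` (chart_dom c `&` U)) (field_in c X).

Definition differential f : one_form M := fun p v =>
  'D_v (f \o chart_inv (chart_at p)) (chart_map (chart_at p) p).

Definition bracket X Y : vector_field M := fun p =>
  let c := chart_at p in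
  'D_(X p) (field_in c Y) (chart_map c p)
  - 'D_(Y p) (field_in c X) (chart_map c p).

Definition smooth_one_form (alpha : one_form M) : Prop :=
  forall c i, atlas c ->
    smooth_fun (chart_dom c) (fun p => alpha p (coord_field c i p)).

Definition smooth_two_tensor (B : two_tensor M) : Prop :=
  forall c i j, atlas c ->
    smooth_fun (chart_dom c)
      (fun p => B p (coord_field c i p) (coord_field c j p)).

Definition apply_endo (A : endo_field M) X : vector_field M :=
  fun p => A p (X p).

Definition smooth_endo (A : endo_field M) : Prop :=
  forall c i, atlas c ->
    smooth_field (chart_dom c) (apply_endo A (coord_field c i)).

Record riemannian_metric (g : two_tensor M) : Prop := {
  metric_smooth : smooth_two_tensor g;
  metric_linear : forall p (a : R) (u v w : tangent p),
    g p (a *: u + v) w = a * g p u w + g p v w;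
  metric_sym : forall p (u v : tangent p), g p u v = g p v u;
  metric_pos : forall p (v : tangent p), v != 0 -> 0 < g p v v
}.

(* The normalizations of the exterior derivatives and of the wedge products
   below are those without numerical factors (dx /\ dy (d_x, d_y) = 1). *)
Definition wedge11 (alpha beta : one_form M) : two_tensor M := fun p u v =>
  alpha p u * beta p v - alpha p v * beta p u.

Definition wedge12 (alpha : one_form M) (B : two_tensor M) p
    (u v w : tangent p) : R :=
  alpha p u * B p v w + alpha p v * B p w u + alpha p w * B p u v.

Definition ext_deriv1 (alpha : one_form M) X Y p : R :=
  differential (fun q => alpha q (Y q)) p (X p)
  - differential (fun q => alpha q (X q)) p (Y p)
  - alpha p (bracket X Y p).

Definition ext_deriv2 (B : two_tensor M) X Y Z p : R :=
  differential (fun q => B q (Y q) (Z q)) p (X p)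
  + differential (fun q => B q (Z q) (X q)) p (Y p)
  + differential (fun q => B q (X q) (Y q)) p (Z p)
  - B p (bracket X Y p) (Z p)
  - B p (bracket Y Z p) (X p)
  - B p (bracket Z X p) (Y p).

(* (L_X A) Y = L_X (A Y) - A (L_X Y) *)
Definition lie_deriv_endo X (A : endo_field M) Y : vector_field M := fun p =>
  bracket X (apply_endo A Y) p - A p (bracket X Y p).

(* Smooth vector fields are taken on the whole of M; the values of the
   connection on non-smooth fields are unconstrained. *)
Record levi_civita (g : two_tensor M)
    (nabla : vector_field M -> vector_field M -> vector_field M) : Prop := {
  nabla_smooth : forall X Y, smooth_field setT X -> smooth_field setT Y ->
    smooth_field setT (nabla X Y);
  nabla_linear_l : forall f X Y Z, smooth_fun setT f ->
    smooth_field setT X -> smooth_field setT Y -> smooth_field setT Z ->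
    forall p, nabla (fun q => f q *: X q + Y q) Z p
              = f p *: nabla X Z p + nabla Y Z p;
  nabla_add_r : forall X Y Z,
    smooth_field setT X -> smooth_field setT Y -> smooth_field setT Z ->
    forall p, nabla X (fun q => Y q + Z q) p = nabla X Y p + nabla X Z p;
  nabla_leibniz : forall f X Y, smooth_fun setT f ->
    smooth_field setT X -> smooth_field setT Y ->
    forall p, nabla X (fun q => f q *: Y q) p
              = differential f p (X p) *: Y p + f p *: nabla X Y p;
  nabla_torsion_free : forall X Y,
    smooth_field setT X -> smooth_field setT Y ->
    forall p, nabla X Y p - nabla Y X p = bracket X Y p;
  nabla_metric : forall X Y Z,
    smooth_field setT X -> smooth_field setT Y -> smooth_field setT Z ->
    forall p, differential (fun q => g q (Y q) (Z q)) p (X p)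
              = g p (nabla X Y p) (Z p) + g p (Y p) (nabla X Z p)
}.

Definition curvature
    (nabla : vector_field M -> vector_field M -> vector_field M) X Y Z
    : vector_field M := fun p =>
  nabla X (nabla Y Z) p - nabla Y (nabla X Z) p - nabla (bracket X Y) Z p.

End calculus.

Section almost_kenmotsu.
Context {R : realType} {n : nat} {M : smooth_manifold R n}.
Variables (phi : endo_field M) (xi : vector_field M) (eta : one_form M).
Variable g : two_tensor M.

Record almost_contact_metric : Prop := {
  acm_phi_smooth : smooth_endo phi;
  acm_xi_smooth : smooth_field setT xi;
  acm_eta_smooth : smooth_one_form eta;
  acm_eta_linear : forall p (a : R) (u v : tangent p),
    eta p (a *: u + v) = a * eta p u + eta p v;
  acm_metric : riemannian_metric g;
  acm_phi2 : forall p (v : tangent p),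
    phi p (phi p v) = - v + eta p v *: xi p;
  acm_eta_xi : forall p, eta p (xi p) = 1;
  acm_compatible : forall p (u v : tangent p),
    g p (phi p u) (phi p v) = g p u v - eta p u * eta p v
}.

Definition fundamental_form : two_tensor M := fun p u v => g p u (phi p v).

Record almost_kenmotsu : Prop := {
  ak_acm : almost_contact_metric;
  ak_deta : forall X Y : vector_field M,
    smooth_field setT X -> smooth_field setT Y ->
    forall p, ext_deriv1 eta X Y p = 0;
  ak_dPhi : forall X Y Z : vector_field M,
    smooth_field setT X -> smooth_field setT Y -> smooth_field setT Z ->
    forall p, ext_deriv2 fundamental_form X Y Z p
              = 2 * wedge12 eta fundamental_form p (X p) (Y p) (Z p)
}.

(* h = (1/2) L_xi phi and h' = h o phi. These are tensors; they are written as
   operators on vector fields, not only global ones: the value at p depends on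
   the argument near p only. *)
Definition h_tensor (X : vector_field M) : vector_field M :=
  fun p => 2^-1 *: lie_deriv_endo xi phi X p.

Definition h'_tensor (X : vector_field M) : vector_field M :=
  h_tensor (apply_endo phi X).

Definition h'_eigenvector (X : vector_field M) (p : M) : Prop :=
  X p != 0 /\ exists s : R, h'_tensor X p = s *: X p.

Record generalized_kappa_mu' (kappa mu : M -> R)
    (nabla : vector_field M -> vector_field M -> vector_field M) : Prop := {
  gkm_kappa_smooth : smooth_fun setT kappa;
  gkm_mu_smooth : smooth_fun setT mu;
  gkm_curvature : forall X Y : vector_field M,
    smooth_field setT X -> smooth_field setT Y ->
    forall p, curvature nabla X Y xi p
      = kappa p *: (eta p (Y p) *: X p - eta p (X p) *: Y p)
        + mu p *: (eta p (Y p) *: h'_tensor X p - eta p (X p) *: h'_tensor Y p)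
}.

End almost_kenmotsu.

(* Main.v *)
From HB Require Import structures.
From mathcomp Require Import all_boot all_order all_algebra.
From mathcomp Require Import all_classical all_reals all_analysis.
From mathcomp Require Import ring lra.
Require Import Defs.

(** Everything is computed on a local orthonormal frame xi, E, phi E.
    Closedness of eta makes nabla xi symmetric, and dPhi = 2 eta /\ Phi fixes the
    trace of the Lie derivative along xi on the contact distribution ker eta; in
    dimension 3 this amounts to nabla xi = id + h' on ker eta
    [frame_nabla_xi]. Substituted in R(E, xi) xi and R(phi E, xi) xi this gives
    three scalar equations [frame_curvature]. The sum of two of them says that
    h' squares to lambda^2 on ker eta [frame_eigenvalue]; as lambda > 0, smooth
    local frames with h' E = lambda E exist [exists_eigenframe]. On such a frame
    the third equation, together with R(E, phi E) xi = 0 and the vanishing of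
    d lambda on ker eta, kills all remaining connection coefficients, so that
    [eigenframe_eqs]
      [xi, E] = - (1 + lambda) E,  [xi, phi E] = - (1 - lambda) phi E,
      [E, phi E] = 0,  xi(kappa) = -2 (kappa + 1) (mu + 2).

    If mu = -2 then dkappa = xi(kappa) eta = 0, and kappa is constant by
    connectedness. If mu is nowhere -2, dkappa does not vanish, and kappa can serve
    as third coordinate. Since E and phi E commute but do not commute with xi, the
    first coordinate has to satisfy dx(E) = 1, dx(phi E) = 0 and
    dx(xi) = (1 + lambda) x up to a function of kappa, which is taken to be 0:
      dx = (1 + lambda) x eta + g(E, .).
    As d lambda is a multiple of eta, (1 + lambda) eta is closed, hence equal to dG
    locally; then the bracket relations make exp (- G) g(E, .) closed, and x is
    exp G times a primitive of it [adapted_coordinate]. The coordinate y is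
    obtained with phi E and 1 - lambda.
    The functions x, y, kappa are dual to the frame E, phi E, T where
      xi = (1 + lambda) x E + (1 - lambda) y phi E + xi(kappa) T,
    and the inverse function theorem turns them into a chart whose coordinate
    fields are E, phi E, T [coordinates_of_frame]. Finally the bracket relations
    give E(xi(kappa)) = (phi E)(xi(kappa)) = 0, so E and phi E annihilate mu
    [eigenframe_mu] and mu is a function of z = kappa in a chart whose image is a
    ball [function_of_coordinate].

    The analysis behind this (symmetry of second derivatives, Poincare's lemma,
    the inverse function theorem, bump functions to extend local vector fields to
    the global ones on which nabla is defined) is developed for the notion of
    C^k function that defines the manifold, on normed modules. *)

Set Implicit Arguments.
Unset Strict Implicit.
Unset Printing Implicit Defensive.

Import Order.TTheory GRing.Theory Num.Theory.
Import numFieldNormedType.Exports.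

Local Open Scope classical_set_scope.
Local Open Scope ring_scope.

(** * Differentiability by first-order estimates *)

Section fundamentals.
Context {R : realType}.
Implicit Types V W : normedModType R.

Lemma differentiable_eps V W (f : V -> W) (L : {linear V -> W}) x :
  continuous L ->
  (forall e : R, 0 < e ->
     \forall h \near 0, `|f (h + x) - f x - L h| <= e * `|h|) ->
  differentiable f x /\ 'd f x = L :> (V -> W).
Proof.
move=> Lc fL.
have fo : f \o shift x = cst (f x) + L +o_ 0 id.
  apply/eqaddoP => e e0; have := fL e e0; apply: filterS => h /=.
  by rewrite /= opprD addrA.
have dE := diff_unique Lc fo.
by split=> //; apply/diff_locallyP; rewrite dE.
Qed.

Lemma differentiable_epsE V W (f : V -> W) x : differentiable f x ->
  forall e : R, 0 < e ->
    \forall h \near 0, `|f (h + x) - f x - 'D_h f x| <= e * `|h|.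
Proof.
move=> df e e0; have /diff_locally/eqaddoP/(_ e e0) := df.
apply: filterS => h /=; rewrite deriveE// => H.
by apply: le_trans H; rewrite /= opprD addrA.
Qed.

Lemma near_eq_differentiable V W (f g : V -> W) x :
  (\near x, f x = g x) -> differentiable f x -> differentiable g x.
Proof.
move=> fg df.
apply: (proj1 (@differentiable_eps V W g ('d f x) x (diff_continuous df) _)).
move=> e e0; have H := differentiable_epsE df e0.
have fx : f x = g x by exact: nbhs_singleton fg.
near=> h; rewrite -fx -deriveE//.
have -> : g (h + x) = f (h + x).
  apply/esym; near: h.
  have : \forall h \near (0 : V), (fun y => f y = g y) (h + x).
    by have := fg; rewrite (near_shift 0); apply: filterS => h /=; rewrite subr0.
  by [].
by near: h.
Unshelve. all: by end_near. Qed.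

Lemma line_derive V W (f : V -> W) p v t : differentiable f (p + t *: v) ->
  is_derive t 1 (fun s : R => f (p + s *: v)) ('D_v f (p + t *: v)).
Proof.
move=> df.
have dl : is_diff t (fun s : R => p + s *: v) (fun s : R => s *: v).
  have := is_diffD (is_diff_cst p t) (is_diff_scalel t v).
  by rewrite /GRing.add_fun/= => H; apply: is_diff_eq H _; apply/funext => s;
    rewrite /= add0r.
have d1 : differentiable (fun s : R => p + s *: v) t by exact: ex_diff.
have dc : differentiable (f \o (fun s : R => p + s *: v)) t.
  exact: differentiable_comp.
apply: DeriveDef; first exact/derivable1_diffP.
rewrite deriveE// -[X in 'd X t](_ : f \o (fun s : R => p + s *: v) = _)//.
by rewrite diff_comp// /= diff_val scale1r deriveE.
Qed.

Lemma mvt_line V (f : V -> R) p v :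
  (forall t : R, 0 <= t <= 1 -> differentiable f (p + t *: v)) ->
  exists2 t : R, 0 <= t <= 1 & f (p + v) - f p = 'D_v f (p + t *: v).
Proof.
move=> df.
have der (t : R) : 0 <= t <= 1 ->
    is_derive t 1 (fun s : R => f (p + s *: v)) ('D_v f (p + t *: v)).
  by move=> t01; apply: line_derive; exact: df.
have [|t|c c01] := @MVT _ (fun s : R => f (p + s *: v))
    (fun s => 'D_v f (p + s *: v)) 0 1 ltr01.
- by move=> t; rewrite in_itv/= => /andP[t0 t1]; apply: der; rewrite !ltW.
- apply: derivable_within_continuous => s; rewrite in_itv/= => /der H.
  exact: ex_derive.
- rewrite scale1r scale0r addr0 subr0 mulr1 => ->; exists c => //.
  by move: c01; rewrite in_itv/= => /andP[? ?]; rewrite !ltW.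
Qed.

End fundamentals.

(** * Calculus of C^k functions on open sets *)

Section Ck_theory.
Context {R : realType}.
Implicit Types V W : normedModType R.

Lemma Ck_sub V W k (A B : set V) (f : V -> W) :
  A `<=` B -> Ck k B f -> Ck k A f.
Proof.
move=> AB; elim: k f => [|k IH] f /=; first by move=> H x /AB/H.
by move=> [df Df]; split=> [x /AB/df//|v]; exact: IH.
Qed.

Lemma Ck_loc V W k (A : set V) (f : V -> W) :
  (forall x, A x -> exists2 B, B x & Ck k B f) -> Ck k A f.
Proof.
elim: k f => [|k IH] f H /=; first by move=> x /H[B Bx]; exact.
split=> [x /H[B Bx [dB _]]|v]; first exact: dB.
by apply: IH => x /H[B Bx [_ BD]]; exists B => //; exact: BD.
Qed.

Lemma open_near V (A : set V) x : open A -> A x -> \forall y \near x, A y.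
Proof. by move=> oA Ax; apply: open_nbhs_nbhs. Qed.

(** Openness lets pointwise equality on A pass to the derivatives. *)
Lemma Ck_eq V W k (A : set V) (f g : V -> W) : open A ->
  (forall x, A x -> f x = g x) -> Ck k A f -> Ck k A g.
Proof.
move=> oA; elim: k f g => [|k IH] f g fg /=.
  move=> fc x Ax; have fx : f @ x --> f x := fc x Ax.
  change (g @ x --> g x); rewrite -(fg x Ax).
  apply: cvg_trans fx; apply: near_eq_cvg.
  by apply: filterS (open_near oA Ax) => y /fg ->.
have nfg x : A x -> \near x, f x = g x.
  by move=> Ax; apply: filterS (open_near oA Ax) => y /fg ->.
move=> [df Df]; split=> [x Ax|v].
  by apply: (near_eq_differentiable (nfg x Ax)); exact: df.
by apply: IH (Df v) => x Ax; apply: near_eq_derive; exact: nfg.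
Qed.

Lemma Ck_differentiable V W k (A : set V) (f : V -> W) x :
  Ck k.+1 A f -> A x -> differentiable f x.
Proof. by move=> [+ _]; exact. Qed.

Lemma Ck_derive V W k (A : set V) (f : V -> W) v :
  Ck k.+1 A f -> Ck k A ('D_v f).
Proof. by move=> [_ H]; exact: H. Qed.

Lemma CkW V W k (A : set V) (f : V -> W) : Ck k.+1 A f -> Ck k A f.
Proof.
elim: k f => [|k IH] f; last by move=> [df Df]; split=> // v; exact: IH.
by move=> [df _] x /df; exact: differentiable_continuous.
Qed.

Lemma smooth_on_derive V W (A : set V) (f : V -> W) v :
  smooth_on A f -> smooth_on A ('D_v f).
Proof. by move=> fA k; exact: Ck_derive (fA k.+1). Qed.

Lemma smooth_on_differentiable V W (A : set V) (f : V -> W) x :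
  smooth_on A f -> A x -> differentiable f x.
Proof. by move=> /(_ 1%N); exact: Ck_differentiable. Qed.

Lemma smooth_on_continuous V W (A : set V) (f : V -> W) x :
  smooth_on A f -> A x -> {for x, continuous f}.
Proof. by move=> /(_ 0%N); exact. Qed.

Lemma Ck_cst V W k (A : set V) (c : W) : Ck k A (cst c : V -> W).
Proof.
elim: k c => [|k IH] c /=; first by move=> x _; exact: cvg_cst.
split=> [x _|v]; first exact: differentiable_cst.
by rewrite (_ : 'D_v _ = cst 0)//; apply/funext => x; rewrite derive_cst.
Qed.

Lemma Ck_linear V W k (A : set V) (L : {linear V -> W}) :
  continuous L -> Ck k A L.
Proof.
move=> Lc; case: k => [|k] /=; first by move=> x _; exact: Lc.
split=> [x _|v]; first exact: linear_differentiable.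
rewrite (_ : 'D_v _ = cst (L v)); first exact: Ck_cst.
by apply/funext => x; rewrite deriveE ?diff_lin//; exact: linear_differentiable.
Qed.

Lemma CkD V W k (A : set V) (f g : V -> W) : open A ->
  Ck k A f -> Ck k A g -> Ck k A (fun x => f x + g x).
Proof.
move=> oA; elim: k f g => [|k IH] f g.
  by move=> fc gc x Ax; apply: cvgD; [exact: fc|exact: gc].
move=> [df Df] [dg Dg]; split=> [x Ax|v].
  by apply: differentiableD; [exact: df|exact: dg].
apply: (Ck_eq oA _ (IH _ _ (Df v) (Dg v))) => x Ax.
by rewrite -deriveD//; apply: diff_derivable; [exact: df|exact: dg].
Qed.

Lemma CkM V k (A : set V) (f g : V -> R) : open A ->
  Ck k A f -> Ck k A g -> Ck k A (fun x => f x * g x).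
Proof.
move=> oA; elim: k f g => [|k IH] f g.
  by move=> fc gc x Ax; apply: cvgM; [exact: fc|exact: gc].
move=> Cf Cg; have [[df Df] [dg Dg]] := (Cf, Cg); split=> [x Ax|v].
  by apply: differentiableM; [exact: df|exact: dg].
have H := CkD oA (IH _ _ (CkW Cf) (Dg v)) (IH _ _ (CkW Cg) (Df v)).
apply: (Ck_eq oA _ H) => x Ax.
by rewrite -[RHS]/('D_v (f * g) x) deriveM//; apply: diff_derivable;
  [exact: df|exact: dg].
Qed.

Lemma CkZ V k (A : set V) (a : R) (f : V -> R) : open A ->
  Ck k A f -> Ck k A (fun x => a * f x).
Proof. by move=> oA fA; apply: CkM => //; exact: (Ck_cst _ _ a). Qed.

Lemma CkN V k (A : set V) (f : V -> R) : open A ->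
  Ck k A f -> Ck k A (fun x => - f x).
Proof.
move=> oA fA; apply: (Ck_eq oA _ (CkZ (-1) oA fA)) => x _.
by rewrite mulN1r.
Qed.

Lemma CkB V k (A : set V) (f g : V -> R) : open A ->
  Ck k A f -> Ck k A g -> Ck k A (fun x => f x - g x).
Proof. by move=> oA fA gA; apply: CkD => //; exact: CkN. Qed.

Lemma Ck_sum V W k (A : set V) (I : Type) (s : seq I) (f : I -> V -> W) :
  open A -> (forall i, Ck k A (f i)) -> Ck k A (fun x => \sum_(i <- s) f i x).
Proof.
move=> oA fA; elim: s => [|i s IH].
  by apply: (Ck_eq oA _ (Ck_cst k A (0 : W))) => x _; rewrite big_nil.
by apply: (Ck_eq oA _ (CkD oA (fA i) IH)) => x _; rewrite big_cons.
Qed.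

Lemma CkV V k (A : set V) (f : V -> R) : open A ->
  (forall x, A x -> f x != 0) -> Ck k A f -> Ck k A (fun x => (f x)^-1).
Proof.
move=> oA f0; elim: k => [|k IH].
  by move=> fc x Ax; apply: cvgV; [exact: f0|exact: fc].
move=> Cf; have [df Df] := Cf; split=> [x Ax|v].
  by apply: differentiableV; [exact: df|exact: f0].
have Ci := IH (CkW Cf).
apply: (Ck_eq oA _ (CkN oA (CkM oA (CkM oA Ci Ci) (Df v)))) => x Ax.
rewrite deriveV ?f0//; last by apply: diff_derivable; exact: df.
by rewrite -mulNr -expr2 exprVn.
Qed.

Lemma differentiable_rV V n (f : V -> 'rV[R]_n) x :
  (forall i, differentiable (fun y => f y 0 i) x) -> differentiable f x.
Proof.
move=> df.
have -> : f = \sum_i (fun y => f y 0 i *: (delta_mx 0 i : 'rV[R]_n)).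
  apply/funext => y; rewrite [LHS]row_sum_delta.
  by elim/big_ind2 : _ => // a b c d -> ->.
by apply: differentiable_sum => i; exact: differentiableZl.
Qed.

Lemma differentiable_rVi V n (f : V -> 'rV[R]_n) x i :
  differentiable f x -> differentiable (fun y => f y 0 i) x.
Proof.
move=> df; apply: (@differentiable_comp _ _ _ _ f (fun N : 'rV[R]_n => N 0 i)) => //.
exact: differentiable_coord.
Qed.

Lemma derive_rV V n (f : V -> 'rV[R]_n) x v i : differentiable f x ->
  ('D_v f x) 0 i = 'D_v (fun y => f y 0 i) x.
Proof. by move=> df; rewrite derive_mx ?mxE//; exact: diff_derivable. Qed.

Lemma Ck_coord V n k (A : set V) (f : V -> 'rV[R]_n) i : open A ->
  Ck k A f -> Ck k A (fun x => f x 0 i).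
Proof.
move=> oA; elim: k f => [|k IH] f.
  move=> fc x Ax; apply: (@continuous_comp _ _ _ f (fun N : 'rV[R]_n => N 0 i)).
    exact: fc.
  exact: coord_continuous.
move=> [df Df]; split=> [x /df|v]; first exact: differentiable_rVi.
apply: (Ck_eq oA _ (IH _ (Df v))) => x Ax; rewrite derive_rV//.
exact: df.
Qed.

Lemma Ck_rV V n k (A : set V) (f : V -> 'rV[R]_n) : open A ->
  (forall i, Ck k A (fun x => f x 0 i)) -> Ck k A f.
Proof.
move=> oA; elim: k f => [|k IH] f fA.
  move=> x Ax; have fE : f = fun y => \sum_i f y 0 i *: (delta_mx 0 i : 'rV[R]_n).
    by apply/funext => y; exact: row_sum_delta.
  rewrite fE; have H (i : 'I_n) : (fun y => f y 0 i *: (delta_mx 0 i : 'rV[R]_n)) @ x -->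
      (f x 0 i *: (delta_mx 0 i : 'rV[R]_n)) by apply: cvgZr_tmp; exact: fA.
  change ((fun y => \sum_i f y 0 i *: (delta_mx 0 i : 'rV[R]_n)) @ x -->
      \sum_i f x 0 i *: (delta_mx 0 i : 'rV[R]_n)).
  elim: (index_enum _) => [|j s IH].
    under eq_fun do rewrite big_nil; rewrite big_nil; exact: cvg_cst.
  by under eq_fun do rewrite big_cons; rewrite big_cons; exact: cvgD.
have df x : A x -> differentiable f x.
  by move=> Ax; apply: differentiable_rV => i; exact: Ck_differentiable (fA i) Ax.
split=> // v; apply: IH => i.
apply: (Ck_eq oA _ (Ck_derive v (fA i))) => x Ax; rewrite derive_rV//.
exact: df.
Qed.

Lemma derive_comp V W (U : normedModType R) (f : V -> W) (h : W -> U) x v :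
  differentiable f x -> differentiable h (f x) ->
  'D_v (h \o f) x = 'D_('D_v f x) h (f x).
Proof.
move=> df dh; rewrite !deriveE//; last exact: differentiable_comp.
by rewrite diff_comp.
Qed.

Lemma derive_basis n W (h : 'rV[R]_n -> W) y w : differentiable h y ->
  'D_w h y = \sum_i w 0 i *: 'D_(delta_mx 0 i) h y.
Proof.
move=> dh; rewrite deriveE// {1}(row_sum_delta w) linear_sum.
by apply: eq_bigr => i _; rewrite linearZ deriveE.
Qed.

Lemma derivevD V W (f : V -> W) x a v w : differentiable f x ->
  'D_(a *: v + w) f x = a *: 'D_v f x + 'D_w f x.
Proof. by move=> df; rewrite !deriveE// linearP. Qed.

Lemma derive_scale1 W (h : R -> W) (y w : R) : differentiable h y ->
  'D_w h y = w *: 'D_1 h y.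
Proof. by move=> dh; rewrite !deriveE// -linearZ /= -[w *: 1]/(w * 1) mulr1. Qed.

(** The chain rule in coordinates writes the derivative as a sum of products
    D_v f_i * (D_i h o f), to which the induction hypothesis applies. *)
Lemma Ck_comp V n k (A : set V) (B : set 'rV[R]_n) (f : V -> 'rV[R]_n)
    (h : 'rV[R]_n -> R) : open A -> (forall x, A x -> B (f x)) ->
  Ck k A f -> Ck k B h -> Ck k A (h \o f).
Proof.
move=> oA AB; elim: k h => [|k IH] h.
  move=> fc hc x Ax; apply: continuous_comp; first exact: fc.
  by apply: hc; exact: AB.
move=> Cf Ch; have [[df Df] [dh Dh]] := (Cf, Ch); split=> [x Ax|v].
  by apply: differentiable_comp; [exact: df|apply: dh; exact: AB].
have H i := CkM oA (Ck_coord i oA (Df v)) (IH _ (CkW Cf) (Dh (delta_mx 0 i))).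
apply: (Ck_eq oA _ (Ck_sum (index_enum _) oA H)) => x Ax /=.
rewrite (@derive_comp _ _ _ f h); [|exact: df|by apply: dh; exact: AB].
by rewrite [in RHS]derive_basis//; apply: dh; exact: AB.
Qed.

Lemma Ck_comp_rV V n m k (A : set V) (B : set 'rV[R]_n) (f : V -> 'rV[R]_n)
    (h : 'rV[R]_n -> 'rV[R]_m) : open A -> open B ->
    (forall x, A x -> B (f x)) ->
  Ck k A f -> Ck k B h -> Ck k A (h \o f).
Proof.
move=> oA oB AB fA hB; apply: Ck_rV => // i.
by apply: (@Ck_comp V n k A B f (fun y => h y 0 i)) => //; exact: Ck_coord.
Qed.

Lemma Ck_comp1 V k (A : set V) (B : set R) (f : V -> R) (h : R -> R) :
  open A -> (forall x, A x -> B (f x)) ->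
  Ck k A f -> Ck k B h -> Ck k A (h \o f).
Proof.
move=> oA AB; elim: k h => [|k IH] h.
  move=> fc hc x Ax; apply: continuous_comp; first exact: fc.
  by apply: hc; exact: AB.
move=> Cf Ch; have [[df Df] [dh Dh]] := (Cf, Ch); split=> [x Ax|v].
  by apply: differentiable_comp; [exact: df|apply: dh; exact: AB].
apply: (Ck_eq oA _ (CkM oA (Df v) (IH _ (CkW Cf) (Dh 1)))) => x Ax /=.
rewrite (@derive_comp _ _ _ f h); [|exact: df|by apply: dh; exact: AB].
by rewrite [RHS]derive_scale1//; apply: dh; exact: AB.
Qed.

Lemma Ck_expR k (A : set R) : Ck k A (@expR R).
Proof.
have H : forall c : R, Ck k setT (fun x => c * expR x).
  elim: k => [|k IH] c.
    by move=> x _; apply: cvgM; [exact: cvg_cst|exact: continuous_expR].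
  have dE x : differentiable (@expR R) x by exact/derivable1_diffP.
  have dc x : differentiable (fun x : R => c * expR x) x.
    by apply: differentiableM; [exact: differentiable_cst|exact: dE].
  split=> // v; rewrite (_ : 'D_v _ = fun x => (v * c) * expR x)//.
  apply/funext => x; rewrite derive_scale1//.
  rewrite -[LHS]/(v *: 'D_1 ((cst c) * (@expR R)) x).
  rewrite deriveM; [|exact: derivable_cst|exact: derivable_expR].
  by rewrite derive_cst scaler0 addr0 derive_val /= -[v *: _]/(v * (c * expR x))
    mulrA.
apply: (Ck_sub (subsetT A)); apply: (Ck_eq openT _ (H 1)) => x _.
by rewrite mul1r.
Qed.

(** The derivative is half the quotient of D_v f by the square root itself, which
    closes the induction on k. *)
Lemma Ck_sqrt V k (A : set V) (f : V -> R) : open A ->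
  (forall x, A x -> 0 < f x) -> Ck k A f -> Ck k A (fun x => Num.sqrt (f x)).
Proof.
move=> oA f0; elim: k => [|k IH].
  move=> fc x Ax; apply: (@continuous_comp _ _ _ f (@Num.sqrt R)).
    exact: fc.
  exact: sqrt_continuous.
move=> Cf; have [df Df] := Cf.
have ds x : A x -> is_derive (f x) 1 Num.sqrt (2 * Num.sqrt (f x))^-1.
  by move=> Ax; apply: is_derive1_sqrt; exact: f0.
have dsd x : A x -> differentiable (@Num.sqrt R) (f x).
  by move=> /ds H; apply/derivable1_diffP; exact: ex_derive.
split=> [x Ax|v].
  by apply: (@differentiable_comp _ _ _ _ f Num.sqrt); [exact: df|exact: dsd].
have s0 x : A x -> 2 * Num.sqrt (f x) != 0.
  by move=> Ax; rewrite mulf_neq0 ?pnatr_eq0// gt_eqF// sqrtr_gt0 f0.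
apply: (Ck_eq oA _ (CkM oA (Df v) (CkV oA s0 (CkZ 2 oA (IH (CkW Cf)))))).
move=> x Ax /=.
have -> : (fun x => Num.sqrt (f x)) = Num.sqrt \o f by [].
rewrite (@derive_comp _ _ _ f Num.sqrt); [|exact: df|exact: dsd].
rewrite [RHS]derive_scale1; last exact: dsd.
by have -> := @derive_val _ _ _ _ _ _ _ (ds x Ax).
Qed.

End Ck_theory.

(** * Schwarz theorem and bump functions *)

Section schwarz.
Context {R : realType} {V : normedModType R}.
Implicit Types (f : V -> R) (x u v : V) (A : set V).

Lemma derive_shiftE f c u x : 'D_u (fun y => f (y + c)) x = 'D_u f (x + c).
Proof.
rewrite /derive; set a := (X in lim (X @ _)); set b := (X in _ = lim (X @ _)).
by have -> : a = b by apply/funext => h; rewrite /a /b /= addrA.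
Qed.

Lemma second_difference A f x u v (t : R) : Ck 2 A f ->
    (forall s s' : R, 0 <= s <= 1 -> 0 <= s' <= 1 ->
       A (x + s *: (t *: u) + s' *: (t *: v))) ->
  exists s s' : R, [/\ 0 <= s <= 1, 0 <= s' <= 1 &
    f (x + t *: u + t *: v) - f (x + t *: u) - (f (x + t *: v) - f x) =
    t * (t * 'D_v ('D_u f) (x + s *: (t *: u) + s' *: (t *: v)))].
Proof.
move=> fA HA; have df := Ck_differentiable fA; have Df w := Ck_derive w fA.
have i0 : 0 <= (0 : R) <= 1 by apply/andP.
have i1 : 0 <= (1 : R) <= 1 by apply/andP.
have dfs (s s' : R) : 0 <= s <= 1 -> 0 <= s' <= 1 ->
    differentiable f (x + s *: (t *: u) + s' *: (t *: v)).
  by move=> s1 s1'; apply: df; exact: HA.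
have dF (c : V) y : differentiable f (y + c) -> differentiable (fun y => f (y + c)) y.
  move=> H; apply: (@differentiable_comp _ _ _ _ (fun y => y + c) f) => //.
have d1 (s : R) : 0 <= s <= 1 ->
    differentiable (fun y => f (y + t *: v)) (x + s *: (t *: u)).
  by move=> s1; apply: dF; have := dfs s 1 s1 i1; rewrite scale1r.
have d0 (s : R) : 0 <= s <= 1 -> differentiable f (x + s *: (t *: u)).
  by move=> s1; have := dfs s 0 s1 i0; rewrite scale0r addr0.
have [s s01 ->] := @mvt_line _ _ (fun y => f (y + t *: v) - f y) x (t *: u)
  (fun s s1 => differentiableB (d1 s s1) (d0 s s1)).
have [s' s01' E] := @mvt_line _ _ ('D_u f) (x + s *: (t *: u)) (t *: v)
  (fun s' s1' => Ck_differentiable (Df u) (HA s s' s01 s1')).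
exists s, s'; split => //.
rewrite -[LHS]/('D_(t *: u) ((fun y => f (y + t *: v)) - f) (x + s *: (t *: u))).
rewrite deriveB; [|exact: diff_derivable (d1 s s01)|exact: diff_derivable (d0 s s01)].
have dZ (g : V -> R) w y : differentiable g y -> 'D_(t *: w) g y = t * 'D_w g y.
  by move=> dg; have := derivevD t w 0 dg; rewrite addr0 derive0 addr0.
rewrite derive_shiftE !dZ; [|exact: d0|]; last first.
  by have := dfs s 1 s01 i1; rewrite scale1r.
rewrite -mulrBr E dZ//.
by apply: Ck_differentiable (Df u) _; exact: HA.
Qed.

(** The mean value theorem, applied twice, makes the second difference of f
    over a small parallelogram a value of either mixed derivative. *)
Lemma schwarz A f x u v : open A -> Ck 2 A f -> A x ->
  'D_v ('D_u f) x = 'D_u ('D_v f) x.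
Proof.
move=> oA fA Ax; apply/eqP; rewrite -subr_eq0 -normr_eq0; apply/eqP.
have Df w := Ck_derive w fA.
apply/le_anti/andP; split => //; apply/ler_addgt0Pr => e e0; rewrite add0r.
have alg (a b c d : R) : a - b - (c - d) = a - c - (b - d) by ring.
have Hab (a b c : R) : `|a - c| < e / 2 -> `|b - c| < e / 2 -> `|a - b| <= e.
  move=> ac bc; rewrite -(subrKA c) (le_trans (ler_normD _ _))//.
  by rewrite [leRHS](splitr e) lerD// ltW// distrC.
have c1 := (Ck_derive v (Df u)) x Ax.
have c2 := (Ck_derive u (Df v)) x Ax.
have e20 : 0 < e / 2 by rewrite divr_gt0.
have /cvgrPdist_lt/(_ _ e20) n1 := c1.
have /cvgrPdist_lt/(_ _ e20) n2 := c2.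
have nA := open_near oA Ax.
have : \forall y \near x, [/\ A y, `|'D_v ('D_u f) x - 'D_v ('D_u f) y| < e / 2
    & `|'D_u ('D_v f) x - 'D_u ('D_v f) y| < e / 2].
  apply: filterS3 nA n1 n2; move=> y a b c; exact: And3 a b c.
move=> /nbhs_ballP[r /= r0 Hr].
(* keeps the parallelogram spanned by t u and t v in the ball of radius r *)
pose t := r / (`|u| + `|v| + 1).
have N0 : 0 < `|u| + `|v| + 1 by rewrite ltr_wpDl// addr_ge0.
have t0 : 0 < t by rewrite divr_gt0.
have HB (a b : V) (s s' : R) : `|a| + `|b| = `|u| + `|v| ->
    0 <= s <= 1 -> 0 <= s' <= 1 ->
    ball x r (x + s *: (t *: a) + s' *: (t *: b)).
  move=> ab /andP[s0 s1] /andP[s0' s1']; rewrite -ball_normE /= -addrA opprD addrA.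
  rewrite subrr add0r normrN (le_lt_trans (ler_normD _ _))//.
  rewrite !normrZ !ger0_norm//; last exact: ltW.
  apply: (@le_lt_trans _ _ (t * (`|a| + `|b|))).
    by rewrite mulrDr lerD// ler_piMl// mulr_ge0// ltW.
  by rewrite ab /t -mulrA gtr_pMr// mulrC ltr_pdivrMr// mul1r ltrDl.
have [s [s' [s1 s1' E1]]] := second_difference fA (fun s s' s1 s1' =>
  let: And3 H _ _ := Hr _ (HB u v s s' erefl s1 s1') in H).
have [z [z' [z1 z1' E2]]] := second_difference fA (fun s s' s1 s1' =>
  let: And3 H _ _ := Hr _ (HB v u s s' (addrC _ _) s1 s1') in H).
have E : 'D_v ('D_u f) (x + s *: (t *: u) + s' *: (t *: v)) =
         'D_u ('D_v f) (x + z *: (t *: v) + z' *: (t *: u)).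
  apply: (mulfI (lt0r_neq0 t0)); apply: (mulfI (lt0r_neq0 t0)).
  apply: etrans (esym E1) _; apply: etrans _ E2.
  rewrite (addrAC x (t *: v)); exact: alg.
have [_ H1 _] := Hr _ (HB u v s s' erefl s1 s1').
have [_ _ H2] := Hr _ (HB v u z z' (addrC _ _) z1 z1').
rewrite E in H1.
exact: Hab H1 H2.
Qed.

End schwarz.

Section bump.
Context {R : realType}.

Lemma Ck_id (V : normedModType R) k (A : set V) : Ck k A (fun x : V => x).
Proof. by apply: (@Ck_linear _ _ _ k A idfun) => x; exact: cvg_id. Qed.

Implicit Types (k n : nat) (x : R).

(** The family is closed under differentiation, which gives the smoothness of
    its member of index 0, the usual flat function. *)
Definition flat k x : R := if 0 < x then x ^- k * expR (- x^-1) else 0.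

Lemma flat_ge0 k x : 0 <= flat k x.
Proof.
rewrite /flat; case: ifP => // x0; rewrite mulr_ge0 ?expR_ge0//.
by rewrite invr_ge0 exprn_ge0// ltW.
Qed.

(** The factorial bounds x^-(k+2) exp (-1/x) through one term of the exponential
    series; the quadratic bound gives the derivative at 0. *)
Lemma flat_le k x : flat k x <= k.+2`!%:R * x ^+ 2.
Proof.
have F0 : (0 : R) < k.+2`!%:R by rewrite ltr0n fact_gt0.
rewrite /flat; case: ifP => x0; last first.
  by rewrite mulr_ge0// ?exprn_even_ge0// ltW.
have xi0 : 0 <= x^-1 by rewrite invr_ge0 ltW.
have H : x^-1 ^+ k.+2 / k.+2`!%:R <= expR x^-1.
  by apply: le_trans (expR_ge1Dxn k.+1 xi0); rewrite lerDr.
rewrite ler_pdivrMr// in H.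
have := ler_wpM2r (expR_ge0 (- x^-1)) H.
rewrite [in leRHS]mulrAC -expRD subrr expR0 mul1r => {}H.
have x20 : 0 <= x ^+ 2 by rewrite exprn_ge0// ltW.
have := ler_wpM2r x20 H; apply: le_trans.
rewrite le_eqVlt; apply/orP; left; apply/eqP.
rewrite mulrAC -addn2 exprD exprVn; congr (_ * _).
by rewrite -mulrA -exprMn mulVf ?gt_eqF// expr1n mulr1.
Qed.

Lemma flat0 k : flat k 0 = 0.
Proof. by rewrite /flat ltxx. Qed.

Lemma is_derive_flat k x :
  is_derive x 1 (flat k) (flat k.+2 x - k%:R * flat k.+1 x).
Proof.
have [x0|x0|->] := ltgtP x 0.
- have := near_eq_is_derive; move=> /(_ R R R (cst 0) (flat k) x 1 0) H.
  rewrite /flat !ltNge (ltW x0)/= mulr0 subr0; apply: H.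
  have : \forall y \near x, y < 0 by apply: open_near => //; exact: open_lt.
  by apply: filterS => y y0; rewrite /flat ltNge (ltW y0).
- apply: (@near_eq_is_derive R R R (fun y => y ^- k * expR (- y^-1)) (flat k) x 1).
    have : \forall y \near x, 0 < y by apply: open_near => //; exact: open_gt.
    by apply: filterS => y y0; rewrite /flat y0.
  have xn : x != 0 by rewrite gt_eqF.
  have xkn : x ^+ k != 0 by rewrite expf_neq0.
  have dX : is_derive x 1 (fun y : R => y ^+ k) (k%:R * x ^+ k.-1).
    have H := @is_deriveX R R id k x 1 1 (is_derive_id _ _).
    rewrite (_ : (fun y : R => y ^+ k) = id ^+ k); last first.
      by apply/funext => y; rewrite exprfctE.
    by apply: is_derive_eq H _; rewrite -[LHS]/(_ * 1) mulr1.
  have dXV := @is_deriveV _ (fun y : R => y ^+ k) x _ _ xkn dX.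
  have dI : is_derive x 1 (fun y : R => - y^-1) (x ^- 2).
    have H := is_deriveN (is_deriveV xn (is_derive_id x 1)).
    by apply: is_derive_eq H _; rewrite /= scaleNr opprK -[LHS]/(_ * 1) mulr1.
  have dE := is_derive1_comp (is_derive_expR _ ) dI.
  have H := is_deriveM dXV dE.
  apply: is_derive_eq H _; rewrite /flat x0 /=.
  rewrite -![_ *: _]/(_ * _).
  clear dX dXV.
  case: k xkn => [|k] xkn.
    by rewrite !mul0r !mulr0 addr0 subr0 expr0 invr1 mul1r mulrC.
  by rewrite /= !exprS; field; rewrite xn expf_neq0.
- rewrite !flat0 mulr0 subr0.
  have d0 : 'd (cst (0 : R)) (0 : R) = 0 :> (R -> R) := diff_cst _ _.
  have [d dE] : differentiable (flat k) (0 : R) /\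
      'd (flat k) (0 : R) = 'd (cst (0 : R)) (0 : R) :> (R -> R).
    apply: differentiable_eps; first by rewrite d0; exact: cst_continuous.
    move=> e e0; have c0 : 0 < (k.+2)`!%:R^-1 * e.
      by rewrite mulr_gt0// invr_gt0 ltr0n fact_gt0.
    apply: filterS (@nbhs0_le R R _ c0) => h hle; rewrite addr0 d0 flat0 !subr0 ger0_norm ?flat_ge0//.
    apply: le_trans (flat_le _ _) _.
    rewrite -real_normK ?num_real// expr2 mulrA ler_wpM2r// -ler_pdivlMl ?ltr0n ?fact_gt0//.
  apply: DeriveDef; first exact/derivable1_diffP.
  by rewrite deriveE// dE d0.
Qed.

Lemma Ck_flat k n : Ck n setT (flat k).
Proof.
elim: n k => [|n IH] k.
  move=> x _; apply: differentiable_continuous; apply/derivable1_diffP.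
  by have [] := is_derive_flat k x.
have df x : differentiable (flat k) x.
  by apply/derivable1_diffP; have [] := is_derive_flat k x.
split=> // v; apply: (Ck_eq openT _ (CkZ v openT (CkB openT (IH k.+2)
  (CkZ k%:R openT (IH k.+1))))) => x _.
by rewrite derive_scale1// (@derive_val _ _ _ _ _ _ _ (is_derive_flat k x)).
Qed.

Definition smooth_step x : R := flat 0 x / (flat 0 x + flat 0 (1 - x)).

Lemma flat0_gt0 x : 0 < x -> 0 < flat 0 x.
Proof. by move=> x0; rewrite /flat x0 expr0 invr1 mul1r expR_gt0. Qed.

Lemma flat0_eq0 x : x <= 0 -> flat 0 x = 0.
Proof. by move=> x0; rewrite /flat ltNge x0. Qed.

Lemma smooth_step_den x : 0 < flat 0 x + flat 0 (1 - x).
Proof.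
have [x0|x0] := ltP 0 x; first by rewrite ltr_wpDr ?flat_ge0// flat0_gt0.
by rewrite ltr_wpDl ?flat_ge0// flat0_gt0//; lra.
Qed.

Lemma smooth_step0 x : x <= 0 -> smooth_step x = 0.
Proof. by move=> x0; rewrite /smooth_step flat0_eq0// mul0r. Qed.

Lemma smooth_step1 x : 1 <= x -> smooth_step x = 1.
Proof.
move=> x1; rewrite /smooth_step (@flat0_eq0 (1 - x)) ?subr_le0// addr0 divff//.
by rewrite gt_eqF// flat0_gt0// (lt_le_trans _ x1).
Qed.

Lemma Ck_smooth_step k : Ck k setT smooth_step.
Proof.
have C1 : Ck k setT (fun x : R => flat 0 (1 - x)).
  apply: (@Ck_comp1 _ _ _ _ setT (fun x : R => 1 - x) (flat 0)) => //.
  - exact: openT.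
  - apply: CkB; [exact: openT|exact: (Ck_cst k setT (1 : R))|].
    exact: Ck_id.
  - exact: Ck_flat.
apply: CkM; [exact: openT|exact: Ck_flat|].
apply: CkV; [exact: openT| |].
  by move=> x _; rewrite gt_eqF// smooth_step_den.
apply: CkD; [exact: openT|exact: Ck_flat|exact: C1].
Qed.

Lemma coord_norm_le n (u : 'rV[R]_n) i : `|u 0 i| <= `|u|.
Proof.
rewrite [leRHS]/Num.Def.normr/= mx_normrE.
exact: (le_bigmax _ (fun ij : 'I_1 * 'I_n => `|u ij.1 ij.2|) (0, i)).
Qed.

Lemma norm_coord_le n (u : 'rV[R]_n) (e : R) : 0 <= e ->
  (forall i, `|u 0 i| <= e) -> `|u| <= e.
Proof.
move=> e0 H; rewrite /Num.Def.normr/= mx_normrE bigmax_le// => -[i j] _.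
by rewrite ord1; exact: H.
Qed.

Lemma norm_coord_lt n (u : 'rV[R]_n) (e : R) : 0 < e ->
  (forall i, `|u 0 i| < e) -> `|u| < e.
Proof.
move=> e0 H; rewrite /Num.Def.normr/= mx_normrE; apply/bigmax_ltP; split=> // -[i j] _.
by rewrite ord1; exact: H.
Qed.

Lemma Ck_coordinate n k (A : set 'rV[R]_n) i : Ck k A (fun u => u 0 i).
Proof.
have [L LE] : exists L : {linear 'rV[R]_n -> R}, (L : 'rV[R]_n -> R) = (fun u => u 0 i).
  have lin : linear (fun u : 'rV[R]_n => u 0 i) by move=> a u v; rewrite !mxE.
  pose Lm := GRing.isLinear.Build R 'rV[R]_n R *:%R _ lin.
  pose L : {linear 'rV[R]_n -> R} := HB.pack (fun u : 'rV[R]_n => u 0 i) Lm.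
  by exists L.
by rewrite -LE; apply: Ck_linear; rewrite LE; exact: coord_continuous.
Qed.

(** The sum of squares of the coordinates is smooth and dominates the square of
    the sup norm. *)
Lemma exists_bump n (u0 : 'rV[R]_n) (e : R) : 0 < e ->
  exists chi : 'rV[R]_n -> R, [/\ smooth_on setT chi,
    (\forall u \near u0, chi u = 1) & forall u, e <= `|u - u0| -> chi u = 0].
Proof.
move=> e0; pose s (u : 'rV[R]_n) := \sum_i (u 0 i - u0 0 i) ^+ 2.
have Cs k : Ck k setT s.
  apply: Ck_sum; first exact: openT.
  move=> i; have H : Ck k setT (fun u : 'rV[R]_n => u 0 i - u0 0 i).
    apply: CkB; [exact: openT|exact: Ck_coordinate|exact: (Ck_cst _ _ (u0 0 i))].
  apply: (CkM openT H H).
(* the argument is 0 where s = e^2 and at least 1 where s <= e^2 / 2 *)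
exists (fun u => smooth_step (2 - 2 * (e ^- 2) * s u)); split.
- move=> k; apply: (@Ck_comp1 _ _ _ _ setT (fun u => 2 - 2 * e ^- 2 * s u) smooth_step) => //.
  + exact: openT.
  + apply: CkB; [exact: openT|exact: (Ck_cst k setT (2 : R))|].
    by apply: CkZ; [exact: openT|exact: Cs].
  + exact: Ck_smooth_step.
- have s0 : s u0 = 0 by rewrite /s big1// => i _; rewrite subrr expr0n.
  have e2 : 0 < e ^+ 2 / 2 by rewrite divr_gt0// exprn_gt0.
  have /cvgrPdist_lt/(_ _ e2) := Cs 0%N u0 I.
  apply: filterS => u; rewrite s0 sub0r normrN => su.
  apply: smooth_step1; have {}su := le_lt_trans (ler_norm _) su.
  rewrite -subr_ge0 (_ : _ - 1 = 2 * e ^- 2 * (e ^+ 2 / 2 - s u)).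
    apply: mulr_ge0; last by rewrite subr_ge0 ltW.
    by rewrite mulr_ge0// invr_ge0 exprn_ge0// ltW.
  by field; rewrite gt_eqF.
- move=> u eu; apply: smooth_step0.
  have es : e ^+ 2 <= s u.
    rewrite leNgt; apply/negP => su; move: eu; rewrite leNgt => /negP; apply.
    apply: norm_coord_lt => // i; rewrite !mxE.
    rewrite -(@ltr_pXn2r _ 2) ?nnegrE// ?(ltW e0)// real_normK ?num_real//.
    apply: le_lt_trans su; rewrite /s (bigD1 i)//= lerDl sumr_ge0// => j _.
    by rewrite sqr_ge0.
  rewrite subr_le0 mulrAC -ler_pdivrMr ?invr_gt0 ?exprn_gt0// invrK.
  by rewrite ler_pM2l.
Qed.

End bump.

(** * Germs of smooth functions *)

Section germs.
Context {R : realType}.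
Implicit Types V W : normedModType R.

Lemma near_open (T : topologicalType) (P : T -> Prop) x :
  (\forall y \near x, P y) -> exists A, [/\ open A, A x & forall y, A y -> P y].
Proof.
move=> H; have : nbhs x P by exact: H.
by rewrite nbhsE => -[A [oA Ax] AP]; exists A.
Qed.

Lemma near_continuous (T U : topologicalType) (f : T -> U) (P : U -> Prop) x :
  {for x, continuous f} -> (\forall y \near f x, P y) -> \forall y \near x, P (f y).
Proof. by move=> fc H; apply: fc. Qed.

(** Germs dispense with tracking domains: a smoothness hypothesis near a point is
    all that the local arguments need. *)
Definition smooth_at V W (F : V -> W) (u : V) : Prop :=
  exists A, [/\ open A, A u & smooth_on A F].

Lemma smooth_at_on V W (A : set V) (F : V -> W) :
  (forall u, A u -> smooth_at F u) -> smooth_on A F.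
Proof.
by move=> H k; apply: Ck_loc => u /H[B [_ Bu HB]]; exists B.
Qed.

Lemma smooth_on_at V W (A : set V) (F : V -> W) u : open A ->
  smooth_on A F -> A u -> smooth_at F u.
Proof. by move=> oA FA Au; exists A. Qed.

Lemma smooth_at_near V W (F : V -> W) u : smooth_at F u ->
  \forall v \near u, smooth_at F v.
Proof.
by move=> [A [oA Au FA]]; apply: filterS (open_near oA Au) => v Av; exists A.
Qed.

Lemma smooth_at_eq V W (F G : V -> W) u :
  (\forall v \near u, F v = G v) -> smooth_at F u -> smooth_at G u.
Proof.
move=> /near_open[B [oB Bu BFG]] [A [oA Au FA]].
exists (A `&` B); split => //; first exact: openI.
move=> k; apply: (Ck_eq (openI oA oB) _ (Ck_sub (@subIsetl _ A B) (FA k))).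
by move=> x [_ /BFG].
Qed.

Lemma smooth_at_differentiable V W (F : V -> W) u :
  smooth_at F u -> differentiable F u.
Proof. by move=> [A [oA Au FA]]; exact: smooth_on_differentiable FA Au. Qed.

Lemma smooth_at_continuous V W (F : V -> W) u :
  smooth_at F u -> {for u, continuous F}.
Proof. by move=> [A [oA Au FA]]; exact: smooth_on_continuous FA Au. Qed.

Lemma smooth_at_derive V W (F : V -> W) u v :
  smooth_at F u -> smooth_at ('D_v F) u.
Proof.
by move=> [A [oA Au FA]]; exists A; split => //; exact: smooth_on_derive.
Qed.

Lemma smooth_at_cst V W (c : W) (u : V) : smooth_at (fun=> c) u.
Proof. by exists setT; split => //; [exact: openT|move=> k; exact: Ck_cst]. Qed.

Lemma smooth_at_coordinate n i (u : 'rV[R]_n) : smooth_at (fun x : 'rV[R]_n => x 0 i) u.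
Proof.
by exists setT; split => //; [exact: openT|move=> k; exact: Ck_coordinate].
Qed.

(** Transfers a closure property of C^k functions on open sets to germs. *)
Lemma smooth_at2 V W1 W2 W (F : V -> W1) (G : V -> W2) (H : V -> W) u :
  (forall A k, open A -> Ck k A F -> Ck k A G -> Ck k A H) ->
  smooth_at F u -> smooth_at G u -> smooth_at H u.
Proof.
move=> FGH [A [oA Au FA]] [B [oB Bu GB]]; exists (A `&` B); split => //.
  exact: openI.
move=> k; apply: FGH; first exact: openI.
  exact: Ck_sub (@subIsetl _ A B) (FA k).
exact: Ck_sub (@subIsetr _ A B) (GB k).
Qed.

Lemma smooth_atD V W (F G : V -> W) u : smooth_at F u -> smooth_at G u ->
  smooth_at (fun x => F x + G x) u.
Proof. by apply: smooth_at2 => A k; exact: CkD. Qed.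

Lemma smooth_atM V (F G : V -> R) u : smooth_at F u -> smooth_at G u ->
  smooth_at (fun x => F x * G x) u.
Proof. by apply: smooth_at2 => A k; exact: CkM. Qed.

Lemma smooth_atB V (F G : V -> R) u : smooth_at F u -> smooth_at G u ->
  smooth_at (fun x => F x - G x) u.
Proof. by apply: smooth_at2 => A k; exact: CkB. Qed.

Lemma smooth_atN V (F : V -> R) u : smooth_at F u -> smooth_at (fun x => - F x) u.
Proof. by move=> FA; apply: (smooth_at2 _ FA FA) => A k oA _; exact: CkN. Qed.

Lemma smooth_at_expR V (F : V -> R) u : smooth_at F u ->
  smooth_at (fun x => expR (F x)) u.
Proof.
move=> FA; apply: (smooth_at2 _ FA FA) => A k oA _ CF.
by apply: (@Ck_comp1 _ _ _ _ setT F (@expR R)) => //; exact: Ck_expR.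
Qed.

Lemma smooth_at_pos V (F : V -> R) u : {for u, continuous F} ->
  0 < F u -> exists A, [/\ open A, A u & forall x, A x -> 0 < F x].
Proof.
move=> Fc F0; have : \forall y \near F u, 0 < y.
  by apply: open_near => //; exact: open_gt.
by move=> /(near_continuous Fc)/near_open.
Qed.

Lemma smooth_at_restrict V (A : set V) W (F : V -> W) u : open A -> A u ->
  smooth_at F u -> exists B, [/\ open B, B u, B `<=` A & smooth_on B F].
Proof.
move=> oA Au [B [oB Bu FB]]; exists (A `&` B); split => //.
- exact: openI.
- by move=> k; exact: Ck_sub (@subIsetr _ A B) (FB k).
Qed.

Lemma smooth_at_sqrt V (F : V -> R) u : 0 < F u -> smooth_at F u ->
  smooth_at (fun x => Num.sqrt (F x)) u.
Proof.
move=> F0 FA; have [A [oA Au HA]] := smooth_at_pos (smooth_at_continuous FA) F0.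
have [B [oB Bu BA FB]] := smooth_at_restrict oA Au FA.
by exists B; split => // k; apply: Ck_sqrt => // x /BA; exact: HA.
Qed.

Lemma smooth_atV V (F : V -> R) u : F u != 0 -> smooth_at F u ->
  smooth_at (fun x => (F x)^-1) u.
Proof.
move=> F0 FA; have F2 := smooth_atM FA FA.
have [|A [oA Au HA]] := smooth_at_pos (smooth_at_continuous F2).
  by rewrite lt0r mulf_neq0//= -expr2 sqr_ge0.
have [B [oB Bu BA FB]] := smooth_at_restrict oA Au FA.
exists B; split => // k; apply: CkV => // x /BA/HA; apply: contraTneq => ->.
by rewrite mul0r ltxx.
Qed.

Lemma smooth_at_coord V n (F : V -> 'rV[R]_n) u i : smooth_at F u ->
  smooth_at (fun x => F x 0 i) u.
Proof. by move=> FA; apply: (smooth_at2 _ FA FA) => A k oA _; exact: Ck_coord. Qed.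

Lemma smooth_at_big V W (I : Type) (s : seq I) (F : I -> V -> W) u :
  (forall i, smooth_at (F i) u) -> smooth_at (fun x => \sum_(i <- s) F i x) u.
Proof.
move=> FA; elim: s => [|i s IH].
  by apply: smooth_at_eq (smooth_at_cst _ _); near=> v; rewrite big_nil.
apply: smooth_at_eq (smooth_atD (FA i) IH).
by near=> v; rewrite big_cons.
Unshelve. all: by end_near. Qed.

Lemma smooth_atZ V n (F : V -> R) (G : V -> 'rV[R]_n) u : smooth_at F u ->
  smooth_at G u -> smooth_at (fun x => F x *: G x) u.
Proof.
apply: smooth_at2 => A k oA CF CG; apply: Ck_rV => // i.
by apply: (Ck_eq oA _ (CkM oA CF (Ck_coord i oA CG))) => x _; rewrite mxE.
Qed.

Lemma smooth_at_rV V n (F : V -> 'rV[R]_n) u :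
  (forall i, smooth_at (fun x => F x 0 i) u) -> smooth_at F u.
Proof.
move=> FA; have := smooth_at_big (index_enum _)
  (fun i => smooth_atZ (FA i) (smooth_at_cst (delta_mx 0 i : 'rV[R]_n) u)).
by apply: smooth_at_eq; near=> v; rewrite [RHS]row_sum_delta.
Unshelve. all: by end_near. Qed.

Lemma smooth_at_comp V n (F : V -> 'rV[R]_n) (G : 'rV[R]_n -> R) u :
  smooth_at F u -> smooth_at G (F u) -> smooth_at (G \o F) u.
Proof.
move=> FA [B [oB Bu GB]]; have cF := smooth_at_continuous FA.
have /near_open[A [oA Au AB]] := near_continuous cF (open_near oB Bu).
have [C [oC Cu CA FC]] := smooth_at_restrict oA Au FA.
exists C; split => // k; apply: (Ck_comp oC _ (FC k) (GB k)) => x /CA; exact: AB.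
Qed.

Lemma smooth_at_comp_rV V n m (F : V -> 'rV[R]_n) (G : 'rV[R]_n -> 'rV[R]_m) u :
  smooth_at F u -> smooth_at G (F u) -> smooth_at (G \o F) u.
Proof.
move=> FA GA; apply: smooth_at_rV => i.
exact: (@smooth_at_comp _ _ F (fun x => G x 0 i)) (smooth_at_coord i GA).
Qed.

Lemma smooth_at_derivev n m (F : 'rV[R]_n -> 'rV[R]_m)
    (X : 'rV[R]_n -> 'rV[R]_n) u :
  smooth_at F u -> smooth_at X u -> smooth_at (fun x => 'D_(X x) F x) u.
Proof.
move=> FA XA; have := smooth_at_big (index_enum _)
  (fun i => smooth_atZ (smooth_at_coord i XA) (smooth_at_derive (delta_mx 0 i) FA)).
apply: smooth_at_eq; apply: filterS (smooth_at_near FA) => x.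
by move=> /smooth_at_differentiable dF; rewrite [RHS]derive_basis.
Qed.

Lemma derive_scalev V n (F : V -> R) (G : V -> 'rV[R]_n) u v :
  differentiable F u -> differentiable G u ->
  'D_v (fun x => F x *: G x) u = 'D_v F u *: G u + F u *: 'D_v G u.
Proof.
move=> dF dG; have dGi i := differentiable_rVi i dG.
have E i : (fun x => (F x *: G x) 0 i) = F * (fun x => G x 0 i).
  by apply/funext => x; rewrite mxE.
have dFG : differentiable (fun x => F x *: G x) u.
  by apply: differentiable_rV => i; rewrite E; exact: differentiableM.
apply/rowP => i; rewrite derive_rV// E deriveM//; try exact: diff_derivable.
by rewrite !mxE derive_rV// addrC; congr (_ + _); exact: mulrC.
Qed.

Lemma schwarz_at V (f : V -> R) x u v : smooth_at f x ->
  'D_v ('D_u f) x = 'D_u ('D_v f) x.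
Proof. by move=> [A [oA Ax fA]]; exact: schwarz oA (fA 2) Ax. Qed.

(** Since second derivatives commute, only first derivatives of the two
    vector fields survive in the commutator of the operators they define. *)
Lemma derive_commutator n (f : 'rV[R]_n -> R) (X Y : 'rV[R]_n -> 'rV[R]_n) u :
  smooth_at f u -> smooth_at X u -> smooth_at Y u ->
  'D_('D_(X u) Y u - 'D_(Y u) X u) f u =
  'D_(X u) (fun x => 'D_(Y x) f x) u - 'D_(Y u) (fun x => 'D_(X x) f x) u.
Proof.
move=> fA XA YA.
pose H i j := 'D_(delta_mx 0 j) ('D_(delta_mx 0 i) f) u.
have D2 (w : 'rV[R]_n) i : 'D_w ('D_(delta_mx 0 i) f) u = \sum_j w 0 j * H i j.
  by rewrite derive_basis//; apply: smooth_at_differentiable; exact: smooth_at_derive.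
have HC i j : H i j = H j i by exact: schwarz_at.
have key (Z : 'rV[R]_n -> 'rV[R]_n) w : smooth_at Z u ->
    'D_w (fun x => 'D_(Z x) f x) u =
    'D_('D_w Z u) f u + \sum_i Z u 0 i * \sum_j w 0 j * H i j.
  move=> ZA.
  have -> : 'D_w (fun x => 'D_(Z x) f x) u =
      'D_w (\sum_i ((fun x => Z x 0 i) * 'D_(delta_mx 0 i) f)) u.
    apply: near_eq_derive; apply: filterS (smooth_at_near fA) => x.
    move=> /smooth_at_differentiable df; rewrite derive_basis// fct_sumE.
    by [].
  have dZ i : derivable (fun x => Z x 0 i) u w.
    apply: diff_derivable; apply: smooth_at_differentiable.
    exact: smooth_at_coord.
  have dDf i : derivable ('D_(delta_mx 0 i) f) u w.
    apply: diff_derivable; apply: smooth_at_differentiable.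
    exact: smooth_at_derive.
  rewrite derive_sum; last by move=> i; exact: derivableM.
  rewrite (derive_basis ('D_w Z u) (smooth_at_differentiable fA)) -big_split.
  apply: eq_bigr => i _ /=; rewrite deriveM//.
  rewrite derive_rV; last exact: smooth_at_differentiable.
  rewrite [RHS]addrC; congr (_ + _); first exact: (congr1 (fun r => Z u 0 i * r) (D2 w i)).
  by rewrite -[LHS]/(_ * _) -[RHS]/(_ * _) mulrC.
have df := smooth_at_differentiable fA.
rewrite !key// addrC -scaleN1r derivevD// scaleN1r addrC.
rewrite opprD addrACA -[LHS]addr0; congr (_ + _); apply/esym/eqP.
rewrite subr_eq0; apply/eqP.
clearbody H; clear -HC.
under eq_bigr => i _ do rewrite big_distrr/=.
under [RHS]eq_bigr => i _ do rewrite big_distrr/=.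
rewrite exchange_big /=; apply: eq_bigr => i _; apply: eq_bigr => j _.
by rewrite HC mulrCA.
Qed.

End germs.

(** * Poincare's lemma on a ball *)

Section parametric_integral.
Context {R : realType}.
Notation mu := (@lebesgue_measure R).

Lemma continuous_for_within (f : R -> R) (a b : R) :
  (forall t, a <= t <= b -> {for t, continuous f}) ->
  {within `[a, b], continuous f}.
Proof.
move=> fc; apply: continuous_in_subspaceT => t; rewrite inE /= in_itv /=; exact: fc.
Qed.

(** If the derivative of the integrand with respect to the parameter has the
    primitive Phi in the integration variable, then the derivative of the
    integral is an increment of Phi. *)
Lemma derive_integral (k dk : R -> R -> R) (Phi : R -> R) (d C : R) : 0 < d ->
  (forall s t : R, `|s| < d -> 0 <= t <= 1 -> {for t, continuous (k s)}) ->
  (forall s t : R, `|s| < d -> 0 <= t <= 1 ->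
     is_derive s 1 (k ^~ t) (dk s t)) ->
  (forall s t : R, `|s| < d -> 0 <= t <= 1 -> `|dk s t| <= C) ->
  (forall t : R, 0 <= t <= 1 -> is_derive t 1 Phi (dk 0 t)) ->
  (forall t : R, 0 <= t <= 1 -> {for t, continuous (dk 0)}) ->
  is_derive (0 : R) 1 (fun s : R => \int[mu]_(t in `[0, 1]) k s t)
    (Phi 1 - Phi 0).
Proof.
move=> d0 kc kd dC Phid dkc.
have I0 : (`](- d), d[%classic : set R) 0 by rewrite /= in_itv /= oppr_lt0 d0.
have Id (s : R) : (`](- d), d[%classic : set R) s -> `|s| < d.
  by rewrite /= in_itv /= ltr_norml.
have B01 (t : R) : (`[0, 1]%classic : set R) t -> 0 <= t <= 1.
  by rewrite /= in_itv.
have mB : measurable (`[0, 1]%classic : set R) by exact: measurable_itv.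
have C0 : 0 <= C.
  have z : `|0 : R| < d by rewrite normr0.
  by apply: le_trans (dC 0 0 z _); rewrite ?normr_ge0// lexx ler01.
have int (s : R) : (`](- d), d[%classic : set R) s ->
    mu.-integrable `[0, 1] (EFin \o k s).
  move=> /Id sd; apply: continuous_compact_integrable; first exact: segment_compact.
  by apply: continuous_for_within => t; exact: kc.
have der s t : (`](- d), d[%classic : set R) s -> (`[0, 1]%classic : set R) t ->
    derivable (k ^~ t) s 1.
  by move=> /Id sd /B01 t01; have [] := kd s t sd t01.
have intC : mu.-integrable `[0, 1] (EFin \o (fun=> C)).
  apply: continuous_compact_integrable; first exact: segment_compact.
  by apply: continuous_for_within => t _; exact: cvg_cst.
have bd s t : (`](- d), d[%classic : set R) s -> (`[0, 1]%classic : set R) t ->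
    `|partial1of2 k s t| <= C.
  move=> /Id sd /B01 t01; rewrite partial1of2E.
  by have -> := @derive_val _ _ _ _ _ _ _ (kd s t sd t01); exact: dC.
 have D := @derivable_under_integral R _ (measurableTypeR R) mu k _ mB 0 (- d) d I0 int der
  (fun=> C) (fun=> C0) intC bd.
have V := @differentiation_under_integral R _ (measurableTypeR R) mu k _ mB 0 (- d) d I0 int der
  (fun=> C) (fun=> C0) intC bd.
apply: DeriveDef; first exact: D.
rewrite -derive1E V.
have z : `|0 : R| < d by rewrite normr0.
rewrite (@eq_Rintegral _ _ _ mu _ (dk 0)); last first.
  move=> t; rewrite inE => /B01 t01; rewrite partial1of2E.
  exact: (@derive_val _ _ _ _ _ _ _ (kd 0 t z t01)).
rewrite /Rintegral (@continuous_FTC2 _ (dk 0) Phi 0 1 ltr01).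
- by rewrite -EFinB.
- exact: continuous_for_within.
- have Pc (t : R) : 0 <= t <= 1 -> {for t, continuous Phi}.
    move=> /Phid dP; apply: differentiable_continuous; apply/derivable1_diffP.
    by have [] := dP.
  split.
  + move=> t; rewrite in_itv /= => /andP[t0 t1].
    by have [] := Phid t _; rewrite ?(ltW t0) ?(ltW t1).
  + by apply: cvg_at_right_filter; apply: Pc; rewrite lexx ler01.
  + by apply: cvg_at_left_filter; apply: Pc; rewrite lexx ler01.
- move=> t; rewrite in_itv /= => /andP[t0 t1]; rewrite derive1E.
  by apply: (@derive_val _ _ _ _ _ _ _ (Phid t _)); rewrite !ltW.
Qed.

End parametric_integral.

Section poincare.
Context {R : realType} {n : nat}.
Notation mu := (@lebesgue_measure R).
Implicit Types (u v w p : 'rV[R]_n).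

Lemma ball_rV u0 (r : R) u : ball u0 r u <-> `|u - u0| < r.
Proof. by rewrite -ball_normE /= distrC. Qed.

Lemma smooth_at_bounded (f : 'rV[R]_n -> R) u0 (r : R) :
  (forall u, `|u - u0| <= r -> smooth_at f u) ->
  exists C, forall u, `|u - u0| <= r -> `|f u| <= C.
Proof.
move=> fs; have [r0|r0] := ltP 0 r; last first.
  exists `|f u0| => u /le_trans/(_ r0); rewrite normr_le0 subr_eq0 => /eqP ->//.
have cB : compact (closed_ball u0 r).
  apply: bounded_closed_compact; last exact: closed_ball_closed.
  rewrite closed_ballE//; exists (`|u0| + r); split; first exact: num_real.
  move=> N uN u; rewrite /closed_ball_ /= => ue.
  have -> : u = u0 - (u0 - u) by rewrite opprB addrC subrK.
  apply: le_trans (ler_normB _ _) _.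
  by apply: le_trans (ltW uN); rewrite lerD2l.
have cf : compact (f @` closed_ball u0 r).
  apply: continuous_compact => //; apply: continuous_in_subspaceT => u.
  rewrite inE closed_ballE// /closed_ball_ /= => ur.
  by apply: smooth_at_continuous; apply: fs; rewrite distrC.
have [N [_ HN]] := compact_bounded cf.
exists (N + 1) => u ur; apply: (HN (N + 1)); first by rewrite ltrDl.
by exists u => //; rewrite closed_ballE// /closed_ball_ /= distrC.
Qed.

Lemma ball_convex u0 p q (r : R) (t : R) : 0 <= t <= 1 -> `|p - u0| < r ->
  `|q - u0| < r -> `|p + t *: (q - p) - u0| < r.
Proof.
move=> /andP[t0 t1] pr qr.
have -> : p + t *: (q - p) - u0 = (1 - t) *: (p - u0) + t *: (q - u0).
  by apply/rowP => i; rewrite !mxE; ring.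
have [->|tn0] := eqVneq t 0; first by rewrite subr0 scale1r scale0r addr0.
apply: le_lt_trans (ler_normD _ _) _; rewrite !normrZ !ger0_norm ?subr_ge0//.
have -> : r = (1 - t) * r + t * r by ring.
by rewrite ler_ltD// ?ltr_pM2l ?lt0r ?tn0// ler_wpM2l ?subr_ge0// ltW.
Qed.

Definition pairing (th : 'I_n -> 'rV[R]_n -> R) u v : R := \sum_i th i u * v 0 i.

Section primitive.
Variables (u0 : 'rV[R]_n) (r : R) (th : 'I_n -> 'rV[R]_n -> R).
Hypothesis th_smooth : forall i u, `|u - u0| < r -> smooth_at (th i) u.
Hypothesis th_closed : forall i j u, `|u - u0| < r ->
  'D_(delta_mx 0 i) (th j) u = 'D_(delta_mx 0 j) (th i) u.

(** The integral of the one-form th along the segment from the centre u0. *)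
Definition radial_primitive u : R :=
  \int[mu]_(t in `[0, 1]) pairing th (u0 + t *: (u - u0)) (u - u0).

Lemma pairing_closed u v w : `|u - u0| < r ->
  \sum_i 'D_w (th i) u * v 0 i = \sum_i 'D_v (th i) u * w 0 i.
Proof.
move=> ur; have dth i := smooth_at_differentiable (th_smooth i ur).
under eq_bigr do rewrite derive_basis// big_distrl.
under [RHS]eq_bigr do rewrite derive_basis// big_distrl.
rewrite exchange_big; apply: eq_bigr => i _; apply: eq_bigr => j _ /=.
by rewrite th_closed// -![_ *: _]/(_ * _); ring.
Qed.

(** Closedness makes the derivative of the integrand along v the derivative in
    t of t * th (u0 + t (p - u0)) v. *)
Lemma radial_primitive_line p v : `|p - u0| < r ->
  is_derive (0 : R) 1 (fun s : R => radial_primitive (p + s *: v)) (pairing th p v).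
Proof.
move=> pr; pose r' := (`|p - u0| + r) / 2.
have pr' : `|p - u0| < r' by rewrite /r'; lra.
have r'r : r' < r by rewrite /r'; lra.
have V0 : 0 < `|v| + 1 by rewrite ltr_wpDl.
pose d := (r' - `|p - u0|) / (`|v| + 1).
have d0 : 0 < d by rewrite divr_gt0// subr_gt0.
pose Y (s : R) := p + s *: v - u0.
have Yr (s : R) : `|s| < d -> `|Y s| <= r'.
  move=> sd; rewrite /Y addrAC; apply: le_trans (ler_normD _ _) _.
  rewrite -lerBrDl normrZ; move: sd; rewrite /d ltr_pdivlMr// => /ltW.
  by apply: le_trans; rewrite ler_wpM2l// lerDl.
pose x (s t : R) := u0 + t *: Y s.
have xr' (s t : R) : `|s| < d -> 0 <= t <= 1 -> `|x s t - u0| <= r'.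
  move=> /Yr sr /andP[t0 t1]; rewrite addrC addKr normrZ ger0_norm//.
  by apply: le_trans sr; rewrite ler_piMl.
have xr (s t : R) : `|s| < d -> 0 <= t <= 1 -> `|x s t - u0| < r.
  by move=> sd t01; apply: le_lt_trans r'r; exact: xr'.
have z0 : `|0 : R| < d by rewrite normr0.
pose k (s t : R) := pairing th (x s t) (Y s).
pose dk (s t : R) := \sum_i (t * 'D_v (th i) (x s t) * Y s 0 i + th i (x s t) * v 0 i).
(* primitive in t of the derivative at s = 0 of the integrand *)
pose Phi (t : R) := t * pairing th (x 0 t) v.
have Y0 : Y 0 = p - u0 by rewrite /Y scale0r addr0.
have cx (s t : R) : {for t, continuous (x s)}.
  apply: differentiable_continuous.
  have H := is_diffD (is_diff_cst u0 t) (is_diff_scalel t (Y s)).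
  by case: H.
have cth (f : 'rV[R]_n -> R) (s t : R) : smooth_at f (x s t) ->
    {for t, continuous (fun t => f (x s t))}.
  move=> fs; apply: (@continuous_comp _ _ _ (x s) f); first exact: cx.
  exact: smooth_at_continuous.
have csum (g : 'I_n -> R -> R) (t : R) : (forall i, {for t, continuous (g i)}) ->
    {for t, continuous (fun t => \sum_i g i t)}.
  move=> gc; change ((fun t => \sum_i g i t) @ t --> \sum_i g i t).
  elim: (index_enum _) => [|j l IH].
    under eq_fun do rewrite big_nil; rewrite big_nil; exact: cvg_cst.
  by under eq_fun do rewrite big_cons; rewrite big_cons; apply: cvgD => //; exact: gc.
have kc (s t : R) : `|s| < d -> 0 <= t <= 1 -> {for t, continuous (k s)}.
  move=> sd t01; apply: csum => i; apply: cvgM; last exact: cvg_cst.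
  exact: (cth (th i) s t (th_smooth i (xr s t sd t01))).
have dkc (t : R) : 0 <= t <= 1 -> {for t, continuous (dk 0)}.
  move=> t01; have ths i := th_smooth i (xr 0 t z0 t01).
  apply: csum => i; apply: cvgD; apply: cvgM; try exact: cvg_cst.
    apply: cvgM; first exact: cvg_id.
    exact: (cth ('D_v (th i)) 0 t (smooth_at_derive v (ths i))).
  exact: (cth (th i) 0 t (ths i)).
have dline (s t : R) i w c : smooth_at (th i) (c + s *: w) ->
    is_derive s 1 (fun s : R => th i (c + s *: w)) ('D_w (th i) (c + s *: w)).
  by move=> H; apply: line_derive; exact: smooth_at_differentiable.
have sumE (g : 'I_n -> R -> R) : (fun s => \sum_i g i s) = \sum_i g i.
  by apply/funext => s; rewrite fct_sumE.
have kd (s t : R) : `|s| < d -> 0 <= t <= 1 -> is_derive s 1 (k ^~ t) (dk s t).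
  move=> sd t01; rewrite /k /pairing /dk (sumE (fun i s => th i (x s t) * Y s 0 i)).
  apply: is_derive_sum => i.
  have xE s' : x s' t = (u0 + t *: (p - u0)) + s' *: (t *: v).
    by rewrite /x /Y; apply/rowP => j; rewrite !mxE; ring.
  have ths := th_smooth i (xr s t sd t01).
  have d1 : is_derive s 1 (fun s => th i (x s t)) (t * 'D_v (th i) (x s t)).
    have -> : (fun s => th i (x s t)) =
        (fun s' => th i ((u0 + t *: (p - u0)) + s' *: (t *: v))).
      by apply/funext => s'; rewrite xE.
    have := @dline s t i (t *: v) (u0 + t *: (p - u0)).
    rewrite -xE => /(_ ths) H; apply: is_derive_eq H _.
    have dt := smooth_at_differentiable ths.
    by have := derivevD t v 0 dt; rewrite addr0 derive0 addr0.
  have d2 : is_derive s 1 (fun s => Y s 0 i) (v 0 i).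
    have -> : (fun s => Y s 0 i) = (fun s => (p - u0) 0 i + s * v 0 i).
      by apply/funext => s'; rewrite /Y !mxE; ring.
    have H := is_deriveD (is_derive_cst ((p - u0) 0 i) s 1)
      (is_deriveM (is_derive_id s 1) (is_derive_cst (v 0 i) s 1)).
    apply: is_derive_eq H _.
    by rewrite scaler0 !add0r -[LHS]/(_ * _) mulr1.
  apply: is_derive_eq (is_deriveM d1 d2) _.
  by rewrite -![_ *: _]/(_ * _) addrC [Y s 0 i * _]mulrC.
have thA i : exists C, forall u, `|u - u0| <= r' -> `|th i u| <= C.
  by apply: smooth_at_bounded => u /le_lt_trans/(_ r'r); exact: th_smooth.
have thB i : exists C, forall u, `|u - u0| <= r' -> `|'D_v (th i) u| <= C.
  apply: smooth_at_bounded => u /le_lt_trans/(_ r'r) ur.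
  by apply: smooth_at_derive; exact: th_smooth.
have [A HA] := choice thA; have [B HB] := choice thB.
have r'0 : 0 <= r' by apply: le_trans (ltW pr').
have dkb (s t : R) : `|s| < d -> 0 <= t <= 1 ->
    `|dk s t| <= \sum_i (B i * r' + A i * `|v|).
  move=> sd t01; apply: le_trans (ler_norm_sum _ _ _) _; apply: ler_sum => i _.
  apply: le_trans (ler_normD _ _) _; rewrite !normrM.
  have := HB i _ (xr' s t sd t01); have := HA i _ (xr' s t sd t01).
  have := le_trans (coord_norm_le (Y s) i) (Yr s sd); have := coord_norm_le v i.
  case/andP: t01 => t0 t1 h1 h2 h3 h4.
  rewrite (ger0_norm t0); apply: lerD; apply: ler_pM => //; first by rewrite mulr_ge0.
  by apply: le_trans h4; rewrite ler_piMl.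
have Phid (t : R) : 0 <= t <= 1 -> is_derive t 1 Phi (dk 0 t).
  move=> t01; have ths i := th_smooth i (xr 0 t z0 t01).
  have xE t' : x 0 t' = u0 + t' *: (p - u0) by rewrite /x Y0.
  have d1 : is_derive t 1 (fun t => pairing th (x 0 t) v)
      (\sum_i 'D_(p - u0) (th i) (x 0 t) * v 0 i).
    rewrite /pairing (sumE (fun i t => th i (x 0 t) * v 0 i)).
    apply: is_derive_sum => i.
    have d2 : is_derive t 1 (fun t => th i (x 0 t)) ('D_(p - u0) (th i) (x 0 t)).
      have -> : (fun t => th i (x 0 t)) = (fun t => th i (u0 + t *: (p - u0))).
        by apply/funext => t'; rewrite xE.
      by rewrite xE; apply: dline => //; rewrite -xE.
    apply: is_derive_eq (is_deriveM d2 (is_derive_cst (v 0 i) t 1)) _.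
    by rewrite scaler0 add0r -[LHS]/(_ * _) mulrC.
  apply: is_derive_eq (is_deriveM (is_derive_id t 1) d1) _.
  rewrite (pairing_closed v (p - u0) (xr 0 t z0 t01)) /dk Y0 big_split /=.
  congr (_ + _); last by rewrite -[LHS]/(_ * _) mulr1.
  rewrite -[LHS]/(_ * _) big_distrr /=; apply: eq_bigr => i _.
  by rewrite mulrA.
have := derive_integral d0 kc kd dkb Phid dkc.
rewrite /Phi mul1r mul0r subr0 /x scale1r Y0 addrC subrK.
by [].
Qed.

Lemma radial_primitive_mvt p q : `|p - u0| < r -> `|q - u0| < r ->
  exists2 s : R, 0 <= s <= 1 & radial_primitive q - radial_primitive p =
    pairing th (p + s *: (q - p)) (q - p).
Proof.
move=> pr qr; set v := q - p.
have der (s : R) : 0 <= s <= 1 ->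
    is_derive s 1 (fun s => radial_primitive (p + s *: v)) (pairing th (p + s *: v) v).
  move=> s01; have H := @radial_primitive_line (p + s *: v) v (ball_convex s01 pr qr).
  have dS : is_derive s 1 (fun t : R => t - s) 1.
    have := is_deriveB (is_derive_id s 1) (is_derive_cst s s 1).
    by move=> D; apply: is_derive_eq D _; rewrite subr0.
  have H' : is_derive ((fun t : R => t - s) s) 1
      (fun t : R => radial_primitive (p + s *: v + t *: v)) (pairing th (p + s *: v) v).
    by rewrite /= subrr.
  have := @is_derive1_comp _ _ (fun t : R => t - s) s _ _ H' dS; rewrite mulr1.
  have -> // : (fun t : R => radial_primitive (p + s *: v + t *: v)) \o (fun t => t - s) =
    (fun s => radial_primitive (p + s *: v)).
  by apply/funext => t /=; rewrite -addrA -scalerDl [s + _]addrC subrK.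
have [t|t|c c01] := @MVT _ (fun s => radial_primitive (p + s *: v))
  (fun s => pairing th (p + s *: v) v) 0 1 ltr01.
- by rewrite in_itv /= => /andP[t0 t1]; apply: der; rewrite !ltW.
- apply: derivable_within_continuous => s; rewrite in_itv/= => /der H.
  exact: ex_derive.
- rewrite scale1r scale0r addr0 subr0 mulr1 /v [p + _]addrC subrK => ->; exists c => //.
  by move: c01; rewrite in_itv/= => /andP[? ?]; rewrite !ltW.
Qed.

Lemma pairing_linear u : linear (pairing th u).
Proof.
move=> a v w; rewrite /pairing scaler_sumr -big_split; apply: eq_bigr => i _ /=.
by rewrite !mxE -[a *: _]/(a * _); ring.
Qed.

(** Directional derivatives do not give differentiability by themselves; the mean
    value form of the increment and the continuity of th do. *)
Lemma radial_primitive_diff u : `|u - u0| < r ->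
  differentiable radial_primitive u /\
  forall v, 'D_v radial_primitive u = pairing th u v.
Proof.
move=> ur.
pose Lm := GRing.isLinear.Build R 'rV[R]_n R *:%R _ (pairing_linear u).
pose L : {linear 'rV[R]_n -> R} := HB.pack (pairing th u) Lm.
have Lc : continuous L.
  move=> v; apply: smooth_at_continuous; apply: smooth_at_big => i.
  by apply: smooth_atM; [exact: smooth_at_cst|exact: smooth_at_coordinate].
have [dF dE] : differentiable radial_primitive u /\ 'd radial_primitive u = L :> (_ -> _).
  apply: differentiable_eps => // e e0.
  pose e' := e / n.+1%:R; have e'0 : 0 < e' by rewrite divr_gt0.
  have : \forall y \near u, `|y - u0| < r /\ forall i, `|th i y - th i u| <= e'.
    apply: filterI.
      have : \forall y \near u, ball u0 r y.
        by apply: open_near; [exact: ball_open|exact/ball_rV].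
      by apply: filterS => y /ball_rV.
    have Hi i : \forall y \near u, `|th i y - th i u| <= e'.
      have /cvgrPdist_le/(_ _ e'0) := smooth_at_continuous (th_smooth i ur).
      by apply: filterS => y; rewrite distrC.
    exact: (filter_forall _ Hi).
  move=> /nbhs_ballP[d /= d0 Hd].
  have := @nbhs0_lt R 'rV[R]_n _ d0; apply: filterS => h hd.
  have [hr _] : `|h + u - u0| < r /\ forall i, `|th i (h + u) - th i u| <= e'.
    by apply: Hd; apply/ball_rV; rewrite addrK.
  have [s s01 ->] := radial_primitive_mvt ur hr; rewrite addrK.
  have [_ He] : `|u + s *: h - u0| < r /\
      forall i, `|th i (u + s *: h) - th i u| <= e'.
    apply: Hd; apply/ball_rV; rewrite addrC addKr normrZ.
    case/andP: s01 => s0 s1; rewrite ger0_norm//.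
    by apply: le_lt_trans hd; rewrite ler_piMl.
  rewrite [X in `|X|](_ : _ = pairing th (u + s *: h) h - pairing th u h)// /pairing -sumrB.
  apply: le_trans (ler_norm_sum _ _ _) _.
  apply: (@le_trans _ _ (\sum_(i < n) e' * `|h|)).
    apply: ler_sum => i _; rewrite -mulrBl normrM ler_pM//; exact: coord_norm_le.
  rewrite sumr_const card_ord -mulrnAl ler_wpM2r// /e' -mulr_natr -mulrA.
  apply: ler_piMr; first exact: ltW.
  by rewrite ler_pdivrMl ?ltr0n// mulr1 ler_nat.
by split=> // v; rewrite deriveE// dE.
Qed.

End primitive.

(** Poincare's lemma for one-forms on a ball. *)
Lemma poincare u0 (r : R) (th : 'I_n -> 'rV[R]_n -> R) :
  (forall i u, `|u - u0| < r -> smooth_at (th i) u) ->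
  (forall i j u, `|u - u0| < r ->
    'D_(delta_mx 0 i) (th j) u = 'D_(delta_mx 0 j) (th i) u) ->
  exists F : 'rV[R]_n -> R, forall u, `|u - u0| < r ->
    smooth_at F u /\ forall v, 'D_v F u = pairing th u v.
Proof.
move=> ths thc; exists (radial_primitive u0 th).
have H := radial_primitive_diff ths thc; move=> u ur; split; last exact: (H u ur).2.
exists (ball u0 r); split; [exact: ball_open|exact/ball_rV|].
case=> [|k].
  by move=> x /ball_rV xr; apply: differentiable_continuous; exact: (H x xr).1.
split=> [x /ball_rV xr|v]; first exact: (H x xr).1.
have sv : smooth_on (ball u0 r) (fun x => pairing th x v).
  apply: smooth_at_on => x /ball_rV xr; apply: smooth_at_big => i.
  by apply: smooth_atM; [exact: ths|exact: smooth_at_cst].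
apply: (Ck_eq (@ball_open _ _ u0 r) _ (sv k)) => x /ball_rV xr.
by rewrite (H x xr).2.
Qed.

End poincare.

(** * The inverse function theorem for a dual frame *)

(** Matrices over a realType inherit the completeness needed by Banach's
    fixed point theorem. *)
HB.instance Definition _ (R : realType) (m n : nat) := NormedModule.on 'M[R]_(m, n).

Section local_inverse.
Context {R : realType} {n : nat}.
Implicit Types (u v w y : 'rV[R]_n).

(** The linear map with columns e; along a frame dual to F it is the inverse of
    the differential of F. *)
Definition combine (e : 'I_n -> 'rV[R]_n) y : 'rV[R]_n := \sum_j y 0 j *: e j.

Lemma combineE e y : combine e y = y *m (\matrix_(i < n) e i).
Proof. by rewrite mulmx_sum_row; apply: eq_bigr => i _; rewrite rowK. Qed.

Lemma combineB e y y' : combine e (y - y') = combine e y - combine e y'.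
Proof. by rewrite !combineE mulmxBl. Qed.

Lemma combineP e a y y' : combine e (a *: y + y') = a *: combine e y + combine e y'.
Proof. by rewrite !combineE mulmxDl scalemxAl. Qed.

Lemma combine_norm e y : `|combine e y| <= (\sum_j `|e j|) * `|y|.
Proof.
apply: le_trans (ler_norm_sum _ _ _) _; rewrite mulr_suml; apply: ler_sum => j _.
by rewrite normrZ mulrC ler_wpM2l//; exact: coord_norm_le.
Qed.

(** A right inverse of an endomorphism of a finite-dimensional space is also a
    left inverse. *)
Lemma combine_inverse e (D : {linear 'rV[R]_n -> 'rV[R]_n}) :
  (forall i, D (e i) = delta_mx 0 i) ->
  (forall v, combine e (D v) = v) /\ (forall y, combine e y = 0 -> y = 0).
Proof.
move=> De; have Dc y : D (combine e y) = y.
  rewrite linear_sum [RHS]row_sum_delta; apply: eq_bigr => i _.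
  by rewrite linearZ /= De.
have c0 y : combine e y = 0 -> y = 0 by move=> y0; rewrite -(Dc y) y0 linear0.
have Au : (\matrix_(i < n) e i) \in unitmx.
  by rewrite -row_free_unit; apply: inj_row_free => y; rewrite -combineE; exact: c0.
split=> // v; have vE : v = combine e (v *m invmx (\matrix_(i < n) e i)).
  by rewrite combineE mulmxKV.
by rewrite {1}vE Dc -vE.
Qed.

Section with_frame.
Variables (Om : set 'rV[R]_n) (F : 'rV[R]_n -> 'rV[R]_n).
Variables (E : 'I_n -> 'rV[R]_n -> 'rV[R]_n) (u0 : 'rV[R]_n).
Hypothesis oOm : open Om.
Hypothesis Om0 : Om u0.
Hypothesis Fs : smooth_on Om F.
Hypothesis Es : forall i, smooth_on Om (E i).
Hypothesis FE : forall i u, Om u -> 'D_(E i u) F u = delta_mx 0 i.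

Let dF u : Om u -> differentiable F u.
Proof. exact: smooth_on_differentiable Fs. Qed.

Lemma frame_inverse u : Om u ->
  (forall v, combine (E^~ u) ('D_v F u) = v) /\
  (forall y, combine (E^~ u) y = 0 -> y = 0).
Proof.
move=> Ou; have [|H1 H2] := @combine_inverse (E^~ u) ('d F u).
  by move=> i; rewrite -deriveE ?FE//; exact: dF.
by split=> // v; rewrite deriveE; [exact: H1|exact: dF].
Qed.

Let K : R := \sum_j `|E j u0|.
(** The Newton step for the equation F u = 0, with the differential frozen at u0. *)
Let phi u : 'rV[R]_n := u - combine (E^~ u0) (F u).

Let K0 : 0 <= K. Proof. exact: sumr_ge0. Qed.

Lemma newton_smooth u : Om u -> smooth_at phi u.
Proof.
move=> Ou; have Fu := smooth_on_at oOm Fs Ou.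
have cs : smooth_at (fun u => combine (E^~ u0) (F u)) u.
  apply: smooth_at_big => j; apply: smooth_atZ; last exact: smooth_at_cst.
  exact: smooth_at_coord.
apply: smooth_at_rV => i.
have := smooth_atB (smooth_at_coordinate i u) (smooth_at_coord i cs).
by apply: smooth_at_eq; near=> x; rewrite !mxE.
Unshelve. all: by end_near. Qed.

Lemma newton_derive v : 'D_v phi u0 = 0.
Proof.
have := (frame_inverse Om0).1 v.
have dFi j : differentiable (fun u => F u 0 j) u0 by apply: differentiable_rVi; exact: dF.
have dc j : differentiable (fun u => F u 0 j *: E j u0) u0.
  exact: differentiableZl.
have -> : phi = id - \sum_j (fun u => F u 0 j *: E j u0).
  by apply/funext => u; rewrite /phi /combine -[RHS]/(u - (\sum_j (fun u => F u 0 j *: E j u0)) u)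
    fct_sumE.
rewrite deriveB//; last first.
  by apply: diff_derivable; exact: differentiable_sum.
rewrite derive_id derive_sum; last by move=> j; exact: diff_derivable.
move=> vE; rewrite -[X in X - _]vE /combine; apply/eqP; rewrite subr_eq0; apply/eqP.
apply: eq_bigr => j _; rewrite derive_rV; last exact: dF.
rewrite (derive_scalev v (dFi j) (differentiable_cst (E j u0) u0)).
by rewrite derive_cst scaler0 addr0.
Qed.

(** The differential of phi vanishes at u0, hence is small near u0. *)
Lemma newton_contraction : exists2 r : R, 0 < r &
  (forall u, `|u - u0| < r -> Om u) /\
  forall u v, `|u - u0| < r -> `|v - u0| < r ->
    `|phi u - phi v| <= 2^-1 * `|u - v|.
Proof.
(* n partial derivatives of size e sum to at most 1/2 *)
pose e : R := (2 * n.+1%:R)^-1; have e0 : 0 < e by rewrite invr_gt0 mulr_gt0.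
have : \forall u \near u0, Om u /\ forall j, `|'D_(delta_mx 0 j) phi u| < e.
  apply: filterI; first exact: (open_near oOm Om0).
  have Hj j : \forall u \near u0, `|'D_(delta_mx 0 j) phi u| < e.
    have /cvgrPdist_lt/(_ _ e0) := smooth_at_continuous
      (smooth_at_derive (delta_mx 0 j) (newton_smooth Om0)).
    by apply: filterS => u; rewrite newton_derive sub0r normrN.
  exact: (filter_forall _ Hj).
move=> /nbhs_ballP[r /= r0 Hr]; exists r => //; split.
  by move=> u ur; have [] := Hr u ((ball_rV u0 r u).2 ur).
move=> u v ur vr; apply: norm_coord_le; first by rewrite mulr_ge0.
move=> i; have -> : (phi u - phi v) 0 i = phi u 0 i - phi v 0 i.
  by rewrite mxE [X in _ + X]mxE.
have dphi t : 0 <= t <= 1 -> differentiable (fun u => phi u 0 i) (v + t *: (u - v)).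
  move=> t01; apply: differentiable_rVi; apply: smooth_at_differentiable.
  apply: newton_smooth; have cr := ball_convex t01 vr ur.
  by have [] := Hr _ ((ball_rV u0 r _).2 cr).
have [t t01] := mvt_line dphi.
rewrite [v + _]addrC subrK => E1.
have -> : phi u 0 i - phi v 0 i = 'D_(u - v) (fun u => phi u 0 i) (v + t *: (u - v)) := E1.
have [Oc Hc] := Hr _ ((ball_rV u0 r _).2 (ball_convex t01 vr ur)).
rewrite derive_basis; last exact: dphi.
apply: le_trans (ler_norm_sum _ _ _) _.
apply: (@le_trans _ _ (\sum_(j < n) e * `|u - v|)).
  apply: ler_sum => j _; rewrite -[X in `|X|]/(_ * _) normrM mulrC ler_pM//.
    rewrite -derive_rV; last by apply: smooth_at_differentiable; exact: newton_smooth.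
    by apply: le_trans (coord_norm_le _ _) _; exact: ltW.
  exact: coord_norm_le.
rewrite sumr_const card_ord -mulrnAl ler_wpM2r// /e invfM -mulr_natr -mulrA.
apply: ler_piMr; first by rewrite invr_ge0.
by rewrite ler_pdivrMl ?ltr0n// mulr1 ler_nat.
Qed.

(** Newton's iteration u |-> phi u + L w, with L the inverse of the differential
    at u0, has a fixed point for w near F u0; it solves F u = w. *)
Lemma exists_preimage (r : R) : 0 < r ->
  (forall u, `|u - u0| < r -> Om u) ->
  (forall u v, `|u - u0| < r -> `|v - u0| < r ->
    `|phi u - phi v| <= 2^-1 * `|u - v|) ->
  forall w, `|w - F u0| < r / 4 / (K + 1) ->
  exists2 u, `|u - u0| < r & F u = w.
Proof.
move=> r0 rO rphi w wr; pose L := combine (E^~ u0).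
pose U := closed_ball u0 (r / 2); have r20 : 0 < r / 2 by rewrite divr_gt0.
have UE u : U u <-> `|u - u0| <= r / 2.
  by rewrite /U closed_ballE// /closed_ball_ /= distrC.
have Ur u : U u -> `|u - u0| < r by move=> /UE; lra.
pose T u := phi u + L w.
have Tlip u v : U u -> U v -> `|T u - T v| <= 2^-1 * `|u - v|.
  move=> /Ur ur /Ur vr; rewrite /T opprD addrACA subrr addr0; exact: rphi.
have T0 : T u0 - u0 = L (w - F u0).
  by rewrite /T /phi /L combineB; apply/rowP => i; rewrite !mxE; ring.
have LT : `|T u0 - u0| <= r / 4.
  rewrite T0; apply: le_trans (combine_norm _ _) _.
  have K1 : 0 < K + 1 by rewrite ltr_wpDl.
  move: wr; rewrite ltr_pdivlMr// mulrC => /ltW; apply: le_trans.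
  by rewrite ler_wpM2r// lerDl.
have TU : {homo T : u / U u >-> U u}.
  move=> u Uu; apply/UE; have U0 : U u0 by apply/UE; rewrite subrr normr0 ltW.
  have := Tlip u u0 Uu U0; move/UE: Uu => Uu H.
  rewrite -(subrKA (T u0)); apply: le_trans (ler_normD _ _) _.
  by move: H LT Uu; move: `|_| `|_| `|_| => a b c; lra.
have [u Uu uT] : exists2 u, U u & u = T u.
  apply: (@banach_fixed_point R 'rV[R]_n U (mkfun TU)).
  - exists (2^-1)%:nng; split; first by rewrite /=; lra.
    by move=> [x y] /= [Ux Uy]; exact: Tlip.
  - exact: closed_ball_closed.
  - by exists u0; apply/UE; rewrite subrr normr0 ltW.
exists u; first exact: Ur.
have Z : L (w - F u) = 0.
  rewrite /L combineB; move: uT; rewrite /T /phi -/(L _) => /eqP.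
  rewrite -subr_eq0 => /eqP uT; rewrite -/(L w) -/(L (F u)) -[RHS]oppr0 -uT.
  by apply/rowP => i; rewrite !mxE; ring.
by have /eqP := (frame_inverse Om0).2 _ Z; rewrite subr_eq0 => /eqP ->.
Qed.

(** Inverse function theorem for F with a given frame E inverting its
    differential on all of Om: the derivative of the inverse G is the frame at G,
    which yields the smoothness of G by induction. *)
Lemma local_inverse : exists (r rho : R) (G : 'rV[R]_n -> 'rV[R]_n),
  [/\ 0 < r, 0 < rho, (forall u, `|u - u0| < r -> Om u),
    (forall u, `|u - u0| < r -> `|F u - F u0| < rho -> G (F u) = u) &
    [/\ (forall w, `|w - F u0| < rho -> `|G w - u0| < r /\ F (G w) = w),
      smooth_on (ball (F u0) rho) G &
      forall i w, `|w - F u0| < rho -> 'D_(delta_mx 0 i) G w = E i (G w)]].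
Proof.
have [r r0 [rO rphi]] := newton_contraction.
pose rho := r / 4 / (K + 1); have K1 : 0 < K + 1 by rewrite ltr_wpDl.
have rho0 : 0 < rho by rewrite !divr_gt0.
have ex w : exists u, `|w - F u0| < rho -> `|u - u0| < r /\ F u = w.
  have [wr|wr] := boolP (`|w - F u0| < rho); last by exists u0.
  by have [u ur Fu] := exists_preimage r0 rO rphi wr; exists u.
have [G HG] := choice ex; exists r, rho, G.
(* F expands distances because u - combine (F u) contracts them by 1/2 *)
have lip u v : `|u - u0| < r -> `|v - u0| < r -> `|u - v| <= 2 * K * `|F u - F v|.
  move=> ur vr; have H := rphi u v ur vr.
  have E1 : u - v = (phi u - phi v) + combine (E^~ u0) (F u - F v).
    by rewrite combineB /phi; apply/rowP => i; rewrite !mxE; ring.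
  have H2 := combine_norm (E^~ u0) (F u - F v); rewrite -/K in H2.
  have H3 : `|u - v| <= `|phi u - phi v| + `|combine (E^~ u0) (F u - F v)|.
    by rewrite {1}E1; exact: ler_normD.
  move: H H2 H3; move: `|u - v| `|phi u - phi v| `|combine _ _| => a b c; nra.
have GF u : `|u - u0| < r -> `|F u - F u0| < rho -> G (F u) = u.
  move=> ur Fr; have [Gr FG] := HG _ Fr; have := lip _ _ Gr ur.
  by rewrite FG subrr normr0 mulr0 normr_le0 subr_eq0 => /eqP.
have dG w : `|w - F u0| < rho -> differentiable G w /\
    forall v, 'D_v G w = combine (E^~ (G w)) v.
  move=> wr; have [Gr FG] := HG w wr; have Ou := rO _ Gr.
  have lin : linear (combine (E^~ (G w))) by move=> a y y'; exact: combineP.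
  pose Lm := GRing.isLinear.Build R 'rV[R]_n 'rV[R]_n *:%R _ lin.
  pose L : {linear 'rV[R]_n -> 'rV[R]_n} := HB.pack (combine (E^~ (G w))) Lm.
  have Lc : continuous L.
    move=> v; apply: smooth_at_continuous; apply: smooth_at_big => j.
    by apply: smooth_atZ; [exact: smooth_at_coordinate|exact: smooth_at_cst].
  have [dGw dE] : differentiable G w /\ 'd G w = L :> (_ -> _).
    apply: differentiable_eps => // e e0.
    pose Ku : R := \sum_j `|E j (G w)|.
    have Ku0 : 0 <= Ku by exact: sumr_ge0.
    have Ku1 : 0 < Ku + 1 by rewrite ltr_wpDl.
    (* absorbs the norm of the inverse differential and the Lipschitz constant of G *)
    pose e' := e / (Ku + 1) / (2 * (K + 1)).
    have e'0 : 0 < e' by rewrite !divr_gt0// mulr_gt0.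
    have [d d0 Hd] : exists2 d, 0 < d & forall h, `|h| < d ->
        `|F (h + G w) - F (G w) - 'D_h F (G w)| <= e' * `|h|.
      have /nbhs_ballP[d /= d0 Hd] := differentiable_epsE (dF Ou) e'0.
      by exists d => // h hd; apply: Hd; apply/ball_rV; rewrite subr0.
    pose d' := Num.min (rho - `|w - F u0|) (d / (2 * (K + 1))).
    have d'0 : 0 < d' by rewrite lt_min subr_gt0 wr divr_gt0// mulr_gt0.
    have := @nbhs0_lt R 'rV[R]_n _ d'0; apply: filterS => h.
    rewrite lt_min => /andP[h1 h2].
    have hr : `|h + w - F u0| < rho.
      rewrite -addrA; apply: le_lt_trans (ler_normD _ _) _; lra.
    have [Hr FH] := HG _ hr.
    have hle : `|G (h + w) - G w| <= 2 * (K + 1) * `|h|.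
      have := lip _ _ Hr Gr; rewrite FH FG addrK => /le_trans; apply.
      by rewrite ler_wpM2r// ler_pM2l// lerDl.
    have hd : `|G (h + w) - G w| < d.
      apply: le_lt_trans hle _; rewrite mulrC -ltr_pdivlMr// mulr_gt0//.
    have := Hd _ hd; rewrite subrK FH FG addrK => rem.
    have -> : G (h + w) - G w - L h =
        - L (h - 'D_(G (h + w) - G w) F (G w)).
      have LE y : L y = combine (E^~ (G w)) y by [].
      by rewrite !LE combineB (frame_inverse Ou).1 opprB.
    rewrite normrN; apply: le_trans (combine_norm (E^~ (G w)) _) _; rewrite -/Ku.
    apply: (@le_trans _ _ ((Ku + 1) * (e' * (2 * (K + 1) * `|h|)))).
      apply: ler_pM => //; first by rewrite lerDl.
      by apply: le_trans rem _; rewrite ler_pM2l.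
    rewrite /e' le_eqVlt; apply/orP; left; apply/eqP; field.
    by rewrite !gt_eqF.
  by split=> // v; rewrite deriveE// dE.
have oB : open (ball (F u0) rho) by exact: ball_open.
split => //; split => //.
  elim=> [|k IH].
    by move=> w /ball_rV wr; apply: differentiable_continuous; exact: (dG w wr).1.
  split=> [w /ball_rV wr|v]; first exact: (dG w wr).1.
  have EG j : Ck k (ball (F u0) rho) (E j \o G).
    apply: (Ck_comp_rV oB oOm _ IH (Es j k)) => w /ball_rV wr.
    by apply: rO; exact: (HG w wr).1.
  have H : Ck k (ball (F u0) rho) (fun w => combine (E^~ (G w)) v).
    apply: Ck_sum => // j; apply: Ck_rV => // i.
    apply: (Ck_eq oB _ (CkZ (v 0 j) oB (Ck_coord i oB (EG j)))) => x _.
    by rewrite mxE.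
  by apply: (Ck_eq oB _ H) => w /ball_rV wr; rewrite (dG w wr).2.
move=> i w wr; rewrite (dG w wr).2 /combine (bigD1 i)//= mxE !eqxx scale1r.
by rewrite big1 ?addr0// => j ji; rewrite mxE (negbTE ji) andbF scale0r.
Qed.

End with_frame.
End local_inverse.

(** * Smooth functions and vector fields on a manifold *)

#[local] Opaque derive.

Section charts.
Context {R : realType} {n : nat} {M : smooth_manifold R n}.
Implicit Types (c d : chart R n M) (p q : M) (f : M -> R) (X Y : vector_field M).

Notation img c := (chart_map c @` chart_dom c).

Lemma chart_inv_dom c u : img c u -> chart_dom c (chart_inv c u).
Proof. by move=> [q cq <-]; rewrite chart_mapK. Qed.

Lemma chart_invK c u : img c u -> chart_map c (chart_inv c u) = u.
Proof. by move=> [q cq <-]; rewrite chart_mapK. Qed.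

Lemma chart_img c q : chart_dom c q -> img c (chart_map c q).
Proof. by move=> cq; exists q. Qed.
Hint Resolve chart_img : core.

Lemma near_chart_inv c q (P : M -> Prop) : chart_dom c q ->
  (\forall x \near q, P x) -> \forall u \near chart_map c q, P (chart_inv c u).
Proof.
move=> cq; rewrite -{1}(chart_mapK cq).
by apply: near_continuous; exact: chart_inv_cont.
Qed.

Lemma near_chart_map c q (P : 'rV[R]_n -> Prop) : chart_dom c q ->
  (\forall u \near chart_map c q, P u) -> \forall x \near q, P (chart_map c x).
Proof. by move=> cq; apply: near_continuous; exact: chart_map_cont. Qed.

Lemma near_dom c q : chart_dom c q -> \forall x \near q, chart_dom c x.
Proof. by move=> cq; apply: open_nbhs_nbhs; split => //; exact: chart_dom_open. Qed.

Lemma near_img c q : chart_dom c q -> \forall u \near chart_map c q, img c u.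
Proof. by move=> cq; apply: open_near; [exact: chart_img_open|exact: chart_img]. Qed.

Lemma near_chart c q (P : 'rV[R]_n -> Prop) : chart_dom c q ->
  (\forall x \near q, P (chart_map c x)) -> \forall u \near chart_map c q, P u.
Proof.
move=> cq /(near_chart_inv cq) H; apply: filterS2 H (near_img cq) => u + iu.
by rewrite chart_invK.
Qed.

Lemma open_img c (U : set M) : open U -> open (chart_map c @` (chart_dom c `&` U)).
Proof.
move=> oU; rewrite openE => _ [q [cq Uq] <-].
have nU : \forall x \near q, U x by exact: open_nbhs_nbhs.
change (\forall u \near chart_map c q, (chart_map c @` (chart_dom c `&` U)) u).
apply: near_chart => //; apply: filterS2 (near_dom cq) nU => x cx Ux.
by exists x.
Qed.

(** Smoothness of the transition maps, in germ form. *)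
Lemma transition_smooth c d q : atlas c -> atlas d -> chart_dom c q ->
  chart_dom d q -> smooth_at (chart_map d \o chart_inv c) (chart_map c q).
Proof.
move=> ac ad cq dq; have [H _] := atlas_compatible ac ad.
apply: (smooth_on_at _ H); last by exists q.
by apply: open_img; exact: chart_dom_open.
Qed.

Lemma near_transition c d q W (F : M -> W) : chart_dom c q -> chart_dom d q ->
  \forall u \near chart_map c q,
    (F \o chart_inv d) ((chart_map d \o chart_inv c) u) = (F \o chart_inv c) u.
Proof.
move=> cq dq; have := near_chart_inv cq (near_dom dq).
by apply: filterS => u du /=; rewrite chart_mapK.
Qed.

Lemma smooth_at_transition c d q f : atlas c -> atlas d -> chart_dom c q ->
  chart_dom d q -> smooth_at (f \o chart_inv d) (chart_map d q) ->
  smooth_at (f \o chart_inv c) (chart_map c q).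
Proof.
move=> ac ad cq dq fd; apply: (smooth_at_eq (near_transition f cq dq)).
apply: (@smooth_at_comp _ _ _ (chart_map d \o chart_inv c)).
  exact: transition_smooth.
by rewrite /= chart_mapK.
Qed.

(** Smoothness at q tested in a single chart, which suffices by [smfE]. *)
Definition smf f q := smooth_at (f \o chart_inv (chart_at q)) (chart_map (chart_at q) q).

Lemma smfE c f q : atlas c -> chart_dom c q ->
  smf f q <-> smooth_at (f \o chart_inv c) (chart_map c q).
Proof.
move=> ac cq; have aq := chart_at_atlas q; have qq := chart_at_dom q.
by split; apply: smooth_at_transition.
Qed.

Lemma smf_near f q : smf f q -> \forall x \near q, smf f x.
Proof.
have aq := chart_at_atlas q; have qq := chart_at_dom q.
move=> /smooth_at_near/(near_chart_map qq) H.
apply: filterS2 H (near_dom qq) => x fx qx.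
by rewrite (smfE f aq qx).
Qed.

Lemma smf_eq f f' q : (\forall x \near q, f x = f' x) -> smf f q -> smf f' q.
Proof.
move=> ff'; apply: smooth_at_eq; exact: near_chart_inv (chart_at_dom q) ff'.
Qed.

Lemma smooth_funP (U : set M) f : open U ->
  smooth_fun U f <-> forall q, U q -> smf f q.
Proof.
move=> oU; split=> [H q Uq|H c ac].
  apply: (smooth_on_at _ (H _ (chart_at_atlas q))); first exact: open_img.
  by exists q => //; split => //; exact: chart_at_dom.
by apply: smooth_at_on => _ [q [cq Uq] <-]; apply/smfE => //; exact: H.
Qed.

Lemma smf_cst (a : R) q : smf (fun=> a) q.
Proof. exact: smooth_at_cst. Qed.
Lemma smfD f f' q : smf f q -> smf f' q -> smf (fun x => f x + f' x) q.
Proof. exact: smooth_atD. Qed.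
Lemma smfB f f' q : smf f q -> smf f' q -> smf (fun x => f x - f' x) q.
Proof. exact: smooth_atB. Qed.
Lemma smfM f f' q : smf f q -> smf f' q -> smf (fun x => f x * f' x) q.
Proof. exact: smooth_atM. Qed.
Lemma smfN f q : smf f q -> smf (fun x => - f x) q.
Proof. exact: smooth_atN. Qed.
Lemma smf_sum (I : Type) (s : seq I) (f : I -> M -> R) q :
  (forall i, smf (f i) q) -> smf (fun x => \sum_(i <- s) f i x) q.
Proof. exact: smooth_at_big. Qed.
Lemma smfV f q : f q != 0 -> smf f q -> smf (fun x => (f x)^-1) q.
Proof.
by move=> f0; apply: smooth_atV; rewrite /= chart_mapK//; exact: chart_at_dom.
Qed.
Lemma smf_sqrt f q : 0 < f q -> smf f q -> smf (fun x => Num.sqrt (f x)) q.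
Proof.
by move=> f0; apply: smooth_at_sqrt; rewrite /= chart_mapK//; exact: chart_at_dom.
Qed.

Lemma smf_continuous f q : smf f q -> {for q, continuous f}.
Proof.
have qq := chart_at_dom q.
move=> /smooth_at_continuous fc P; rewrite /= -{1}(chart_mapK qq) => /fc H.
have := near_chart_map qq H; apply: filterS2 (near_dom qq) => x qx /=.
by rewrite chart_mapK.
Qed.

Lemma chart_coord_smf c i q : atlas c -> chart_dom c q ->
  smf (fun x => chart_map c x 0 i) q.
Proof.
move=> ac cq; apply/(smfE _ ac cq).
have : smooth_at (fun u : 'rV[R]_n => u 0 i) (chart_map c q).
  exact: smooth_at_coordinate.
apply: smooth_at_eq; apply: filterS (near_img cq) => u iu /=.
by rewrite chart_invK.
Qed.

(** ** Components of tangent vectors *)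

Lemma derive_transition (W : normedModType R) c d q v (F : M -> W) :
  atlas c -> atlas d -> chart_dom c q ->
  chart_dom d q -> differentiable (F \o chart_inv d) (chart_map d q) ->
  'D_v (F \o chart_inv c) (chart_map c q) =
  'D_('D_v (chart_map d \o chart_inv c) (chart_map c q))
     (F \o chart_inv d) (chart_map d q).
Proof.
move=> ac ad cq dq dF.
rewrite -(near_eq_derive v (near_transition F cq dq)).
rewrite -[LHS]/('D_v ((F \o chart_inv d) \o (chart_map d \o chart_inv c)) _).
rewrite derive_comp /= ?chart_mapK//.
by apply: smooth_at_differentiable; exact: transition_smooth.
Qed.

Lemma derive_transition_id c q v : chart_dom c q ->
  'D_v (chart_map c \o chart_inv c) (chart_map c q) = v.
Proof.
move=> cq; rewrite -[RHS](derive_id (chart_map c q)); apply: near_eq_derive.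
by apply: filterS (near_img cq) => u iu; rewrite /= chart_invK.
Qed.

Lemma tcoord_chart_at q (v : tangent q) : tcoord (chart_at q) v = v.
Proof. by apply: derive_transition_id; exact: chart_at_dom. Qed.

Lemma tcoordP c q (a : R) (v w : tangent q) : atlas c -> chart_dom c q ->
  tcoord c (a *: v + w) = a *: tcoord c v + tcoord c w.
Proof.
move=> ac cq; apply: derivevD; apply: smooth_at_differentiable.
by apply: transition_smooth => //; [exact: chart_at_atlas|exact: chart_at_dom].
Qed.

(** The tangent vector at q with components w in the chart c. *)
Definition tuncoord c q (w : 'rV[R]_n) : tangent q :=
  'D_w (chart_map (chart_at q) \o chart_inv c) (chart_map c q).

Lemma tuncoordK c q w : atlas c -> chart_dom c q -> tcoord c (tuncoord c q w) = w.
Proof.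
move=> ac cq; have aq := chart_at_atlas q; have qq := chart_at_dom q.
rewrite /tcoord /tuncoord -(@derive_transition _ c (chart_at q) q w) //.
  exact: derive_transition_id.
by apply: smooth_at_differentiable; exact: transition_smooth.
Qed.

Lemma tcoordK c q (v : tangent q) : atlas c -> chart_dom c q ->
  tuncoord c q (tcoord c v) = v.
Proof.
move=> ac cq; have aq := chart_at_atlas q; have qq := chart_at_dom q.
rewrite /tcoord /tuncoord -(@derive_transition _ (chart_at q) c q v) //.
  exact: derive_transition_id.
by apply: smooth_at_differentiable; exact: transition_smooth.
Qed.

Lemma tcoord_inj c q (v w : tangent q) : atlas c -> chart_dom c q ->
  tcoord c v = tcoord c w -> v = w.
Proof. by move=> ac cq E; rewrite -(tcoordK v ac cq) E (tcoordK w ac cq). Qed.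

Lemma tcoord_coord_field c i q : atlas c -> chart_dom c q ->
  tcoord c (coord_field c i q) = delta_mx 0 i.
Proof. exact: tuncoordK. Qed.

Lemma tcoord0 c q : atlas c -> chart_dom c q -> tcoord c (0 : tangent q) = 0.
Proof. by move=> ac cq; rewrite /tcoord derive0. Qed.

Lemma tcoordD c q (v w : tangent q) : atlas c -> chart_dom c q ->
  tcoord c (v + w) = tcoord c v + tcoord c w.
Proof. by move=> ac cq; rewrite -[v]scale1r (tcoordP 1 _ _ ac cq) !scale1r. Qed.

Lemma tcoordZ c q a (v : tangent q) : atlas c -> chart_dom c q ->
  tcoord c (a *: v) = a *: tcoord c v.
Proof.
by move=> ac cq; rewrite -[a *: v]addr0 (tcoordP a v 0 ac cq) (tcoord0 ac cq) addr0.
Qed.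

Lemma tcoord_sum c q (I : Type) (s : seq I) (v : I -> tangent q) :
  atlas c -> chart_dom c q ->
  tcoord c (\sum_(i <- s) v i) = \sum_(i <- s) tcoord c (v i).
Proof.
move=> ac cq; elim: s => [|i s IH]; first by rewrite !big_nil (tcoord0 ac cq).
by rewrite !big_cons (tcoordD _ _ ac cq) IH.
Qed.

Lemma tangent_expand c q (v : tangent q) : atlas c -> chart_dom c q ->
  v = \sum_i tcoord c v 0 i *: coord_field c i q.
Proof.
move=> ac cq; apply: (tcoord_inj ac cq).
rewrite (tcoord_sum _ _ ac cq) {1}[tcoord c v]row_sum_delta.
apply: eq_bigr => i _.
by rewrite (tcoordZ _ _ ac cq) (tcoord_coord_field i ac cq).
Qed.

Lemma differentialE c f q (v : tangent q) : atlas c -> chart_dom c q -> smf f q ->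
  differential f q v = 'D_(tcoord c v) (f \o chart_inv c) (chart_map c q).
Proof.
move=> ac cq fq; apply: derive_transition => //.
- exact: chart_at_atlas.
- exact: chart_at_dom.
- by apply: smooth_at_differentiable; apply/smfE.
Qed.

Lemma differential_chart_coord c i q (v : tangent q) : atlas c -> chart_dom c q ->
  differential (fun x => chart_map c x 0 i) q v = tcoord c v 0 i.
Proof.
move=> ac cq; rewrite /tcoord derive_rV//; apply: smooth_at_differentiable.
by apply: transition_smooth => //; [exact: chart_at_atlas|exact: chart_at_dom].
Qed.

(** ** Differentials *)

Lemma smf_differentiable f q : smf f q ->
  differentiable (f \o chart_inv (chart_at q)) (chart_map (chart_at q) q).
Proof. exact: smooth_at_differentiable. Qed.

Lemma smf_derivable f q (v : tangent q) : smf f q ->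
  derivable (f \o chart_inv (chart_at q)) (chart_map (chart_at q) q) v.
Proof. by move=> /smf_differentiable; exact: diff_derivable. Qed.

Lemma differential_linear f q a (v w : tangent q) : smf f q ->
  differential f q (a *: v + w) = a * differential f q v + differential f q w.
Proof. by move=> /smf_differentiable H; exact: derivevD. Qed.

Lemma differential_eq f f' q (v : tangent q) : (\forall x \near q, f x = f' x) ->
  differential f q v = differential f' q v.
Proof.
by move=> E; apply: near_eq_derive; exact: near_chart_inv (chart_at_dom q) E.
Qed.

Lemma differential_cst a q (v : tangent q) : differential (fun=> a) q v = 0.
Proof. exact: derive_cst. Qed.

Lemma differentialD f f' q (v : tangent q) : smf f q -> smf f' q ->
  differential (fun x => f x + f' x) q v = differential f q v + differential f' q v.
Proof.
move=> H H'; exact: (deriveD (smf_derivable H) (smf_derivable H')).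
Qed.

Lemma differentialN f q (v : tangent q) : smf f q ->
  differential (fun x => - f x) q v = - differential f q v.
Proof. move=> H; exact: (deriveN (smf_derivable H)). Qed.

Lemma differentialM f f' q (v : tangent q) : smf f q -> smf f' q ->
  differential (fun x => f x * f' x) q v =
  f q * differential f' q v + f' q * differential f q v.
Proof.
move=> H H'; have := deriveM (smf_derivable (v := v) H) (smf_derivable H').
by rewrite /= chart_mapK//; exact: chart_at_dom.
Qed.

(** ** Vector fields *)

(** As for functions, one chart suffices by [smXE]. *)
Definition smX X q :=
  smooth_at (field_in (chart_at q) X) (chart_map (chart_at q) q).

(** The components in c are the Jacobian of the transition map applied to those
    in d. *)
Lemma field_in_transition c d q X : atlas c -> atlas d -> chart_dom c q ->
  chart_dom d q -> \forall u \near chart_map c q,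
    'D_((field_in d X \o (chart_map d \o chart_inv c)) u)
      (chart_map c \o chart_inv d) ((chart_map d \o chart_inv c) u) =
    field_in c X u.
Proof.
move=> ac ad cq dq; apply: filterS2 (near_img cq) (near_chart_inv cq (near_dom dq)) => u.
move=> [x cx E]; subst u; rewrite /field_in /= !(chart_mapK cx) => dx.
rewrite !(chart_mapK dx).
rewrite [RHS](@derive_transition _ _ d)//; first exact: chart_at_atlas.
  exact: chart_at_dom.
by apply: smooth_at_differentiable; exact: transition_smooth.
Qed.

Lemma field_smooth_transition c d q X : atlas c -> atlas d -> chart_dom c q ->
  chart_dom d q -> smooth_at (field_in d X) (chart_map d q) ->
  smooth_at (field_in c X) (chart_map c q).
Proof.
move=> ac ad cq dq Xd; apply: smooth_at_eq (field_in_transition X ac ad cq dq) _.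
have t1 := transition_smooth ac ad cq dq.
have t2 := transition_smooth ad ac dq cq.
apply: (@smooth_at_comp_rV _ _ _ _ (chart_map d \o chart_inv c)
  (fun w => 'D_(field_in d X w) (chart_map c \o chart_inv d) w)) => //.
by rewrite /= chart_mapK//; exact: smooth_at_derivev.
Qed.

Lemma smXE c X q : atlas c -> chart_dom c q ->
  smX X q <-> smooth_at (field_in c X) (chart_map c q).
Proof.
move=> ac cq; have aq := chart_at_atlas q; have qq := chart_at_dom q.
by split; apply: field_smooth_transition.
Qed.

Lemma smX_near X q : smX X q -> \forall x \near q, smX X x.
Proof.
have aq := chart_at_atlas q; have qq := chart_at_dom q.
move=> /smooth_at_near/(near_chart_map qq) H.
apply: filterS2 H (near_dom qq) => x fx qx.
by rewrite (smXE X aq qx).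
Qed.

Lemma near_field_in c X Y q : chart_dom c q -> (\forall x \near q, X x = Y x) ->
  \forall u \near chart_map c q, field_in c X u = field_in c Y u.
Proof.
move=> cq /(near_chart_inv cq); apply: filterS => u; rewrite /field_in.
by move=> ->.
Qed.

Lemma smX_eq X Y q : (\forall x \near q, X x = Y x) -> smX X q -> smX Y q.
Proof.
by move=> XY; apply: smooth_at_eq; exact: near_field_in (chart_at_dom q) XY.
Qed.

Lemma smooth_fieldP (U : set M) X : open U ->
  smooth_field U X <-> forall q, U q -> smX X q.
Proof.
move=> oU; split=> [H q Uq|H c ac].
  apply: (smooth_on_at _ (H _ (chart_at_atlas q))); first exact: open_img.
  by exists q => //; split => //; exact: chart_at_dom.
by apply: smooth_at_on => _ [q [cq Uq] <-]; apply/smXE => //; exact: H.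
Qed.

Lemma near_field_inE c q (F : vector_field M) (G : 'rV[R]_n -> 'rV[R]_n) :
  chart_dom c q -> (forall x, chart_dom c x -> tcoord c (F x) = G (chart_map c x)) ->
  \forall u \near chart_map c q, G u = field_in c F u.
Proof.
move=> cq FG; apply: filterS (near_img cq) => u iu.
by rewrite /field_in FG ?chart_invK//; exact: chart_inv_dom.
Qed.

Lemma field_in_map c X x : chart_dom c x ->
  field_in c X (chart_map c x) = tcoord c (X x).
Proof. by move=> cx; rewrite /field_in chart_mapK. Qed.

Lemma smXD X Y q : smX X q -> smX Y q -> smX (fun x => X x + Y x) q.
Proof.
have aq := chart_at_atlas q; have qq := chart_at_dom q.
move=> Xq Yq; apply: smooth_at_eq (smooth_atD Xq Yq).
apply: (@near_field_inE _ _ _ (fun u => _)) => // x qx.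
by rewrite (tcoordD _ _ aq qx) !(field_in_map _ qx).
Qed.

Lemma smXZ f X q : smf f q -> smX X q -> smX (fun x => f x *: X x) q.
Proof.
have aq := chart_at_atlas q; have qq := chart_at_dom q.
move=> fq Xq; apply: smooth_at_eq (smooth_atZ fq Xq).
apply: (@near_field_inE _ _ _ (fun u => _)) => // x qx.
by rewrite (tcoordZ _ _ aq qx) (field_in_map _ qx) /= (chart_mapK qx).
Qed.

Lemma smX0 q : smX (fun=> 0) q.
Proof.
have aq := chart_at_atlas q; have qq := chart_at_dom q.
apply: smooth_at_eq (smooth_at_cst 0 _).
by apply: (@near_field_inE _ _ _ (fun u => _)) => // x qx; rewrite tcoord0.
Qed.

Lemma smX_sum (I : Type) (s : seq I) (X : I -> vector_field M) q :
  (forall i, smX (X i) q) -> smX (fun x => \sum_(i <- s) X i x) q.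
Proof.
move=> HX; elim: s => [|i s IH].
  by apply: smX_eq (smX0 q); near=> x; rewrite big_nil.
by apply: smX_eq (smXD (HX i) IH); near=> x; rewrite big_cons.
Unshelve. all: by end_near. Qed.

Lemma smX_coord_field c i q : atlas c -> chart_dom c q -> smX (coord_field c i) q.
Proof.
move=> ac cq; apply/(smXE _ ac cq).
apply: smooth_at_eq (smooth_at_cst (delta_mx 0 i : 'rV[R]_n) _).
apply: (@near_field_inE _ _ _ (fun u => _)) => // x qx.
by rewrite tcoord_coord_field.
Qed.

Lemma smf_tcoord c X i q : atlas c -> chart_dom c q -> smX X q ->
  smf (fun x => tcoord c (X x) 0 i) q.
Proof.
move=> ac cq /(smXE _ ac cq) Xq; apply/(smfE _ ac cq).
exact: smooth_at_coord i Xq.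
Qed.

Lemma near_expand c X q : atlas c -> chart_dom c q -> \forall x \near q,
  X x = \sum_i tcoord c (X x) 0 i *: coord_field c i x.
Proof.
by move=> ac cq; apply: filterS (near_dom cq) => x cx; exact: tangent_expand.
Qed.

(** Both sides are computed in the chart at q, where this is the commutator
    identity for directional derivatives. *)
Lemma differential_bracket f X Y q : smf f q -> smX X q -> smX Y q ->
  differential f q (bracket X Y q) =
  differential (fun x => differential f x (Y x)) q (X q) -
  differential (fun x => differential f x (X x)) q (Y q).
Proof.
have aq := chart_at_atlas q; have qq := chart_at_dom q.
move=> fq Xq Yq.
have E (Z : vector_field M) : smX Z q -> forall v : tangent q,
    differential (fun x => differential f x (Z x)) q v =
    'D_v (fun u => 'D_(field_in (chart_at q) Z u) (f \o chart_inv (chart_at q)) u)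
      (chart_map (chart_at q) q).
  move=> Zq v; apply: near_eq_derive.
  apply: filterS2 (near_chart_inv qq (smf_near fq)) (near_img qq) => u fx [x qx E].
  subst u; rewrite chart_mapK// in fx.
  by rewrite /= chart_mapK// (differentialE _ aq qx fx) field_in_map.
rewrite !E//; have := derive_commutator fq Xq Yq.
by rewrite !(field_in_map _ qq) !tcoord_chart_at => <-.
Qed.

(** A vector is determined by its action on the coordinates of c, so the
    commutator identity computes the bracket in any chart. *)
Lemma bracket_in_chart c X Y q : atlas c -> chart_dom c q -> smX X q -> smX Y q ->
  tcoord c (bracket X Y q) =
  'D_(tcoord c (X q)) (field_in c Y) (chart_map c q) -
  'D_(tcoord c (Y q)) (field_in c X) (chart_map c q).
Proof.
move=> ac cq Xq Yq; apply/rowP => i.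
rewrite -(differential_chart_coord i _ ac cq) differential_bracket//; last first.
  exact: chart_coord_smf.
have E (Z : vector_field M) (v : tangent q) : smX Z q ->
    differential (fun x => differential (fun x0 => chart_map c x0 0 i) x (Z x)) q v =
    ('D_(tcoord c v) (field_in c Z) (chart_map c q)) 0 i.
  move=> Zq.
  have -> : differential (fun x => differential (fun x0 => chart_map c x0 0 i) x (Z x)) q v =
     differential (fun x => tcoord c (Z x) 0 i) q v.
    apply: differential_eq; apply: filterS (near_dom cq) => x cx.
    exact: differential_chart_coord.
  rewrite (differentialE v ac cq (smf_tcoord i ac cq Zq)) derive_rV//.
  by apply: smooth_at_differentiable; apply/smXE.
by rewrite !mxE !E.
Qed.

Lemma smX_bracket X Y q : smX X q -> smX Y q -> smX (bracket X Y) q.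
Proof.
have aq := chart_at_atlas q; have qq := chart_at_dom q.
move=> Xq Yq; set c := chart_at q in aq qq *.
have H1 := smooth_at_derivev Yq Xq; have H2 := smooth_at_derivev Xq Yq.
have := smooth_atD H1 (smooth_atZ (smooth_at_cst (-1 : R) _) H2).
apply: smooth_at_eq; have nX := near_chart_inv qq (smX_near Xq).
have nY := near_chart_inv qq (smX_near Yq).
apply: filterS3 nX nY (near_img qq) => u Xu Yu [x qx E]; subst u.
rewrite chart_mapK// in Xu Yu.
rewrite [RHS](field_in_map _ qx) (bracket_in_chart aq qx Xu Yu) scaleN1r.
by rewrite !(field_in_map _ qx).
Qed.

Lemma bracketC X Y q : bracket X Y q = - bracket Y X q.
Proof. by rewrite /bracket opprB. Qed.

Lemma bracket_eq X X' Y Y' q : (\forall x \near q, X x = X' x) ->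
  (\forall x \near q, Y x = Y' x) -> bracket X Y q = bracket X' Y' q.
Proof.
have qq := chart_at_dom q.
move=> XX' YY'; rewrite /bracket (nbhs_singleton XX') (nbhs_singleton YY').
exact: (congr2 (fun a b : 'rV[R]_n => a - b)
  (near_eq_derive (X' q) (near_field_in qq YY'))
  (near_eq_derive (Y' q) (near_field_in qq XX'))).
Qed.

Lemma bracketZr f X Y q : smf f q -> smX X q -> smX Y q ->
  bracket X (fun x => f x *: Y x) q =
  differential f q (X q) *: Y q + f q *: bracket X Y q.
Proof.
have aq := chart_at_atlas q; have qq := chart_at_dom q.
move=> fq Xq Yq.
rewrite /bracket.
have dX := smooth_at_differentiable Xq; have dY := smooth_at_differentiable Yq.
have E1 : 'D_(X q) (field_in (chart_at q) (fun x => f x *: Y x)) (chart_map (chart_at q) q) =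
    differential f q (X q) *: Y q +
    f q *: 'D_(X q) (field_in (chart_at q) Y) (chart_map (chart_at q) q).
  have := derive_scalev (X q) (smf_differentiable fq) dY.
  rewrite (field_in_map _ qq) tcoord_chart_at /= (chart_mapK qq).
  apply: etrans; apply: near_eq_derive.
  apply: filterS (near_img qq) => u [x qx E]; subst u.
  by rewrite (field_in_map _ qx) (tcoordZ _ _ aq qx) (field_in_map _ qx) /= (chart_mapK qx).
have E2 : 'D_(f q *: Y q) (field_in (chart_at q) X) (chart_map (chart_at q) q) =
    f q *: 'D_(Y q) (field_in (chart_at q) X) (chart_map (chart_at q) q).
  by rewrite -[f q *: Y q]addr0 (derivevD _ _ _ dX) derive0 addr0.
apply: (etrans (congr2 (fun a b : 'rV[R]_n => a - b) E1 E2)).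
by rewrite scalerBr addrA.
Qed.

Lemma bracketDr X Y Z q : smX X q -> smX Y q -> smX Z q ->
  bracket X (fun x => Y x + Z x) q = bracket X Y q + bracket X Z q.
Proof.
have aq := chart_at_atlas q; have qq := chart_at_dom q.
move=> Xq Yq Zq.
rewrite /bracket addrACA -opprD; congr (_ - _).
  have dY := smooth_at_differentiable Yq; have dZ := smooth_at_differentiable Zq.
  rewrite -deriveD; try exact: diff_derivable.
  apply: near_eq_derive; apply: filterS (near_img qq) => u [x qx E]; subst u.
  by rewrite -[RHS]/(field_in _ _ _ + field_in _ _ _) !(field_in_map _ qx) (tcoordD _ _ aq qx).
have dX := smooth_at_differentiable Xq.
by rewrite -[Y q]scale1r (derivevD _ _ _ dX) !scale1r.
Qed.

End charts.

(** * Tensors and almost contact metric structures *)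

Arguments acm_phi_smooth {R n M phi xi eta g}.
Arguments acm_xi_smooth {R n M phi xi eta g}.
Arguments acm_eta_smooth {R n M phi xi eta g}.
Arguments acm_eta_linear {R n M phi xi eta g}.
Arguments acm_metric {R n M phi xi eta g}.
Arguments acm_phi2 {R n M phi xi eta g} _ {p} v.
Arguments acm_eta_xi {R n M phi xi eta g}.
Arguments acm_compatible {R n M phi xi eta g} _ {p} u v.
Arguments metric_smooth {R n M g}.
Arguments metric_linear {R n M g}.
Arguments metric_sym {R n M g}.
Arguments metric_pos {R n M g}.

Section extension.
Context {R : realType} {n : nat} {M : smooth_manifold R n}.
Implicit Types (c : chart R n M) (q : M) (X Y : vector_field M).

(** The image of a closed ball is compact, hence closed in the Hausdorff space M. *)
Lemma ball_image_closed c (u0 : 'rV[R]_n) (e : R) :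
  (forall u, `|u - u0| <= e -> (chart_map c @` chart_dom c) u) ->
  closed (chart_inv c @` [set u | `|u - u0| <= e]).
Proof.
move=> He; apply: compact_closed; first exact: manifold_hausdorff.
apply: continuous_compact.
  apply: continuous_in_subspaceT => u; rewrite inE => /He; exact: chart_inv_cont.
have [e0|e0] := ltP 0 e; last first.
  have sub : [set u | `|u - u0| <= e] `<=` [set u0].
    move=> u /= /le_trans/(_ e0); rewrite normr_le0 subr_eq0 => /eqP //.
  have /subset_set1 [->|->] := sub; [exact: compact0|exact: compact_set1].
have -> : [set u | `|u - u0| <= e] = closed_ball u0 e.
  by rewrite closed_ballE//; apply/seteqP; split => u; rewrite /closed_ball_ /= distrC.
apply: bounded_closed_compact; last exact: closed_ball_closed.
rewrite closed_ballE//; exists (`|u0| + e); split; first exact: num_real.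
move=> N uN u; rewrite /closed_ball_ /= => ue.
have -> : u = u0 - (u0 - u) by rewrite opprB addrC subrK.
apply: le_trans (ler_normB _ _) _.
by apply: le_trans (ltW uN); rewrite lerD2l.
Qed.

(** Cutting off with a bump function whose support is a compact, hence closed,
    subset of a chart domain. *)
Lemma extend_field X q : smX X q ->
  exists Y, smooth_field setT Y /\ \forall x \near q, Y x = X x.
Proof.
set c := chart_at q; have aq : atlas c := chart_at_atlas q.
have qq : chart_dom c q := chart_at_dom q.
move=> /smX_near Xq.
have /nbhs_ballP[r /= r0 Hr] : nbhs (chart_map c q) (fun u =>
  (chart_map c @` chart_dom c) u /\ smX X (chart_inv c u)).
  by apply: filterI; [exact: near_img|exact: near_chart_inv].
pose e := r / 2; have e0 : 0 < e by rewrite divr_gt0.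
have er : e < r by rewrite /e ltr_pdivrMr// mulr_natr mulr2n ltrDl.
have Hball u : `|u - chart_map c q| < r ->
    (chart_map c @` chart_dom c) u /\ smX X (chart_inv c u).
  by move=> ur; apply: Hr; rewrite -ball_normE /= distrC.
have [chi [chis chi1 chi0]] := exists_bump (chart_map c q) e0.
pose chiM (x : M) : R := if x \in chart_dom c then chi (chart_map c x) else 0.
pose Y : vector_field M := fun x => chiM x *: X x.
have KC := @ball_image_closed c (chart_map c q) e
  (fun u ue => proj1 (Hball u (le_lt_trans ue er))).
exists Y; split; last first.
  apply: filterS2 (near_dom qq) (near_chart_map qq chi1) => x cx x1.
  by rewrite /Y /chiM mem_set// x1 scale1r.
apply/smooth_fieldP => [|x _]; first exact: openT.
have [xK|xK] := pselect ((chart_inv c @` [set u | `|u - chart_map c q| <= e]) x).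
  case: xK => u /= ue ux.
  have [[y cy yu] Xu] := Hball u (le_lt_trans ue er).
  have xy : x = y by rewrite -ux -yu (chart_mapK cy).
  rewrite ux in Xu; rewrite -xy in cy.
  apply: (smXZ _ Xu); apply/(smfE _ aq cy).
  have : smooth_at chi (chart_map c x) by exact: smooth_on_at openT chis _.
  apply: smooth_at_eq; apply: filterS (near_img cy) => _ [z cz <-].
  by rewrite /= chart_mapK// /chiM mem_set.
apply: smX_eq (smX0 x).
have oK := open_nbhs_nbhs (conj (closed_openC KC) xK).
apply: filterS oK => y yK; rewrite /Y /chiM; case: ifPn; last by rewrite scale0r.
rewrite inE => cy; rewrite chi0 ?scale0r//.
rewrite leNgt; apply/negP => ye; apply: yK.
by exists (chart_map c y); [exact: ltW|rewrite chart_mapK].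
Qed.

End extension.

Section tensors.
Context {R : realType} {n : nat} {M : smooth_manifold R n}.
Implicit Types (c : chart R n M) (q : M) (X Y : vector_field M).

Lemma form_sum (alpha : one_form M) q (I : Type) (s : seq I) (a : I -> R)
    (v : I -> tangent q) :
  (forall b (u w : tangent q), alpha q (b *: u + w) = b * alpha q u + alpha q w) ->
  alpha q (\sum_(i <- s) a i *: v i) = \sum_(i <- s) a i * alpha q (v i).
Proof.
move=> lin; have a0 : alpha q 0 = 0.
  by have := lin (-1) 0 0; rewrite scaleN1r oppr0 addr0 mulN1r addNr.
elim: s => [|i s IH]; first by rewrite !big_nil.
by rewrite !big_cons lin IH.
Qed.

(** Smoothness is assumed on coordinate fields only; a field is expanded in them
    with smooth coefficients. *)
Lemma smf_one_form (alpha : one_form M) X q : smooth_one_form alpha ->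
  (forall x b (u w : tangent x), alpha x (b *: u + w) = b * alpha x u + alpha x w) ->
  smX X q -> smf (fun x => alpha x (X x)) q.
Proof.
move=> sa lin Xq; set c := chart_at q; have aq : atlas c := chart_at_atlas q.
have qq : chart_dom c q := chart_at_dom q.
have H i : smf (fun x => tcoord c (X x) 0 i * alpha x (coord_field c i x)) q.
  apply: smfM; first exact: smf_tcoord.
  by have /smooth_funP := sa c i aq; apply => //; exact: chart_dom_open.
apply: smf_eq (smf_sum (index_enum _) H).
apply: filterS (near_expand X aq qq) => x E.
by rewrite [in RHS]E (form_sum _ _ _ (lin x)).
Qed.

Lemma smf_two_tensor (B : two_tensor M) X Y q : smooth_two_tensor B ->
  (forall x b (u v w : tangent x), B x (b *: u + v) w = b * B x u w + B x v w) ->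
  (forall x b (u v w : tangent x), B x w (b *: u + v) = b * B x w u + B x w v) ->
  smX X q -> smX Y q -> smf (fun x => B x (X x) (Y x)) q.
Proof.
move=> sB linl linr Xq Yq.
set c := chart_at q; have aq : atlas c := chart_at_atlas q.
have qq : chart_dom c q := chart_at_dom q.
have H i : smf (fun x => tcoord c (X x) 0 i * \sum_j tcoord c (Y x) 0 j *
    B x (coord_field c i x) (coord_field c j x)) q.
  apply: smfM; first exact: smf_tcoord.
  apply: smf_sum => j; apply: smfM; first exact: smf_tcoord.
  by have /smooth_funP := sB c i j aq; apply => //; exact: chart_dom_open.
apply: smf_eq (smf_sum (index_enum _) H).
apply: filterS2 (near_expand X aq qq) (near_expand Y aq qq) => x EX EY.
rewrite [in RHS]EX (@form_sum (fun y u => B y u (Y y)) x)//.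
apply: eq_bigr => i _; rewrite [in RHS]EY.
by rewrite (@form_sum (fun y u => B y (coord_field c i y) u) x).
Qed.

Lemma smX_endo (A : endo_field M) X q : smooth_endo A -> smX X q ->
  smX (apply_endo A X) q.
Proof.
move=> sA Xq; set c := chart_at q; have aq : atlas c := chart_at_atlas q.
have qq : chart_dom c q := chart_at_dom q.
have H i : smX (fun x => tcoord c (X x) 0 i *: apply_endo A (coord_field c i) x) q.
  apply: smXZ; first exact: smf_tcoord.
  by have /smooth_fieldP := sA c i aq; apply => //; exact: chart_dom_open.
apply: smX_eq (smX_sum (index_enum _) H).
apply: filterS (near_expand X aq qq) => x E.
rewrite [in RHS]/apply_endo [in RHS]E linear_sum; apply: eq_bigr => i _.
by rewrite linearZ.
Qed.

End tensors.

Section acm_algebra.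
Context {R : realType} {n : nat} {M : smooth_manifold R n}.
Unset Implicit Arguments.
Variables (phi : endo_field M) (xi : vector_field M) (eta : one_form M).
Variable g : two_tensor M.
Hypothesis H : almost_contact_metric phi xi eta g.
Set Implicit Arguments.
Implicit Types (q : M).

Let gm := acm_metric H.

Lemma gC q (u v : tangent q) : g q u v = g q v u.
Proof. exact: metric_sym gm q u v. Qed.
Lemma gPl q a (u v w : tangent q) : g q (a *: u + v) w = a * g q u w + g q v w.
Proof. exact: metric_linear gm q a u v w. Qed.
Lemma gPr q a (u v w : tangent q) : g q w (a *: u + v) = a * g q w u + g q w v.
Proof. by rewrite !(gC w) gPl. Qed.
Lemma g0l q (w : tangent q) : g q 0 w = 0.
Proof. by have := gPl (-1) 0 0 w; rewrite scaleN1r oppr0 addr0 mulN1r addNr. Qed.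
Lemma g0r q (w : tangent q) : g q w 0 = 0.
Proof. by rewrite gC g0l. Qed.
Lemma gDl q (u v w : tangent q) : g q (u + v) w = g q u w + g q v w.
Proof. by rewrite -[u]scale1r gPl mul1r scale1r. Qed.
Lemma gDr q (u v w : tangent q) : g q w (u + v) = g q w u + g q w v.
Proof. by rewrite !(gC w) gDl. Qed.
Lemma gZl q a (u w : tangent q) : g q (a *: u) w = a * g q u w.
Proof. by rewrite -[a *: u]addr0 gPl g0l addr0. Qed.
Lemma gZr q a (u w : tangent q) : g q w (a *: u) = a * g q w u.
Proof. by rewrite !(gC w) gZl. Qed.
Lemma gNl q (u w : tangent q) : g q (- u) w = - g q u w.
Proof. by rewrite -scaleN1r gZl mulN1r. Qed.
Lemma gNr q (u w : tangent q) : g q w (- u) = - g q w u.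
Proof. by rewrite !(gC w) gNl. Qed.
Lemma gBl q (u v w : tangent q) : g q (u - v) w = g q u w - g q v w.
Proof. by rewrite gDl gNl. Qed.
Lemma gBr q (u v w : tangent q) : g q w (u - v) = g q w u - g q w v.
Proof. by rewrite gDr gNr. Qed.


Lemma etaP q a (u v : tangent q) : eta q (a *: u + v) = a * eta q u + eta q v.
Proof. exact: acm_eta_linear H q a u v. Qed.
Lemma eta0 q : eta q 0 = 0.
Proof. by have := @etaP q (-1) 0 0; rewrite scaleN1r oppr0 addr0 mulN1r addNr. Qed.
Lemma etaZ q a (u : tangent q) : eta q (a *: u) = a * eta q u.
Proof. by rewrite -[a *: u]addr0 etaP eta0 addr0. Qed.

Lemma phi_xi q : phi q (xi q) = 0.
Proof.
have E : phi q (phi q (xi q)) = 0.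
  by rewrite (acm_phi2 H) (acm_eta_xi H) scale1r addNr.
have F := acm_phi2 H (phi q (xi q)); rewrite E linear0 in F.
set w := phi q (xi q) in E F *; have {}F : w = eta q w *: xi q.
  by apply/eqP; rewrite -subr_eq0 -oppr_eq0 opprB addrC; apply/eqP; rewrite -F.
rewrite F linearZ /= -/w in E.
have [e0|e0] := eqVneq (eta q w) 0; first by rewrite F e0 scale0r.
move/eqP: E; rewrite scaler_eq0 (negbTE e0) /=; move/eqP; by [].
Qed.

Lemma eta_g q (u : tangent q) : eta q u = g q u (xi q).
Proof.
have := acm_compatible H u (xi q).
by rewrite phi_xi g0r (acm_eta_xi H) mulr1 => /esym/eqP; rewrite subr_eq0 => /eqP.
Qed.

Lemma g_xi q : g q (xi q) (xi q) = 1.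
Proof. by rewrite -eta_g (acm_eta_xi H). Qed.

Lemma eta_phi q (u : tangent q) : eta q (phi q u) = 0.
Proof.
have E : phi q (phi q (phi q u)) = - phi q u.
  by rewrite [in LHS](acm_phi2 H u) linearD linearN linearZ /= phi_xi scaler0 addr0.
rewrite (acm_phi2 H) in E.
have {}E : eta q (phi q u) *: xi q = 0.
  by apply: (@addrI _ (- phi q u)); rewrite E addr0.
move/eqP: E; rewrite scaler_eq0 => /orP[/eqP//|/eqP x0].
by have /eqP := acm_eta_xi H q; rewrite x0 eta0 eq_sym oner_eq0.
Qed.

Lemma g_phi q (u v : tangent q) : g q (phi q u) v = - g q u (phi q v).
Proof.
have := acm_compatible H u (phi q v).
rewrite eta_phi mulr0 subr0 (acm_phi2 H) gDr gNr gZr -eta_g eta_phi mulr0 addr0.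
by move=> <-; rewrite opprK.
Qed.

Lemma smX_phi X q : smX X q -> smX (apply_endo phi X) q.
Proof. exact: smX_endo (acm_phi_smooth H). Qed.

Lemma smf_eta X q : smX X q -> smf (fun x => eta x (X x)) q.
Proof.
by apply: smf_one_form; [exact: acm_eta_smooth H|move=> x b u w; exact: etaP].
Qed.

Lemma smf_g X Y q : smX X q -> smX Y q -> smf (fun x => g x (X x) (Y x)) q.
Proof.
apply: smf_two_tensor; first exact: metric_smooth gm.
  by move=> x b u v w; exact: gPl.
by move=> x b u v w; exact: gPr.
Qed.

Lemma smX_xi q : smX xi q.
Proof.
by have /smooth_fieldP := acm_xi_smooth H; apply => //; exact: openT.
Qed.

End acm_algebra.

Section orthonormal.
Context {R : realType} (B : 'rV[R]_3 -> 'rV[R]_3 -> R).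
Hypothesis BP : forall a u v w, B (a *: u + v) w = a * B u w + B v w.

Lemma orthonormal_expand (e0 e1 e2 : 'rV[R]_3) :
  B e0 e0 = 1 -> B e1 e1 = 1 -> B e2 e2 = 1 -> B e0 e1 = 0 -> B e0 e2 = 0 ->
  B e1 e0 = 0 -> B e1 e2 = 0 -> B e2 e0 = 0 -> B e2 e1 = 0 ->
  forall v, v = B v e0 *: e0 + B v e1 *: e1 + B v e2 *: e2.
Proof.
move=> b00 b11 b22 b01 b02 b10 b12 b20 b21.
have B0 w : B 0 w = 0.
  by have := BP (-1) 0 0 w; rewrite scaleN1r oppr0 addr0 mulN1r addNr.
have BZ a u w : B (a *: u) w = a * B u w by rewrite -[a *: u]addr0 BP B0 addr0.
have BL a0 a1 a2 w : B (a0 *: e0 + a1 *: e1 + a2 *: e2) w =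
    a0 * B e0 w + a1 * B e1 w + a2 * B e2 w.
  by rewrite -addrA BP BP BZ addrA.
pose P : 'M[R]_3 := \matrix_(i < 3) [:: e0; e1; e2]`_i.
have PE (a : 'rV[R]_3) : a *m P = a 0 0 *: e0 + a 0 1 *: e1 + a 0 2 *: e2.
  rewrite mulmx_sum_row !big_ord_recl big_ord0 addr0 !rowK /= addrA.
  by congr (a 0 _ *: _ + a 0 _ *: _ + a 0 _ *: _); apply/val_inj.
have Pu : P \in unitmx.
  rewrite -row_free_unit; apply: inj_row_free => a aP0.
  have Z w : a 0 0 * B e0 w + a 0 1 * B e1 w + a 0 2 * B e2 w = 0.
    by rewrite -BL -PE aP0 B0.
  apply/rowP => i; rewrite mxE.
  have := Z e0; have := Z e1; have := Z e2.
  rewrite b00 b11 b22 b01 b02 b10 b12 b20 b21 !mulr0 !mulr1 !addr0 !add0r.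
  move=> z2 z1 z0; case: i => -[|[|[|//]]] i3.
  - by rewrite -[RHS]z0; congr (a 0 _); apply/val_inj.
  - by rewrite -[RHS]z1; congr (a 0 _); apply/val_inj.
  - by rewrite -[RHS]z2; congr (a 0 _); apply/val_inj.
move=> v; have vE : v = v *m invmx P *m P by rewrite mulmxKV.
rewrite [in LHS]vE PE; set a := v *m invmx P; rewrite PE in vE.
rewrite {1 2 3}vE !BL b00 b11 b22 b01 b02 b10 b12 b20 b21.
by rewrite !mulr0 !mulr1 !addr0 !add0r.
Qed.

End orthonormal.

(** * Frames of eigenvectors *)

Arguments ak_acm {R n M phi xi eta g}.
Arguments ak_deta {R n M phi xi eta g} _ {X Y}.
Arguments ak_dPhi {R n M phi xi eta g} _ {X Y Z}.
Arguments nabla_smooth {R n M g nabla} _ {X Y}.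
Arguments nabla_torsion_free {R n M g nabla} _ {X Y}.
Arguments nabla_metric {R n M g nabla} _ {X Y Z}.
Arguments gkm_curvature {R n M phi xi eta kappa mu nabla} _ {X Y}.
Arguments gkm_kappa_smooth {R n M phi xi eta kappa mu nabla}.
Arguments gkm_mu_smooth {R n M phi xi eta kappa mu nabla}.

Section sealed.
Context {R : realType} {n : nat} {M : smooth_manifold R n}.
Implicit Types (f : M -> R) (X Y Z : vector_field M) (q : M).

Fact bracket_seal : {b : vector_field M -> vector_field M -> vector_field M |
  b = bracket}.
Proof. by exists bracket. Qed.
(** Opaque copies of the bracket, the differential and h': conversion would
    otherwise unfold them down to limits of difference quotients. *)
Definition lie := sval bracket_seal.
Lemma lieE : lie = bracket. Proof. exact: (svalP bracket_seal). Qed.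

Fact differential_seal : {d : (M -> R) -> one_form M | d = differential}.
Proof. by exists differential. Qed.
Definition dd : (M -> R) -> one_form M := sval differential_seal.
Arguments dd f p v : clear implicits.
Lemma ddE : dd = differential. Proof. exact: (svalP differential_seal). Qed.

Fact h'_seal (phi : endo_field M) (xi : vector_field M) :
  {h : vector_field M -> vector_field M | h = h'_tensor phi xi}.
Proof. by exists (h'_tensor phi xi). Qed.
Definition hp phi xi := sval (h'_seal phi xi).
Lemma hpE phi xi : hp phi xi = h'_tensor phi xi.
Proof. exact: (svalP (h'_seal phi xi)). Qed.

Lemma hp_lie (phi : endo_field M) (xi X : vector_field M) p :
  hp phi xi X p =
  2^-1 *: (lie xi (apply_endo phi (apply_endo phi X)) p -
           phi p (lie xi (apply_endo phi X) p)).
Proof. by rewrite hpE lieE. Qed.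

Lemma lieC X Y q : lie X Y q = - lie Y X q.
Proof. by rewrite lieE; exact: bracketC. Qed.

Lemma lie_eq X X' Y Y' q : (\forall x \near q, X x = X' x) ->
  (\forall x \near q, Y x = Y' x) -> lie X Y q = lie X' Y' q.
Proof. by rewrite lieE; exact: bracket_eq. Qed.

Lemma lieZr f X Y q : smf f q -> smX X q -> smX Y q ->
  lie X (fun x => f x *: Y x) q = dd f q (X q) *: Y q + f q *: lie X Y q.
Proof. by rewrite lieE ddE; exact: bracketZr. Qed.

Lemma lieDr X Y Z q : smX X q -> smX Y q -> smX Z q ->
  lie X (fun x => Y x + Z x) q = lie X Y q + lie X Z q.
Proof. by rewrite lieE; exact: bracketDr. Qed.

Lemma smX_lie X Y q : smX X q -> smX Y q -> smX (lie X Y) q.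
Proof. by rewrite lieE; exact: smX_bracket. Qed.

Lemma dd_lie f X Y q : smf f q -> smX X q -> smX Y q ->
  dd f q (lie X Y q) =
  dd (fun x => dd f x (Y x)) q (X q) - dd (fun x => dd f x (X x)) q (Y q).
Proof. by rewrite lieE ddE; exact: differential_bracket. Qed.

Lemma dd_eq f f' q (v : tangent q) : (\forall x \near q, f x = f' x) ->
  dd f q v = dd f' q v.
Proof. by rewrite ddE; exact: differential_eq. Qed.

Lemma dd_cst a q (v : tangent q) : dd (fun=> a) q v = 0.
Proof. by rewrite ddE; exact: differential_cst. Qed.

Lemma ddP f q a (v w : tangent q) : smf f q ->
  dd f q (a *: v + w) = a * dd f q v + dd f q w.
Proof. by rewrite ddE; exact: differential_linear. Qed.

Lemma ddD f f' q (v : tangent q) : smf f q -> smf f' q ->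
  dd (fun x => f x + f' x) q v = dd f q v + dd f' q v.
Proof. by rewrite ddE; exact: differentialD. Qed.

Lemma ddM f f' q (v : tangent q) : smf f q -> smf f' q ->
  dd (fun x => f x * f' x) q v = f q * dd f' q v + f' q * dd f q v.
Proof. by rewrite ddE; exact: differentialM. Qed.

End sealed.

Arguments dd {R n M} f p v.

Section geometry.
Context {R : realType} {M : smooth_manifold R 3}.
Unset Implicit Arguments.
Variables (phi : endo_field M) (xi : vector_field M) (eta : one_form M).
Variable g : two_tensor M.
Variable nabla : vector_field M -> vector_field M -> vector_field M.
Variables kappa mu : M -> R.
Hypothesis Mak : almost_kenmotsu phi xi eta g.
Hypothesis LC : levi_civita g nabla.
Hypothesis Mkm : generalized_kappa_mu' phi xi eta kappa mu nabla.
Set Implicit Arguments.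
Implicit Types (p q : M) (X Y Z : vector_field M).

Let acm := ak_acm Mak.
Notation gl X := (smooth_field setT X).
Notation h' := (hp phi xi).

Lemma gl_at X q : gl X -> smX X q.
Proof. by move=> /(smooth_fieldP _ openT); exact. Qed.

Lemma gl_of X : (forall q, smX X q) -> gl X.
Proof. by move=> HX; apply/(smooth_fieldP _ openT) => q _; exact: HX. Qed.

Lemma gl_xi : gl xi. Proof. exact: acm_xi_smooth acm. Qed.

Lemma gl_phi X : gl X -> gl (apply_endo phi X).
Proof. by move=> HX; apply: gl_of => q; apply: (smX_phi acm); exact: gl_at. Qed.

Lemma gl_bracket X Y : gl X -> gl Y -> gl (lie X Y).
Proof. by move=> HX HY; apply: gl_of => q; apply: smX_lie; exact: gl_at. Qed.

Lemma gl_nabla X Y : gl X -> gl Y -> gl (nabla X Y).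
Proof. by move=> HX HY; exact: (nabla_smooth LC HX HY). Qed.

Lemma torsion_free X Y p : gl X -> gl Y -> nabla X Y p - nabla Y X p = lie X Y p.
Proof. by move=> HX HY; rewrite lieE; exact: (nabla_torsion_free LC HX HY). Qed.

Lemma metric_compatible X Y Z p : gl X -> gl Y -> gl Z ->
  dd (fun q => g q (Y q) (Z q)) p (X p) =
  g p (nabla X Y p) (Z p) + g p (Y p) (nabla X Z p).
Proof. by move=> HX HY HZ; rewrite ddE; exact: (nabla_metric LC HX HY HZ). Qed.

Lemma deta X Y p : gl X -> gl Y ->
  dd (fun q => eta q (Y q)) p (X p) - dd (fun q => eta q (X q)) p (Y p)
  - eta p (lie X Y p) = 0.
Proof. by move=> HX HY; rewrite ddE lieE; exact: (ak_deta Mak HX HY). Qed.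

Lemma dPhi X Y Z p : gl X -> gl Y -> gl Z ->
  let B := fundamental_form phi g in
  dd (fun q => B q (Y q) (Z q)) p (X p) + dd (fun q => B q (Z q) (X q)) p (Y p)
  + dd (fun q => B q (X q) (Y q)) p (Z p) - B p (lie X Y p) (Z p)
  - B p (lie Y Z p) (X p) - B p (lie Z X p) (Y p) =
  2 * wedge12 eta B p (X p) (Y p) (Z p).
Proof. by move=> HX HY HZ; rewrite ddE lieE; exact: (ak_dPhi Mak HX HY HZ). Qed.

Lemma curvature_kappa_mu X Y p : gl X -> gl Y ->
  nabla X (nabla Y xi) p - nabla Y (nabla X xi) p - nabla (lie X Y) xi p =
  kappa p *: (eta p (Y p) *: X p - eta p (X p) *: Y p)
  + mu p *: (eta p (Y p) *: h' X p - eta p (X p) *: h' Y p).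
Proof. by move=> HX HY; rewrite lieE hpE; exact: (gkm_curvature Mkm HX HY). Qed.

Lemma dd_const (f : M -> R) a p v :
  (\forall q \near p, f q = a) -> dd f p v = 0.
Proof.
by move=> fa; rewrite (dd_eq (f' := fun=> a))// dd_cst.
Qed.

Lemma nabla_const a p X Y Z : gl X -> gl Y -> gl Z ->
  (\forall q \near p, g q (Y q) (Z q) = a) ->
  g p (nabla X Y p) (Z p) = - g p (Y p) (nabla X Z p).
Proof.
move=> HX HY HZ E; have := metric_compatible p HX HY HZ.
by rewrite (dd_const _ E) => /esym/eqP; rewrite addr_eq0 => /eqP.
Qed.

Lemma g_nabla_xi_xi Z p : gl Z -> g p (nabla Z xi p) (xi p) = 0.
Proof.
move=> HZ; have := @nabla_const 1 p Z xi xi HZ gl_xi gl_xi.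
have E : \forall q \near p, g q (xi q) (xi q) = 1 by near=> q; exact: g_xi acm q.
move=> /(_ E); rewrite (gC acm (xi p)); lra.
Unshelve. all: by end_near. Qed.

(** The second fundamental form of the kernel of the closed form eta is
    symmetric. *)
Lemma nabla_xi_sym X Z p : gl X -> gl Z ->
  g p (nabla X xi p) (Z p) = g p (nabla Z xi p) (X p).
Proof.
move=> HX HZ; have := deta p HX HZ.
have E (Y : vector_field M) : (fun q => eta q (Y q)) = (fun q => g q (Y q) (xi q)).
  by apply/funext => q; exact: eta_g acm _ _.
rewrite !E (metric_compatible p HX HZ gl_xi) (metric_compatible p HZ HX gl_xi).
rewrite (eta_g acm) -(torsion_free p HX HZ) (gBl acm).
rewrite (gC acm (Z p)) (gC acm (X p)).
by move: (g p _ _) (g p _ _) (g p _ _) (g p _ _) => a b c d H; lra.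
Qed.

(** By symmetry g(nabla_xi xi, Z) = g(nabla_Z xi, xi), which is half the
    derivative of the constant g(xi, xi). *)
Lemma nabla_xi_xi p : nabla xi xi p = 0.
Proof.
have HV := gl_nabla gl_xi gl_xi.
have := nabla_xi_sym p gl_xi HV; rewrite (g_nabla_xi_xi p HV) => E.
apply/eqP; apply: contraT => v0.
by have := metric_pos (acm_metric acm) _ _ v0; rewrite E ltxx.
Qed.

Lemma nabla_bracket_xi X p : gl X ->
  lie xi X p = nabla xi X p - nabla X xi p.
Proof. by move=> HX; rewrite (torsion_free p gl_xi HX). Qed.

(** g(nabla_X xi, Z) is symmetric, and nabla_xi X = [xi, X] + nabla_X xi: deriving
    g(X, Z) = a along xi expresses it by Lie derivatives. *)
Lemma nabla_xi_lie a X Z p : gl X -> gl Z ->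
  (\forall q \near p, g q (X q) (Z q) = a) ->
  2 * g p (nabla X xi p) (Z p) =
  - g p (lie xi X p) (Z p) - g p (X p) (lie xi Z p).
Proof.
move=> HX HZ E; have := nabla_const gl_xi HX HZ E.
rewrite !nabla_bracket_xi// (gBl acm) (gBr acm) (gC acm (X p) (nabla Z xi p)).
rewrite -(nabla_xi_sym p HX HZ).
by move: (g p _ _) (g p _ _) (g p _ _) => a' b c; lra.
Qed.

(** Scalar form of the curvature condition: derivatives of the second fundamental
    form g(nabla xi, .) instead of second covariant derivatives. *)
Lemma curvature_xi X Y Z p : gl X -> gl Y -> gl Z ->
  dd (fun q => g q (nabla Y xi q) (Z q)) p (X p)
    - g p (nabla Y xi p) (nabla X Z p)
  - (dd (fun q => g q (nabla X xi q) (Z q)) p (Y p)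
    - g p (nabla X xi p) (nabla Y Z p))
  - g p (nabla Z xi p) (lie X Y p) =
  kappa p * (eta p (Y p) * g p (X p) (Z p) - eta p (X p) * g p (Y p) (Z p))
  + mu p * (eta p (Y p) * g p (h' X p) (Z p) - eta p (X p) * g p (h' Y p) (Z p)).
Proof.
move=> HX HY HZ; have HXY := gl_bracket HX HY.
have := congr1 (fun v => g p v (Z p)) (curvature_kappa_mu p HX HY).
rewrite !(gDl acm, gZl acm, gNl acm) => <-.
rewrite (metric_compatible p HX (gl_nabla HY gl_xi) HZ).
rewrite (metric_compatible p HY (gl_nabla HX gl_xi) HZ).
rewrite (nabla_xi_sym p HXY HZ).
by rewrite !addrK.
Qed.

(** d eta = 0 keeps brackets in the contact distribution. *)
Lemma eta_bracket a b X Y p : gl X -> gl Y ->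
  (\forall q \near p, eta q (X q) = a) -> (\forall q \near p, eta q (Y q) = b) ->
  eta p (lie X Y p) = 0.
Proof.
move=> HX HY EX EY; have := deta p HX HY.
rewrite (dd_const _ EX) (dd_const _ EY) subrr sub0r.
by move/eqP; rewrite oppr_eq0 => /eqP.
Qed.

Lemma eta_xi_near p : \forall q \near p, eta q (xi q) = 1.
Proof. by near=> q; exact: acm_eta_xi acm q. Unshelve. all: by end_near. Qed.

(** A unit section E of the contact distribution near p; it determines the
    orthonormal frame xi, E, phi E. *)
Definition frame E p :=
  \forall q \near p, g q (E q) (E q) = 1 /\ eta q (E q) = 0.

Lemma near_near (P : M -> Prop) p : (\forall q \near p, P q) ->
  \forall q \near p, \forall x \near q, P x.
Proof.
move=> /near_open[A [oA Ap AP]].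
have : nbhs p A by apply: open_nbhs_nbhs.
by apply: filterS => q Aq; apply: filterS AP _; apply: open_nbhs_nbhs.
Qed.

Section frame_at.
Variables (E1 : vector_field M).
Hypothesis HE1 : gl E1.
Notation E2 := (apply_endo phi E1).

Let HE2 : gl E2. Proof. exact: gl_phi. Qed.

Lemma phiphi q : eta q (E1 q) = 0 -> phi q (phi q (E1 q)) = - E1 q.
Proof. by move=> e0; rewrite (acm_phi2 acm) e0 scale0r addr0. Qed.

Lemma frame_eqs p : frame E1 p -> [/\ g p (E1 p) (E1 p) = 1,
  g p (E2 p) (E2 p) = 1, g p (E1 p) (E2 p) = 0, g p (E1 p) (xi p) = 0 &
  g p (E2 p) (xi p) = 0].
Proof.
move=> /nbhs_singleton[e1 e0]; split => //.
- by rewrite (acm_compatible acm) e1 e0 mul0r subr0.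
- by have := g_phi acm (E1 p) (E1 p); rewrite (gC acm (phi p (E1 p))) /apply_endo; lra.
- by rewrite -(eta_g acm).
- by rewrite -(eta_g acm) (eta_phi acm).
Qed.

Lemma frame_expand p (v : tangent p) : frame E1 p ->
  v = g p v (xi p) *: xi p + g p v (E1 p) *: E1 p + g p v (E2 p) *: E2 p.
Proof.
move=> /frame_eqs[e11 e22 e12 e10 e20].
apply: (@orthonormal_expand R (g p)) => //; try by rewrite (gC acm).
- by move=> *; exact: gPl acm _ _ _ _ _.
- exact: g_xi acm p.
Qed.

Lemma parseval p (u v : tangent p) : frame E1 p ->
  g p u v = g p u (xi p) * g p v (xi p) + g p u (E1 p) * g p v (E1 p)
    + g p u (E2 p) * g p v (E2 p).
Proof.
move=> F; rewrite [v in LHS](frame_expand v F) !(gDr acm) !(gZr acm).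
by rewrite ![g p v _ * _]mulrC.
Qed.

Lemma near_frame_eqs p : frame E1 p -> \forall q \near p,
  [/\ g q (E1 q) (E1 q) = 1,
  g q (E2 q) (E2 q) = 1, g q (E1 q) (E2 q) = 0, g q (E1 q) (xi q) = 0 &
  g q (E2 q) (xi q) = 0].
Proof. by move=> /near_near; apply: filterS => q; exact: frame_eqs. Qed.

Lemma bracket_phiE2 p X : frame E1 p -> gl X ->
  lie X (apply_endo phi E2) p = - lie X E1 p.
Proof.
move=> F HX.
rewrite (@lie_eq _ _ _ X X (apply_endo phi E2) (fun q => -1 *: E1 q)).
- rewrite (lieZr (f := fun=> -1) (smf_cst _ _) (gl_at p HX) (gl_at p HE1)).
  by rewrite dd_cst scale0r add0r scaleN1r.
- by near=> q.
- by apply: filterS F => q [_ e0]; rewrite /apply_endo phiphi// scaleN1r.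
Unshelve. all: by end_near. Qed.

Lemma bracket_phiphiE2 p X : frame E1 p -> gl X ->
  lie X (apply_endo phi (apply_endo phi E2)) p = - lie X E2 p.
Proof.
move=> F HX.
rewrite (@lie_eq _ _ _ X X (apply_endo phi (apply_endo phi E2)) (fun q => -1 *: E2 q)).
- rewrite (lieZr (f := fun=> -1) (smf_cst _ _) (gl_at p HX) (gl_at p HE2)).
  by rewrite dd_cst scale0r add0r scaleN1r.
- by near=> q.
- by apply: filterS F => q [_ e0]; rewrite /apply_endo phiphi// scaleN1r linearN.
Unshelve. all: by end_near. Qed.

(** dPhi = 2 eta /\ Phi on (xi, E1, E2) fixes the trace of the Lie derivative. *)
Lemma frame_trace p : frame E1 p ->
  g p (lie xi E1 p) (E1 p) + g p (lie xi E2 p) (E2 p) = -2.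
Proof.
move=> F; have := dPhi p gl_xi HE1 HE2.
have [e11 e22 e12 e10 e20] := frame_eqs F.
have N12 : \forall q \near p, fundamental_form phi g q (E1 q) (E2 q) = -1.
  apply: filterS F => q [e1 e0].
  by rewrite /fundamental_form /apply_endo phiphi// (gNr acm) e1.
have N20 : \forall q \near p, fundamental_form phi g q (E2 q) (xi q) = 0.
  by near=> q; rewrite /fundamental_form (phi_xi acm) (g0r acm).
have N01 : \forall q \near p, fundamental_form phi g q (xi q) (E1 q) = 0.
  near=> q; rewrite /fundamental_form (gC acm) -(eta_g acm); exact: eta_phi acm _ _.
rewrite /= (dd_const _ N12) (dd_const _ N20)
  (dd_const _ N01) /wedge12 (nbhs_singleton N12) (nbhs_singleton N20)
  (nbhs_singleton N01) (acm_eta_xi acm) /fundamental_form.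
rewrite (phi_xi acm) (g0r acm) (lieC E2 xi) (gNl acm).
rewrite {1}/apply_endo phiphi; last by have /nbhs_singleton[] := F.
rewrite (gNr acm) -[phi p (E1 p)]/(E2 p).
move: (g p _ _) (g p _ _) => a b; rewrite !mulr0 mul1r; lra.
Unshelve. all: by end_near. Qed.

(** h' is symmetric and trace-free on the contact distribution. *)
Lemma frame_h' p : frame E1 p ->
  [/\ g p (h' E1 p) (xi p) = 0, g p (h' E2 p) (xi p) = 0,
    2 * g p (h' E1 p) (E1 p) =
      g p (lie xi E2 p) (E2 p) - g p (lie xi E1 p) (E1 p),
    2 * g p (h' E1 p) (E2 p) =
      - g p (lie xi E1 p) (E2 p) - g p (lie xi E2 p) (E1 p) &
    g p (h' E2 p) (E1 p) = g p (h' E1 p) (E2 p) /\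
    g p (h' E2 p) (E2 p) = - g p (h' E1 p) (E1 p)].
Proof.
move=> F; have e0 : eta p (E1 p) = 0 by have /nbhs_singleton[] := F.
have N1 : \forall q \near p, eta q (E1 q) = 0 by apply: filterS F => q [].
have N2 : \forall q \near p, eta q (E2 q) = 0 by near=> q; exact: eta_phi acm _ _.
have z1 := eta_bracket gl_xi HE1 (eta_xi_near p) N1.
have z2 := eta_bracket gl_xi HE2 (eta_xi_near p) N2.
rewrite !(eta_g acm) in z1 z2.
have hE1 v : g p (h' E1 p) v = 2^-1 * (- g p (lie xi E1 p) v
    + g p (lie xi E2 p) (phi p v)).
  rewrite hp_lie (gZl acm) (gBl acm).
  by rewrite (bracket_phiE2 F gl_xi) (gNl acm) (g_phi acm) opprK.
have hE2 v : g p (h' E2 p) v = 2^-1 * (- g p (lie xi E2 p) v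
    - g p (lie xi E1 p) (phi p v)).
  rewrite hp_lie (gZl acm) (gBl acm).
  rewrite (bracket_phiphiE2 F gl_xi) (bracket_phiE2 F gl_xi) !(gNl acm).
  by rewrite linearN /= (gNl acm) (g_phi acm) opprK.
have p2 : phi p (E2 p) = - E1 p by exact: phiphi.
rewrite !hE1 !hE2 (phi_xi acm) !(g0r acm) z1 z2 p2 !(gNr acm).
rewrite -[phi p (E1 p)]/(E2 p).
by move: (g p _ _) (g p _ _) (g p _ _) (g p _ _) => a b c d; split; [lra..|split; lra].
Unshelve. all: by end_near. Qed.

(** On the frame, nabla xi is the identity of the contact distribution plus h'. *)
Lemma frame_nabla_xi p : frame E1 p ->
  let s := g p (h' E1 p) (E1 p) in let w := g p (h' E1 p) (E2 p) in
  [/\ g p (nabla E1 xi p) (E1 p) = 1 + s, g p (nabla E2 xi p) (E2 p) = 1 - s,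
    g p (nabla E1 xi p) (E2 p) = w & g p (nabla E2 xi p) (E1 p) = w].
Proof.
move=> F; have N := near_frame_eqs F.
have N11 : \forall q \near p, g q (E1 q) (E1 q) = 1 by apply: filterS N => q [].
have N22 : \forall q \near p, g q (E2 q) (E2 q) = 1 by apply: filterS N => q [].
have N12 : \forall q \near p, g q (E1 q) (E2 q) = 0 by apply: filterS N => q [].
have B11 := nabla_xi_lie HE1 HE1 N11.
have B22 := nabla_xi_lie HE2 HE2 N22.
have B12 := nabla_xi_lie HE1 HE2 N12.
have B21 := nabla_xi_sym p HE1 HE2.
have tr := frame_trace F; have [_ _ h1 h2 _] := frame_h' F.
move=> s w; rewrite -/s in h1; rewrite -/w in h2; rewrite -B21.
move: B11 B22 B12 tr h1 h2; rewrite (gC acm (E1 p) (lie xi E1 p)).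
rewrite (gC acm (E1 p) (lie xi E2 p)) (gC acm (E2 p) (lie xi E2 p)).
clearbody s w; clear.
move: (g p _ _) (g p _ _) (g p _ _) (g p _ _) (g p _ _) (g p _ _) (g p _ _) => *.
split; lra.
Qed.

Lemma nabla_frame_xi p X : gl X ->
  (\forall q \near p, g q (X q) (xi q) = 0) -> g p (nabla xi X p) (xi p) = 0.
Proof.
by move=> HX E; rewrite (nabla_const gl_xi HX gl_xi E) nabla_xi_xi (g0r acm) oppr0.
Qed.

Lemma curvature_xi_frame X Z p : gl X -> gl Z -> eta p (X p) = 0 ->
  - dd (fun q => g q (nabla X xi q) (Z q)) p (xi p)
  + g p (nabla X xi p) (nabla xi Z p) + g p (nabla Z xi p) (nabla xi X p)
  - g p (nabla Z xi p) (nabla X xi p) =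
  kappa p * g p (X p) (Z p) + mu p * g p (h' X p) (Z p).
Proof.
move=> HX HZ X0; have := curvature_xi p HX gl_xi HZ.
have N : \forall q \near p, g q (nabla xi xi q) (Z q) = 0.
  by near=> q; rewrite nabla_xi_xi (g0l acm).
rewrite (dd_const _ N) nabla_xi_xi (g0l acm) X0 (acm_eta_xi acm) lieC.
rewrite nabla_bracket_xi// (gNr acm) (gBr acm).
rewrite (_ : _ + mu p * _ = kappa p * g p (X p) (Z p) + mu p * g p (h' X p) (Z p)).
  by move=> <-; ring.
ring.
Unshelve. all: by end_near. Qed.

(** Components of the Jacobi-type equations R(E_i, xi)xi along E_j. *)
Lemma frame_curvature p : frame E1 p ->
  let s q := g q (h' E1 q) (E1 q) in let w q := g q (h' E1 q) (E2 q) in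
  let om := g p (nabla xi E1 p) (E2 p) in
  [/\ - dd (fun q => g q (nabla E1 xi q) (E1 q)) p (xi p) + 2 * w p * om
        - ((1 + s p) ^+ 2 + w p ^+ 2) = kappa p + mu p * s p,
      - dd (fun q => g q (nabla E2 xi q) (E2 q)) p (xi p) - 2 * w p * om
        - ((1 - s p) ^+ 2 + w p ^+ 2) = kappa p - mu p * s p &
      - dd (fun q => g q (nabla E1 xi q) (E2 q)) p (xi p) - 2 * s p * om
        - 2 * w p = mu p * w p].
Proof.
move=> F s w om; have [e11 e22 e12 e10 e20] := frame_eqs F.
have N := near_frame_eqs F.
have N11 : \forall q \near p, g q (E1 q) (E1 q) = 1 by apply: filterS N => q [].
have N22 : \forall q \near p, g q (E2 q) (E2 q) = 1 by apply: filterS N => q [].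
have N12 : \forall q \near p, g q (E1 q) (E2 q) = 0 by apply: filterS N => q [].
have N10 : \forall q \near p, g q (E1 q) (xi q) = 0 by apply: filterS N => q [].
have N20 : \forall q \near p, g q (E2 q) (xi q) = 0 by apply: filterS N => q [].
have a0 : eta p (E1 p) = 0 by rewrite (eta_g acm).
have b0 : eta p (E2 p) = 0 by rewrite (eta_g acm).
have c11 := curvature_xi_frame HE1 HE1 a0.
have c22 := curvature_xi_frame HE2 HE2 b0.
have c12 := curvature_xi_frame HE1 HE2 a0.
have [B11 B22 B12 B21] := frame_nabla_xi F.
have [_ _ _ _ [h21 h22]] := frame_h' F.
have S1 := g_nabla_xi_xi p HE1; have S2 := g_nabla_xi_xi p HE2.
have X10 := nabla_frame_xi HE1 N10; have X20 := nabla_frame_xi HE2 N20.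
have X11 : g p (nabla xi E1 p) (E1 p) = 0.
  have := nabla_const gl_xi HE1 HE1 N11; rewrite (gC acm (E1 p)).
  by move: (g p _ _) => a; lra.
have X22 : g p (nabla xi E2 p) (E2 p) = 0.
  have := nabla_const gl_xi HE2 HE2 N22; rewrite (gC acm (E2 p)).
  by move: (g p _ _) => a; lra.
have X21 : g p (nabla xi E2 p) (E1 p) = - om.
  have := nabla_const gl_xi HE1 HE2 N12; rewrite (gC acm (E1 p)) -/om.
  by move=> ->; rewrite opprK.
rewrite (parseval (nabla E1 xi p) (nabla xi E1 p) F) in c11.
rewrite (parseval (nabla E1 xi p) (nabla E1 xi p) F) in c11.
rewrite (parseval (nabla E2 xi p) (nabla xi E2 p) F) in c22.
rewrite (parseval (nabla E2 xi p) (nabla E2 xi p) F) in c22.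
rewrite (parseval (nabla E1 xi p) (nabla xi E2 p) F) in c12.
rewrite (parseval (nabla E2 xi p) (nabla xi E1 p) F) in c12.
rewrite (parseval (nabla E2 xi p) (nabla E1 xi p) F) in c12.
rewrite S1 X10 X11 B11 B12 -/om -/(s p) -/(w p) e11 in c11.
rewrite S2 X20 X21 X22 B21 B22 h22 -/(s p) -/(w p) e22 in c22.
rewrite S1 S2 X10 X20 X11 X21 X22 B11 B12 B21 B22 -/om -/(s p) -/(w p) e12 in c12.
move: c11 c22 c12; clear; clearbody s w om.
move: (dd _ _ _) (dd _ _ _) (dd _ _ _) (kappa p) (mu p) (s p) (w p) => d11 d22 d12 k m s' w'.
move=> c11 c22 c12; split.
- lra.
- lra.
- lra.
Qed.

(** Summing the two diagonal components, where the trace of nabla xi is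
    constant, gives the eigenvalues of h'. *)
Lemma frame_eigenvalue p : frame E1 p ->
  g p (h' E1 p) (E1 p) ^+ 2 + g p (h' E1 p) (E2 p) ^+ 2 = -1 - kappa p.
Proof.
move=> F; have [c11 c22 _] := frame_curvature F.
have sm1 : smf (fun q => g q (nabla E1 xi q) (E1 q)) p.
  exact: (smf_g acm (gl_at p (gl_nabla HE1 gl_xi)) (gl_at p HE1)).
have sm2 : smf (fun q => g q (nabla E2 xi q) (E2 q)) p.
  exact: (smf_g acm (gl_at p (gl_nabla HE2 gl_xi)) (gl_at p HE2)).
have T : \forall q \near p,
    g q (nabla E1 xi q) (E1 q) + g q (nabla E2 xi q) (E2 q) = 2.
  apply: filterS (near_near F) => q Fq.
  by have [-> -> _ _] := frame_nabla_xi Fq; ring.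
have := ddD (xi p) sm1 sm2; rewrite (dd_const _ T).
move: c11 c22; clear.
move: (dd _ _ _) (dd _ _ _) (kappa p) (mu p) (g p _ _) (g p _ _) (g p _ _).
move=> d1 d2 k m s w om; nra.
Qed.

End frame_at.

Lemma smX_hp X q : smX X q -> smX (h' X) q.
Proof.
move=> HX; have H1 := smX_phi acm HX; have H2 := smX_phi acm H1.
have xs := gl_at q gl_xi.
have K := smX_phi acm (smX_lie xs H1).
have := smXZ (smf_cst 2^-1 q) (smXD (smX_lie xs H2) (smXZ (smf_cst (-1) q) K)).
apply: smX_eq; near=> x; rewrite hp_lie; congr (_ *: _); rewrite scaleN1r //.
Unshelve. all: by end_near. Qed.

Lemma hp_eq X X' q : (\forall x \near q, X x = X' x) -> h' X q = h' X' q.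
Proof.
move=> E; rewrite !hp_lie.
rewrite (@lie_eq _ _ _ xi xi (apply_endo phi X) (apply_endo phi X') q).
- rewrite (@lie_eq _ _ _ xi xi (apply_endo phi (apply_endo phi X))
    (apply_endo phi (apply_endo phi X')) q)//.
    by near=> x.
  by apply: filterS E => x Ex; rewrite /apply_endo Ex.
- by near=> x.
- by apply: filterS E => x Ex; rewrite /apply_endo Ex.
Unshelve. all: by end_near. Qed.

Lemma apply_endoP (f f' : M -> R) X Y :
  apply_endo phi (fun x => f x *: X x + f' x *: Y x) =
  fun x => f x *: apply_endo phi X x + f' x *: apply_endo phi Y x.
Proof. by apply: functional_extensionality_dep => x; rewrite /apply_endo linearP linearZ. Qed.

Lemma cancel_derivatives (V : lmodType R) (c f f' d d' : R) (a b u v u' v' : V) :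
  c *: (d *: a + f *: u + (d' *: b + f' *: v)
        - (d *: a + f *: u' + (d' *: b + f' *: v'))) =
  f *: (c *: (u - u')) + f' *: (c *: (v - v')).
Proof.
rewrite !scalerA ![_ * c]mulrC -!scalerA -scalerDr; congr (_ *: _).
rewrite !scalerBr opprD addrACA; congr (_ + _).
  by rewrite opprD addrACA subrr add0r.
by rewrite opprD addrACA subrr add0r.
Qed.

(** The derivative terms of the coefficients cancel: h' is tensorial. *)
Lemma hpP (f f' : M -> R) X Y q : smf f q -> smf f' q -> smX X q -> smX Y q ->
  h' (fun x => f x *: X x + f' x *: Y x) q = f q *: h' X q + f' q *: h' Y q.
Proof.
move=> fq fq' Xq Yq; rewrite !hp_lie !apply_endoP.
have xs := gl_at q gl_xi.
have X1 := smX_phi acm Xq; have Y1 := smX_phi acm Yq.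
have X2 := smX_phi acm X1; have Y2 := smX_phi acm Y1.
rewrite (lieDr xs (smXZ fq X2) (smXZ fq' Y2)) (lieDr xs (smXZ fq X1) (smXZ fq' Y1)).
rewrite (lieZr fq xs X2) (lieZr fq' xs Y2) (lieZr fq xs X1) (lieZr fq' xs Y1).
have PL (a b c d : R) (u v u' v' : tangent q) :
    phi q (a *: u + b *: v + (c *: u' + d *: v')) =
    a *: phi q u + b *: phi q v + (c *: phi q u' + d *: phi q v').
  by rewrite !linearD !linearZ.
rewrite PL; exact: cancel_derivatives.
Qed.

Lemma near_pos (f : M -> R) p : smf f p -> 0 < f p -> \forall q \near p, 0 < f q.
Proof.
move=> /smf_continuous fc f0; apply: (@near_continuous _ _ f (fun y => 0 < y) p fc).
by apply: open_near => //; exact: open_gt.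
Qed.

(** Otherwise all of R^3 would lie on the line of xi. *)
Lemma exists_tangent_contact p : exists i : 'I_3,
  (delta_mx 0 i : tangent p) + (- eta p (delta_mx 0 i)) *: xi p != 0.
Proof.
apply: contrapT => H.
have Z i : (delta_mx 0 i : 'rV[R]_3) = eta p (delta_mx 0 i) *: xi p.
  apply/eqP; rewrite -subr_eq0; apply: contraT => N; exfalso; apply: H.
  by exists i; rewrite scaleNr.
have Z0 := Z 0; have Z1 := Z 1; move: (eta p _) (eta p _) Z0 Z1 => a b.
move: (xi p) => x Z0 Z1.
have := congr1 (fun v : 'rV[R]_3 => v 0 0) Z0; rewrite !mxE /= => A00.
have := congr1 (fun v : 'rV[R]_3 => v 0 1) Z0; rewrite !mxE /= => A01.
have := congr1 (fun v : 'rV[R]_3 => v 0 1) Z1; rewrite !mxE /= => A11.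
move/esym/eqP: A01; rewrite mulf_eq0 => /orP[/eqP a0|/eqP x0].
  by move/eqP: A00; rewrite a0 mul0r oner_eq0.
by move/eqP: A11; rewrite x0 mulr0 oner_eq0.
Qed.

Lemma exists_frame p : exists E, gl E /\ frame E p.
Proof.
have ap := chart_at_atlas p; have pp := chart_at_dom p.
have [i Hi] := exists_tangent_contact p.
pose C := coord_field (chart_at p) i.
have sC : smX C p by exact: smX_coord_field.
pose W q := C q + (- eta q (C q)) *: xi q.
have sW : smX W p.
  apply: (smXD sC); apply: smXZ; last exact: gl_at gl_xi.
  by apply: smfN; exact: (smf_eta acm sC).
have Wp : W p != 0.
  have Cp : C p = delta_mx 0 i by rewrite -(tcoord_coord_field i ap pp) tcoord_chart_at.
  by rewrite /W Cp.
have eW q : eta q (W q) = 0.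
  by rewrite /W addrC (etaP acm) (acm_eta_xi acm) mulr1 addNr.
pose N q := g q (W q) (W q).
have sN : smf N p by exact: (smf_g acm sW sW).
have N0 : 0 < N p by exact: metric_pos (acm_metric acm) _ _ Wp.
have sE : smX (fun q => (Num.sqrt (N q))^-1 *: W q) p.
  apply: (smXZ _ sW); apply: smfV; first by rewrite gt_eqF// sqrtr_gt0.
  exact: smf_sqrt.
have [E [HE EE]] := extend_field sE.
exists E; split => //; apply: filterS2 EE (near_pos sN N0) => q -> Nq.
rewrite (etaZ acm) eW mulr0 (gZl acm) (gZr acm) -/(N q); split => //.
by rewrite mulrA -expr2 exprVn sqr_sqrtr ?ltW// mulVf// gt_eqF.
Qed.

Lemma frame_phi E p : frame E p -> frame (apply_endo phi E) p.
Proof.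
move=> F; apply: filterS (near_frame_eqs F) => q [e11 e22 _ _ e20].
by rewrite (eta_g acm).
Qed.

Hypothesis kappa_lt : forall p, kappa p < -1.
Let lam q := Num.sqrt (-1 - kappa q).

Lemma lam_sqr q : lam q ^+ 2 = -1 - kappa q.
Proof. by rewrite sqr_sqrtr// subr_ge0 ltW. Qed.

Lemma lam_gt0 q : 0 < lam q.
Proof. by rewrite sqrtr_gt0 subr_gt0. Qed.

Lemma smf_kappa q : smf kappa q.
Proof. by have /(smooth_funP _ openT) := gkm_kappa_smooth Mkm; exact. Qed.

Lemma smf_lam q : smf lam q.
Proof.
apply: smf_sqrt; first by rewrite subr_gt0.
by apply: smfB; [exact: smf_cst|exact: smf_kappa].
Qed.

(** The condition is imposed near p, so that it may be differentiated. *)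
Definition eigenframe E p :=
  frame E p /\ \forall q \near p, h' E q = lam q *: E q.

(** Rotating a frame E1, E2 with nonnegative first component s of h': the vector
    h' E1 + lam E1 does not vanish and is an eigenvector. *)
Lemma exists_eigenframe p : exists E, gl E /\ eigenframe E p.
Proof.
have [E1 [HE1 [F s0]]] : exists E1, gl E1 /\ frame E1 p /\ 0 <= g p (h' E1 p) (E1 p).
  have [E [HE F]] := exists_frame p.
  have [s0|s0] := leP 0 (g p (h' E p) (E p)); first by exists E.
  exists (apply_endo phi E); split; first exact: gl_phi.
  split; first exact: frame_phi.
  by have [_ _ _ _ [_ ->]] := frame_h' HE F; rewrite oppr_ge0 ltW.
have HE2 := gl_phi HE1; set E2 := apply_endo phi E1 in HE2 *.
pose s q := g q (h' E1 q) (E1 q); pose w q := g q (h' E1 q) (E2 q).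
have sE1 := gl_at p HE1; have sE2 := gl_at p HE2.
have ss : smf s p by exact: (smf_g acm (smX_hp sE1) sE1).
have sw : smf w p by exact: (smf_g acm (smX_hp sE1) sE2).
pose a q := s q + lam q.
have sa : smf a p by exact: (smfD ss (smf_lam p)).
pose N q := a q * a q + w q * w q.
have sN : smf N p by apply: smfD; exact: smfM.
have a0 : 0 < a p by rewrite ltr_wpDl// lam_gt0.
have N0 : 0 < N p by rewrite ltr_pwDl ?mulr_gt0// -expr2 sqr_ge0.
pose r q := (Num.sqrt (N q))^-1.
have sr : smf r p.
  apply: smfV; first by rewrite gt_eqF// sqrtr_gt0.
  exact: smf_sqrt.
have sf := smfM sr sa; have sf' := smfM sr sw.
have sV : smX (fun q => (r q * a q) *: E1 q + (r q * w q) *: E2 q) p.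
  by apply: smXD; exact: smXZ.
have [E [HE EE]] := extend_field sV.
exists E; split => //; split.
  apply: filterS3 EE (near_frame_eqs F) (near_pos sN N0).
  move=> q -> [e11 e22 e12 e10 e20] Nq; split.
    rewrite !(gDl acm, gDr acm, gZl acm, gZr acm) e11 e22 e12 (gC acm (E2 q)) e12.
    transitivity (r q ^+ 2 * N q); first by rewrite /N; ring.
    by rewrite /r exprVn sqr_sqrtr ?ltW// mulVf// gt_eqF.
  by rewrite (eta_g acm) !(gDl acm, gZl acm) e10 e20 !mulr0 addr0.
have NE := near_near EE.
apply: filterS3 NE (near_near F) (filterI (smf_near sf) (smf_near sf')).
move=> q Eq Fq [sfq sfq'].
rewrite (hp_eq Eq) (hpP sfq sfq' (gl_at q HE1) (gl_at q HE2)) (nbhs_singleton Eq).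
have [e1 e2 _ _ [h21 h22]] := frame_h' HE1 Fq.
rewrite (frame_expand (h' E1 q) Fq) (frame_expand (h' E2 q) Fq) e1 e2 h21 h22.
rewrite -/E2 -/(s q) -/(w q) scale0r !add0r.
have ev := frame_eigenvalue HE1 Fq; rewrite -/E2 -/(s q) -/(w q) -lam_sqr in ev.
move: (E1 q) (E2 q) => u v; rewrite /a.
move: (s q) (w q) (lam q) (r q) ev => s' w' l r' ev.
rewrite !scalerDr !scalerA addrACA -!scalerDl; congr (_ *: _ + _ *: _).
  transitivity (r' * (s' ^+ 2 + w' ^+ 2 + l * s')); first by ring.
  by rewrite ev; ring.
by ring.
Qed.

Hypothesis dkappa_eta : forall (p : M) (u v : tangent p),
  wedge11 (differential kappa) eta p u v = 0.

Lemma dd_kappa p (u : tangent p) : dd kappa p u = dd kappa p (xi p) * eta p u.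
Proof.
have := dkappa_eta u (xi p); rewrite /wedge11 -ddE (acm_eta_xi acm) mulr1.
by move=> /eqP; rewrite subr_eq0 => /eqP.
Qed.

Lemma dd_kappa_lam p (u : tangent p) : dd kappa p u = - (2 * lam p * dd lam p u).
Proof.
have E : \forall q \near p, kappa q + lam q * lam q = -1.
  by near=> q; rewrite -expr2 lam_sqr; ring.
have sl := smf_lam p; have sk := smf_kappa p.
have := ddD u sk (smfM sl sl); rewrite (dd_const _ E) (ddM u sl sl).
move: (dd _ _ _) (dd _ _ _) (lam p) => a b c; lra.
Unshelve. all: by end_near. Qed.

(** In an eigenframe the curvature condition forces both the rotation of the
    frame along xi and the bracket of E with phi E to vanish. *)
Lemma eigenframe_eqs E p : gl E -> eigenframe E p ->
  let l := lam p in
  [/\ lie xi E p = - (1 + l) *: E p,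
      lie xi (apply_endo phi E) p = - (1 - l) *: apply_endo phi E p,
      lie E (apply_endo phi E) p = 0 &
      dd kappa p (xi p) = -2 * (kappa p + 1) * (mu p + 2)].
Proof.
have aux1 (b : R) : 2 * 0 = - 0 - b -> b = 0 by lra.
have aux2 (a d l : R) : 2 * l = d - a -> a + d = -2 -> a = - (1 + l) by lra.
have aux3 (a d l : R) : 2 * l = d - a -> a + d = -2 -> d = - (1 - l) by lra.
have aux4 (a b c l : R) : 0 < l -> c = - c -> a = - b ->
    0 - (1 - l) * a - (0 - (1 + l) * c) - (1 + l) * (b - c) = 0 -> b - c = 0.
  move=> l0 c0 -> k; have {}c0 : c = 0 by lra.
  move: k; rewrite c0 => k; have /eqP : 2 * l * b = 0 by lra.
  by rewrite !mulf_eq0 pnatr_eq0 (gt_eqF l0) /= => /eqP ->; rewrite subr0.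
have aux5 (d e f l : R) : 0 < l -> d = - d -> f = - e ->
    - 0 - (1 - l) * d - (0 - (1 + l) * e) - (1 - l) * (d - f) = 0 -> d - f = 0.
  move=> l0 d0 -> k; have {}d0 : d = 0 by lra.
  move: k; rewrite d0 => k; have /eqP : 2 * l * e = 0 by lra.
  by rewrite !mulf_eq0 pnatr_eq0 (gt_eqF l0) /= => /eqP ->; rewrite oppr0 subr0.
have aux6 (k m d l : R) : l ^+ 2 = -1 - k ->
    - d + 2 * 0 * 0 - ((1 + l) ^+ 2 + 0 ^+ 2) = k + m * l ->
    - (2 * l * d) = -2 * (k + 1) * (m + 2).
  move=> lsq c; have -> : k = -1 - l ^+ 2 by lra.
  have -> : d = - (1 + l) ^+ 2 - (k + m * l) by lra.
  have -> : k = -1 - l ^+ 2 by lra.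
  ring.
move=> HE [F hE] l; set E2 := apply_endo phi E; have HE2 : gl E2 by exact: gl_phi.
have l0 : 0 < l := lam_gt0 p.
have Nf := near_frame_eqs F.
have [e11 e22 e12 e10 e20] := nbhs_singleton Nf.
have N11 : \forall q \near p, g q (E q) (E q) = 1 by apply: filterS Nf => q [].
have N22 : \forall q \near p, g q (E2 q) (E2 q) = 1 by apply: filterS Nf => q [].
have N12 : \forall q \near p, g q (E q) (E2 q) = 0 by apply: filterS Nf => q [].
have N10 : \forall q \near p, eta q (E q) = 0 by apply: filterS F => q [].
have N20 : \forall q \near p, eta q (E2 q) = 0 by near=> q; exact: eta_phi acm _ _.
have Ns : \forall q \near p, g q (h' E q) (E q) = lam q /\ g q (h' E q) (E2 q) = 0.
  apply: filterS2 hE Nf => q -> [g11 _ g12 _ _].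
  by rewrite !(gZl acm) g11 g12 mulr1 mulr0.
have [sp wp] := nbhs_singleton Ns.
have NB : \forall q \near p,
   [/\ g q (nabla E xi q) (E q) = 1 + lam q, g q (nabla E2 xi q) (E2 q) = 1 - lam q
     & g q (nabla E xi q) (E2 q) = 0].
  apply: filterS2 (near_near F) Ns => q Fq [sq wq].
  by have [-> -> -> _] := frame_nabla_xi HE Fq; rewrite sq wq.
have dB11 u : dd (fun q => g q (nabla E xi q) (E q)) p u = dd lam p u.
  rewrite (@dd_eq _ _ _ _ (fun q => 1 + lam q)); last by apply: filterS NB => q [].
  by rewrite (ddD u (smf_cst 1 p) (smf_lam p)) dd_cst add0r.
have dB22 u : dd (fun q => g q (nabla E2 xi q) (E2 q)) p u = - dd lam p u.
  rewrite (@dd_eq _ _ _ _ (fun q => 1 + (-1) * lam q)); last first.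
    by apply: filterS NB => q [_ -> _]; rewrite mulN1r.
  rewrite (ddD u (smf_cst 1 p) (smfM (smf_cst (-1) p) (smf_lam p))) dd_cst add0r.
  by rewrite (ddM u (smf_cst (-1) p) (smf_lam p)) dd_cst mulr0 addr0 mulN1r.
have N12' : \forall q \near p, g q (nabla E xi q) (E2 q) = 0.
  by apply: filterS NB => q [].
have dl0 u : eta p u = 0 -> dd lam p u = 0.
  move=> u0; have := dd_kappa_lam u; rewrite dd_kappa u0 mulr0 => /esym/eqP.
  by rewrite oppr_eq0 !mulf_eq0 pnatr_eq0 (gt_eqF l0) /= => /eqP.
have [c11 _ c12] := frame_curvature HE F.
rewrite dB11 sp wp -/l in c11; rewrite (dd_const _ N12') sp wp -/l in c12.
have om0 : g p (nabla xi E p) (E2 p) = 0.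
  move: c12; rewrite mulr0 !oppr0 add0r addr0 mulr0 => /eqP.
  by rewrite oppr_eq0 !mulf_eq0 pnatr_eq0 (gt_eqF l0) /= => /eqP.
rewrite -/E2 om0 in c11.
have lsq := lam_sqr p; rewrite -/l in lsq.
have [h1 h2 ha hb _] := frame_h' HE F.
have tr := frame_trace HE F; rewrite -/E2 sp wp -/l in ha hb tr.
have [B11 B22 B12 B21] := frame_nabla_xi HE F; rewrite sp wp -/l -/E2 in B11 B22 B12 B21.
have z1 := eta_bracket gl_xi HE (eta_xi_near p) N10.
have z2 := eta_bracket gl_xi HE2 (eta_xi_near p) N20.
have z3 := eta_bracket HE HE2 N10 N20.
rewrite !(eta_g acm) in z1 z2 z3.
have b0 : g p (lie xi E p) (E2 p) = 0.
  by rewrite nabla_bracket_xi// (gBl acm) om0 B12 subrr.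
split.
- rewrite (frame_expand (lie xi E p) F) z1 -/E2 b0 !scale0r add0r addr0.
  congr (_ *: _); exact: aux2 ha tr.
- rewrite (frame_expand (lie xi E2 p) F) z2 -/E2 scale0r add0r.
  have -> : g p (lie xi E2 p) (E p) = 0.
    by move: hb; rewrite b0; exact: aux1.
  rewrite scale0r add0r.
  congr (_ *: _); exact: aux3 ha tr.
- have a0 : eta p (E p) = 0 by exact: nbhs_singleton N10.
  have b0' : eta p (E2 p) = 0 by exact: nbhs_singleton N20.
  have S1 := g_nabla_xi_xi p HE; have S2 := g_nabla_xi_xi p HE2.
  have T1 := nabla_const HE HE HE2 N12; have T2 := nabla_const HE2 HE HE2 N12.
  have U11 := nabla_const HE2 HE HE N11; have U22 := nabla_const HE HE2 HE2 N22.
  have LL := torsion_free p HE HE2.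
  have N21' : \forall q \near p, g q (nabla E2 xi q) (E q) = 0.
    by apply: filterS N12' => q; rewrite (nabla_xi_sym q HE2 HE).
  have k1 := curvature_xi p HE HE2 HE; have k2 := curvature_xi p HE HE2 HE2.
  rewrite a0 b0' !mul0r !subrr !mulr0 !addr0 (dd_const _ N21') dB11 (dl0 _ b0') in k1.
  rewrite a0 b0' !mul0r !subrr !mulr0 !addr0 (dd_const _ N12') dB22 (dl0 _ a0) in k2.
  have P1 v : g p (nabla E xi p) v = (1 + l) * g p v (E p).
    by rewrite (parseval _ v F) -/E2 S1 B11 B12 !mul0r addr0 add0r.
  have P2 v : g p (nabla E2 xi p) v = (1 - l) * g p v (E2 p).
    by rewrite (parseval _ v F) -/E2 S2 B22 B21 !mul0r !add0r.
  rewrite !P1 !P2 -LL in k1 k2.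
  rewrite !(gBl acm) in k1 k2.
  have LA : g p (lie E E2 p) (E p) = 0.
    rewrite -LL (gBl acm).
    rewrite (gC acm (E p) (nabla E E2 p)) in T1.
    rewrite (gC acm (E p) (nabla E2 E p)) in U11.
    exact: aux4 l0 U11 T1 k1.
  have LB : g p (lie E E2 p) (E2 p) = 0.
    rewrite -LL (gBl acm).
    rewrite (gC acm (E p) (nabla E2 E2 p)) in T2.
    rewrite (gC acm (E2 p) (nabla E E2 p)) in U22.
    exact: aux5 l0 U22 T2 k2.
  by rewrite (frame_expand (lie E E2 p) F) z3 LA -/E2 LB !scale0r !addr0.
- by rewrite dd_kappa_lam -/l; exact: aux6 lsq c11.
Unshelve. all: by end_near. Qed.

Lemma near_eigenframe E p : eigenframe E p -> \forall q \near p, eigenframe E q.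
Proof.
move=> [F hE]; apply: filterS2 (near_near F) (near_near hE) => q Fq hq.
by split.
Qed.

(** kappa = -1 - lam^2 with lam > 0, and d kappa is proportional to eta. *)
Lemma dd_lam_contact p (u : tangent p) : eta p u = 0 -> dd lam p u = 0.
Proof.
move=> u0; have := dd_kappa_lam u; rewrite dd_kappa u0 mulr0 => /esym/eqP.
by rewrite oppr_eq0 !mulf_eq0 pnatr_eq0 (gt_eqF (lam_gt0 p)) /= => /eqP.
Qed.

Lemma smf_mu q : smf mu q.
Proof. by have /(smooth_funP _ openT) := gkm_mu_smooth Mkm; exact. Qed.

Lemma hp_xi p : h' xi p = 0.
Proof.
have E : \forall q \near p, xi q = 0 *: xi q + 1 *: xi q.
  by near=> q; rewrite scale0r add0r scale1r.
have z (f : vector_field M) : f = (fun q => 0 *: xi q) -> lie xi f p = 0.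
  move=> ->; have xs := gl_at p gl_xi.
  by rewrite (lieZr (smf_cst 0 p) xs xs) dd_cst !scale0r addr0.
rewrite hp_lie !z.
- by rewrite linear0 subr0 scaler0.
- by apply: functional_extensionality_dep => q; rewrite /apply_endo (phi_xi acm) scale0r.
- apply: functional_extensionality_dep => q.
  by rewrite /apply_endo (phi_xi acm) linear0 scale0r.
Unshelve. all: by end_near. Qed.

Lemma eigenframe_h' E p : gl E -> eigenframe E p ->
  h' (apply_endo phi E) p = (- lam p) *: apply_endo phi E p.
Proof.
move=> HE [F /nbhs_singleton hE]; have [e11 e22 e12 _ _] := frame_eqs F.
have [_ h2 _ _ [h21 h22]] := frame_h' HE F.
rewrite hE !(gZl acm) e11 e12 mulr0 mulr1 in h21 h22.
by rewrite (frame_expand (h' (apply_endo phi E) p) F) h2 h21 h22 !scale0r !add0r.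
Qed.

(** The bracket relations make xi(kappa), hence mu, invariant along the frame. *)
Lemma eigenframe_mu E Y c p : gl E -> eigenframe E p -> gl Y ->
  (\forall q \near p, eta q (Y q) = 0) -> lie xi Y p = c *: Y p ->
  dd mu p (Y p) = 0.
Proof.
move=> HE EF HY Y0 br; have Yp : eta p (Y p) = 0 by exact: nbhs_singleton Y0.
have xs := gl_at p gl_xi; have Ys := gl_at p HY.
have sk := smf_kappa p; have sm := smf_mu p.
have kY : \forall q \near p, dd kappa q (Y q) = 0.
  by apply: filterS Y0 => q Yq; rewrite dd_kappa Yq mulr0.
have H := dd_lie sk xs Ys; rewrite br (dd_const _ kY) sub0r in H.
rewrite dd_kappa (etaZ acm) Yp !mulr0 in H.
have N : \forall q \near p,
    dd kappa q (xi q) = (-2 * kappa q + -2) * (mu q + 2).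
  apply: filterS (near_eigenframe EF) => q /(eigenframe_eqs HE)[_ _ _ ->].
  ring.
have sA : smf (fun q => -2 * kappa q + -2) p.
  exact: (smfD (smfM (smf_cst (-2) p) sk) (smf_cst (-2) p)).
have sB : smf (fun q => mu q + 2) p by exact: (smfD sm (smf_cst 2 p)).
rewrite (dd_eq _ N) (ddM _ sA sB) in H.
rewrite (ddD _ (smfM (smf_cst (-2) p) sk) (smf_cst (-2) p)) in H.
rewrite (ddM _ (smf_cst (-2) p) sk) !dd_cst in H.
rewrite dd_kappa Yp (ddD _ sm (smf_cst 2 p)) dd_cst in H.
have k1 := kappa_lt p.
move: H; move: (dd mu p (Y p)) (dd kappa p (xi p)) (mu p) (kappa p) k1 => a b m k k1 H.
have {}H : (k + 1) * a = 0 by lra.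
by move/eqP: H; rewrite mulf_eq0 => /orP[/eqP H|/eqP//]; lra.
Qed.

End geometry.

(** * Closed one-forms and adapted coordinates *)

Lemma derive_pairing (R : realType) n (th : 'I_n -> 'rV[R]_n -> R)
    (Z : 'rV[R]_n -> 'rV[R]_n) u v :
  (forall i, smooth_at (th i) u) -> smooth_at Z u ->
  'D_v (fun x => pairing th x (Z x)) u =
  \sum_i 'D_v (th i) u * Z u 0 i + pairing th u ('D_v Z u).
Proof.
move=> ths Zs; have dZ := smooth_at_differentiable Zs.
have dZi i : derivable (fun x => Z x 0 i) u v.
  by apply: diff_derivable; exact: differentiable_rVi.
have dti i : derivable (th i) u v.
  by apply: diff_derivable; exact: smooth_at_differentiable.
have -> : (fun x => pairing th x (Z x)) = \sum_i (th i * (fun x => Z x 0 i)).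
  by apply/funext => x; rewrite fct_sumE.
rewrite derive_sum; last by move=> i; exact: derivableM.
rewrite /pairing -big_split; apply: eq_bigr => i _ /=.
rewrite (deriveM (dti i) (dZi i)) (derive_rV _ _ dZ) addrC.
by congr (_ + _); exact: mulrC.
Qed.

Lemma near_chart_ball (R : realType) n (M : smooth_manifold R n) (P : M -> Prop)
    (c : chart R n M) p : chart_dom c p ->
  (\forall q \near p, P q) -> exists2 r : R, 0 < r &
  forall u, `|u - chart_map c p| < r ->
    exists q, [/\ chart_dom c q, chart_map c q = u, chart_inv c u = q & P q].
Proof.
move=> cp /(near_chart_inv cp) nP.
have /nbhs_ballP[r /= r0 Hr] : nbhs (chart_map c p) (fun u =>
  (chart_map c @` chart_dom c) u /\ P (chart_inv c u)).
  by apply: filterI; [exact: near_img|exact: nP].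
exists r => // u ur; have [[q cq qu] Pq] := Hr u ((ball_rV _ _ _).2 ur).
exists q; split => //; first by rewrite -qu chart_mapK.
by move: Pq; rewrite -qu chart_mapK.
Qed.

Section local_primitive.
Context {R : realType} {M : smooth_manifold R 3}.

(** The exterior derivative of alpha evaluated on X and Y, by the invariant formula
    that avoids coordinates. *)
Definition form_deriv (alpha : one_form M) (X Y : vector_field M) q : R :=
  dd (fun x => alpha x (Y x)) q (X q) - dd (fun x => alpha x (X x)) q (Y q)
  - alpha q (lie X Y q).

Lemma sum_delta (f : 'I_3 -> R) j :
  \sum_i f i * (delta_mx 0 j : 'rV[R]_3) 0 i = f j.
Proof.
rewrite (bigD1 j)//= mxE !eqxx mulr1 big1 ?addr0// => i ij.
by rewrite mxE (negbTE ij) andbF mulr0.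
Qed.

Section exterior.
Variable th : 'I_3 -> 'rV[R]_3 -> R.
Variable u : 'rV[R]_3.
Hypothesis ths : forall i, smooth_at (th i) u.

(** The exterior derivative at u of the form with coefficients th. *)
Definition exterior (v w : 'rV[R]_3) : R :=
  \sum_i 'D_v (th i) u * w 0 i - \sum_i 'D_w (th i) u * v 0 i.

Lemma exteriorP a v v' w :
  exterior (a *: v + v') w = a * exterior v w + exterior v' w.
Proof.
have d i := smooth_at_differentiable (ths i).
have A : \sum_i 'D_(a *: v + v') (th i) u * w 0 i =
    a * (\sum_i 'D_v (th i) u * w 0 i) + \sum_i 'D_v' (th i) u * w 0 i.
  rewrite mulr_sumr -big_split; apply: eq_bigr => i _.
  by rewrite (derivevD _ _ _ (d i)) -[a *: _]/(a * _) mulrDl mulrA.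
have B : \sum_i 'D_w (th i) u * (a *: v + v') 0 i =
    a * (\sum_i 'D_w (th i) u * v 0 i) + \sum_i 'D_w (th i) u * v' 0 i.
  rewrite mulr_sumr -big_split; apply: eq_bigr => i _ /=.
  by rewrite !mxE mulrDr mulrCA.
by rewrite /exterior A B; move: (\sum_i _) (\sum_i _) (\sum_i _) (\sum_i _) => *; ring.
Qed.

Lemma exteriorC v w : exterior v w = - exterior w v.
Proof. by rewrite /exterior opprB. Qed.

Lemma exteriorPr a v w w' :
  exterior v (a *: w + w') = a * exterior v w + exterior v w'.
Proof. by rewrite exteriorC exteriorP [exterior v w]exteriorC [exterior v w']exteriorC; ring. Qed.

Lemma exterior_vv v : exterior v v = 0.
Proof. by rewrite /exterior subrr. Qed.

Lemma exterior_v0 v : exterior v 0 = 0.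
Proof. by have := exteriorPr (-1) v 0 0; rewrite scaler0 addr0; lra. Qed.

Lemma exterior_0v v : exterior 0 v = 0.
Proof. by rewrite exteriorC exterior_v0 oppr0. Qed.

(** An alternating form is determined by its values on a frame. The trailing 0
    brings the combination to the shape a *: u + v of the linearity lemmas. *)
Lemma exterior_span (x y z : 'rV[R]_3) :
  exterior x y = 0 -> exterior x z = 0 -> exterior y z = 0 ->
  (forall v, exists a b c, v = a *: x + (b *: y + (c *: z + 0))) ->
  forall v w, exterior v w = 0.
Proof.
move=> xy xz yz span v w.
have [a [b [c ->]]] := span v; have [a' [b' [c' ->]]] := span w.
have yx : exterior y x = 0 by rewrite exteriorC xy oppr0.
have zx : exterior z x = 0 by rewrite exteriorC xz oppr0.
have zy : exterior z y = 0 by rewrite exteriorC yz oppr0.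
rewrite !exteriorPr !exteriorP !exterior_vv ?exterior_v0 ?exterior_0v.
by rewrite xy xz yz yx zx zy; ring.
Qed.

End exterior.

Section in_chart.
Unset Implicit Arguments.
Variables (alpha : one_form M) (c : chart R 3 M).
Set Implicit Arguments.
Hypothesis alphaP : forall q a (u v : tangent q),
  alpha q (a *: u + v) = a * alpha q u + alpha q v.
Hypothesis ac : atlas c.

(** Coefficients of alpha in the chart c, as functions on R^3. *)
Definition form_coef (j : 'I_3) (u : 'rV[R]_3) : R :=
  alpha (chart_inv c u) (coord_field c j (chart_inv c u)).

Lemma form_pairing q (v : tangent q) : chart_dom c q ->
  alpha q v = pairing form_coef (chart_map c q) (tcoord c v).
Proof.
move=> cq; rewrite {1}(tangent_expand v ac cq) (form_sum _ _ _ (alphaP (q := q))).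
by apply: eq_bigr => i _; rewrite /form_coef (chart_mapK cq) mulrC.
Qed.

(** The terms that differentiate the components of X and Y cancel against the
    bracket. *)
Lemma form_deriv_chart X Y q : chart_dom c q ->
  (forall X, smX X q -> smf (fun x => alpha x (X x)) q) ->
  smX X q -> smX Y q ->
  form_deriv alpha X Y q =
  exterior form_coef (chart_map c q) (tcoord c (X q)) (tcoord c (Y q)).
Proof.
have alg (a b a' b' : R) : a + b - (a' + b') - (b - b') = a - a' by ring.
move=> cq sa Xq Yq; set u := chart_map c q.
have ths i : smooth_at (form_coef i) u.
  by have := sa _ (smX_coord_field i ac cq) => /(smfE _ ac cq).
have dth i := smooth_at_differentiable (ths i).
have key (Z : vector_field M) (v : tangent q) : smX Z q ->
    dd (fun x => alpha x (Z x)) q v =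
    \sum_i 'D_(tcoord c v) (form_coef i) u * tcoord c (Z q) 0 i +
    pairing form_coef u ('D_(tcoord c v) (field_in c Z) u).
  move=> Zq; rewrite ddE (differentialE v ac cq (sa Z Zq)).
  have ZA : smooth_at (field_in c Z) u by apply/smXE.
  have := derive_pairing (tcoord c v) ths ZA; rewrite (field_in_map Z cq).
  apply: etrans; apply: near_eq_derive; apply: filterS (near_img cq) => _ [x cx <-].
  by rewrite /= (chart_mapK cx) (form_pairing (Z x) cx) (field_in_map _ cx).
rewrite /form_deriv (key Y _ Yq) (key X _ Xq) (form_pairing _ cq) lieE.
rewrite (bracket_in_chart ac cq Xq Yq).
rewrite -/u /exterior /pairing.
rewrite (_ : \sum_i form_coef i u * ('D_(tcoord c (X q)) (field_in c Y) u -
    'D_(tcoord c (Y q)) (field_in c X) u) 0 i =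
  \sum_i form_coef i u * ('D_(tcoord c (X q)) (field_in c Y) u) 0 i -
  \sum_i form_coef i u * ('D_(tcoord c (Y q)) (field_in c X) u) 0 i); last first.
  by rewrite -sumrB; apply: eq_bigr => i _; rewrite !mxE mulrBr.
exact: alg.
Qed.

End in_chart.

(** Poincare's lemma, the closedness being checked on a frame. *)
Lemma local_primitive (alpha : one_form M) (X Y Z : vector_field M) (p : M) :
  (forall q a (u v : tangent q), alpha q (a *: u + v) = a * alpha q u + alpha q v) ->
  (\forall q \near p, forall X, smX X q -> smf (fun x => alpha x (X x)) q) ->
  (\forall q \near p, [/\ smX X q, smX Y q & smX Z q]) ->
  (\forall q \near p, forall v : tangent q,
     exists a b c, v = a *: X q + (b *: Y q + (c *: Z q + 0))) ->
  (\forall q \near p, [/\ form_deriv alpha X Y q = 0, form_deriv alpha X Z q = 0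
     & form_deriv alpha Y Z q = 0]) ->
  exists f : M -> R, \forall q \near p,
    smf f q /\ forall v : tangent q, dd f q v = alpha q v.
Proof.
move=> alphaP sa sX span closed.
have ac := chart_at_atlas p; have cp := chart_at_dom p; set c := chart_at p in ac cp.
have [r r0 Hr] := near_chart_ball cp
  (filterI (filterI sa sX) (filterI span closed)).
pose th := form_coef alpha c.
have ths i u : `|u - chart_map c p| < r -> smooth_at (th i) u.
  move=> /Hr[q [cq <- _ [[saq _] _]]].
  by have := saq _ (smX_coord_field i ac cq) => /(smfE _ ac cq).
have thc i j u : `|u - chart_map c p| < r ->
    'D_(delta_mx 0 i) (th j) u = 'D_(delta_mx 0 j) (th i) u.
  move=> ur; have [q [cq qu _ [[saq [Xq Yq Zq]] [spanq [xy xz yz]]]]] := Hr u ur.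
  rewrite (form_deriv_chart alphaP ac cq saq Xq Yq) qu in xy.
  rewrite (form_deriv_chart alphaP ac cq saq Xq Zq) qu in xz.
  rewrite (form_deriv_chart alphaP ac cq saq Yq Zq) qu in yz.
  have := @exterior_span th u (fun i => ths i u ur) _ _ _ xy xz yz.
  move=> /(_ _ (delta_mx 0 i) (delta_mx 0 j)); rewrite /exterior !sum_delta => H.
  apply/eqP; rewrite -subr_eq0; apply/eqP; apply: H => v.
  have [a [b [d vE]]] := spanq (tuncoord c q v); exists a, b, d.
  by rewrite -(tuncoordK v ac cq) vE !(tcoordP _ _ _ ac cq) (tcoord0 ac cq).
have [F HF] := poincare ths thc.
exists (fun x => F (chart_map c x)).
have nb : \forall q \near p, `|chart_map c q - chart_map c p| < r.
  apply: (@near_chart_map _ _ _ c p (fun u => `|u - chart_map c p| < r) cp).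
  have : \forall u \near chart_map c p, ball (chart_map c p) r u.
    by apply: open_near; [exact: ball_open|exact: ballxx].
  by apply: filterS => u /ball_rV.
apply: filterS2 nb (near_dom cp) => q qr cq; have [Fs FD] := HF _ qr.
have E : \forall u \near chart_map c q, F u = ((fun x => F (chart_map c x)) \o chart_inv c) u.
  by apply: filterS (near_img cq) => u iu; rewrite /= chart_invK.
have sf : smf (fun x => F (chart_map c x)) q.
  by apply/(smfE _ ac cq); exact: smooth_at_eq E Fs.
split => // v; rewrite ddE (differentialE v ac cq sf) -(near_eq_derive _ E) FD.
by rewrite (form_pairing alphaP ac v cq).
Qed.

Lemma smf_expR (f : M -> R) q : smf f q -> smf (fun x => expR (f x)) q.
Proof. exact: smooth_at_expR. Qed.

Lemma dd_expR (f : M -> R) q (v : tangent q) : smf f q ->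
  dd (fun x => expR (f x)) q v = expR (f q) * dd f q v.
Proof.
move=> sf; have df := smf_differentiable sf; have qq := chart_at_dom q.
rewrite ddE /differential.
have dE x : differentiable (@expR R) x by exact/derivable1_diffP.
rewrite -[LHS]/('D_v (expR \o (f \o chart_inv (chart_at q))) _).
rewrite (derive_comp _ df (dE _)) derive_scale1// derive_val /= (chart_mapK qq).
exact: mulrC.
Qed.

End local_primitive.

Section adapted_coordinate.
Context {R : realType} {M : smooth_manifold R 3}.
Unset Implicit Arguments.
Variables (phi : endo_field M) (xi : vector_field M) (eta : one_form M).
Variable g : two_tensor M.
Hypothesis Mak : almost_kenmotsu phi xi eta g.
Set Implicit Arguments.
Let acm := ak_acm Mak.

(** First a primitive G of l eta, then a primitive f of the form
    exp (- G) g(X, .), which G makes closed; x = exp (G) f. *)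
Lemma adapted_coordinate (l : M -> R) (X Y : vector_field M) (p : M) :
  smooth_field setT X -> smooth_field setT Y ->
  (\forall q \near p, smf l q) ->
  (\forall q \near p, [/\ g q (X q) (X q) = 1, g q (X q) (Y q) = 0,
     eta q (X q) = 0 & eta q (Y q) = 0]) ->
  (\forall q \near p, dd l q (X q) = 0 /\ dd l q (Y q) = 0) ->
  (\forall q \near p, [/\ lie xi X q = - l q *: X q,
     exists a, lie xi Y q = a *: Y q & lie X Y q = 0]) ->
  (\forall q \near p, forall v : tangent q,
     exists a b c, v = a *: xi q + (b *: X q + (c *: Y q + 0))) ->
  exists x : M -> R, \forall q \near p,
    smf x q /\ forall v : tangent q,
      dd x q v = x q * l q * eta q v + g q (X q) v.
Proof.
move=> HX HY sl on dl br span.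
have sF : \forall q \near p, [/\ smX xi q, smX X q & smX Y q].
  by near=> q; split; [exact: (smX_xi acm)|exact: gl_at|exact: gl_at].
have NN := near_near on; have eta_xi q := acm_eta_xi acm q.
pose a1 : one_form M := fun q v => l q * eta q v.
have a1P q a (u v : tangent q) : a1 q (a *: u + v) = a * a1 q u + a1 q v.
  by rewrite /a1 (etaP acm); ring.
have [G NG] : exists G : M -> R, \forall q \near p,
    smf G q /\ forall v : tangent q, dd G q v = a1 q v.
  apply: (local_primitive a1P _ sF span).
    apply: filterS sl => q lq Z sZ; exact: (smfM lq (smf_eta acm sZ)).
  apply: filterS3 NN dl br => q onq [lX lY] [bX [b bY] bXY].
  have N0 : \forall x \near q, a1 x (X x) = 0.
    by apply: filterS onq => x [_ _ e _]; rewrite /a1 e mulr0.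
  have N1 : \forall x \near q, a1 x (Y x) = 0.
    by apply: filterS onq => x [_ _ _ e]; rewrite /a1 e mulr0.
  have N2 (v : tangent q) : dd (fun x => a1 x (xi x)) q v = dd l q v.
    by apply: dd_eq; near=> x; rewrite /a1 eta_xi mulr1.
  have [_ _ eX eY] := nbhs_singleton onq.
  rewrite /form_deriv !N2 !(dd_const _ N0) !(dd_const _ N1) bX bY bXY lX lY /a1.
  by rewrite !(etaZ acm) eX eY (eta0 acm) !mulr0 !subr0.
pose rho q := expR (- G q).
have srho q : smf G q -> smf rho q by move=> sG; apply: smf_expR; exact: smfN.
pose a2 : one_form M := fun q v => rho q * g q (X q) v.
have a2P q a (u v : tangent q) : a2 q (a *: u + v) = a * a2 q u + a2 q v.
  by rewrite /a2 (gPr acm); ring.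
have [f Nf] : exists f : M -> R, \forall q \near p,
    smf f q /\ forall v : tangent q, dd f q v = a2 q v.
  apply: (local_primitive a2P _ sF span).
    apply: filterS2 sF NG => q [_ sX _] [sG _] Z sZ.
    exact: (smfM (srho q sG) (smf_g acm sX sZ)).
  apply: filterS3 NN NG br => q onq [sG GD] [bX [b bY] bXY].
  have drho (v : tangent q) : dd rho q v = - rho q * (l q * eta q v).
    have sGN := smfN sG; rewrite (dd_expR v sGN).
    have -> : dd (fun x => - G x) q v = - a1 q v.
      by rewrite -GD !ddE (differentialN v sG).
    by rewrite /rho /a1 mulrN mulNr.
  have N0 : \forall x \near q, a2 x (xi x) = 0.
    by apply: filterS onq => x [_ _ e _]; rewrite /a2 -(eta_g acm) e mulr0.
  have N1 : \forall x \near q, a2 x (Y x) = 0.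
    by apply: filterS onq => x [_ e _ _]; rewrite /a2 e mulr0.
  have N2 (v : tangent q) : dd (fun x => a2 x (X x)) q v = dd rho q v.
    by apply: dd_eq; apply: filterS onq => x [e _ _ _]; rewrite /a2 e mulr1.
  have [gXX gXY eX eY] := nbhs_singleton onq.
  rewrite /form_deriv !N2 !(dd_const _ N0) !(dd_const _ N1) bX bY bXY !drho /a2.
  rewrite ?eX ?eY ?eta_xi !(gZr acm) (g0r acm) gXX gXY; split; ring.
exists (fun q => expR (G q) * f q); apply: filterS2 NG Nf => q [sG GD] [sf fD].
have sE := smf_expR sG; split; first exact: (smfM sE sf).
move=> v; rewrite (ddM v sE sf) fD (dd_expR v sG) GD /a1 /a2 /rho.
have e1 : expR (G q) * expR (- G q) = 1 by rewrite -expRD subrr expR0.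
transitivity (expR (G q) * expR (- G q) * g q (X q) v +
  expR (G q) * f q * l q * eta q v); first by ring.
by rewrite e1 mul1r addrC.
Unshelve. all: by end_near. Qed.

End adapted_coordinate.

(** * Charts from dual frames *)

Section coordinates.
Context {R : realType} {n : nat} {M : smooth_manifold R n}.

(** Functions f_i and fields X_j with df_i(X_j) the Kronecker symbol are the
    coordinates and coordinate fields of a chart, by the inverse function
    theorem. The image of the chart is a ball. *)
Lemma coordinates_of_frame (f : 'I_n -> M -> R) (X : 'I_n -> vector_field M)
    (P : M -> Prop) (p : M) :
  (\forall q \near p, forall i, [/\ smf (f i) q, smX (X i) q &
     forall j, dd (f i) q (X j q) = (i == j)%:R]) ->
  (\forall q \near p, P q) ->
  exists c : chart R n M, [/\ admissible_chart c, chart_dom c p,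
    forall q, chart_dom c q -> [/\ P q,
      forall i, chart_map c q 0 i = f i q,
      forall i, coord_field c i q = X i q &
      forall h : M -> R, smf h q ->
        differentiable (h \o chart_inv c) (chart_map c q) /\
        forall i, 'D_(delta_mx 0 i) (h \o chart_inv c) (chart_map c q) =
                  dd h q (X i q)] &
    exists rho : R, [/\ 0 < rho,
      forall q, chart_dom c q -> `|chart_map c q - chart_map c p| < rho &
      forall w, `|w - chart_map c p| < rho ->
        chart_dom c (chart_inv c w) /\ chart_map c (chart_inv c w) = w]].
Proof.
move=> fX nP; have ac := chart_at_atlas p; have cp := chart_at_dom p.
set c := chart_at p in ac cp; set u0 := chart_map c p.
have [r0 r00 Hr] := near_chart_ball cp (filterI fX nP); rewrite -/u0 in Hr.
pose F (u : 'rV[R]_n) : 'rV[R]_n := \row_i f i (chart_inv c u).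
pose E i := field_in c (X i).
have Fat u : `|u - u0| < r0 -> smooth_at F u.
  move=> /Hr[q [cq <- _ [fXq _]]]; apply: smooth_at_rV => i; have [fq _ _] := fXq i.
  have fA : smooth_at (f i \o chart_inv c) (chart_map c q) by apply/smfE.
  by apply: smooth_at_eq fA; near=> v; rewrite /F mxE.
have Eat i u : `|u - u0| < r0 -> smooth_at (E i) u.
  by move=> /Hr[q [cq <- _ [/(_ i)[_ Xq _] _]]]; apply/smXE.
have FE i u : `|u - u0| < r0 -> 'D_(E i u) F u = delta_mx 0 i.
  move=> ur; have dF := smooth_at_differentiable (Fat u ur).
  have [q [cq qu qi [fXq _]]] := Hr u ur.
  apply/rowP => j; rewrite (derive_rV _ _ dF) !mxE eqxx /=.
  have -> : (fun y => F y 0 j) = f j \o chart_inv c by apply/funext => y; rewrite mxE.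
  have [fq _ fXj] := fXq j.
  by rewrite -qu /E (field_in_map _ cq) -(differentialE _ ac cq fq) -ddE fXj eq_sym.
have u0r : ball u0 r0 u0 by exact: ballxx.
have oB : open (ball u0 r0) by exact: ball_open.
have Fs : smooth_on (ball u0 r0) F by apply: smooth_at_on => u /ball_rV; exact: Fat.
have Es i : smooth_on (ball u0 r0) (E i).
  by apply: smooth_at_on => u /ball_rV; exact: Eat.
have FE' i u : ball u0 r0 u -> 'D_(E i u) F u = delta_mx 0 i.
  by move=> /ball_rV; exact: FE.
have [r [rho [G [r_gt0 rho_gt0 rO GF [FG Gs DG]]]]] :=
  local_inverse oB u0r Fs Es FE'.
have {}rO u : `|u - u0| < r -> `|u - u0| < r0 by move=> /rO /ball_rV.
pose dom : set M := [set q | [/\ chart_dom c q, `|chart_map c q - u0| < r &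
  `|F (chart_map c q) - F u0| < rho]].
pose map q := F (chart_map c q); pose inv w := chart_inv c (G w).
have mapK q : dom q -> inv (map q) = q.
  by move=> [cq qr qrho]; rewrite /inv /map GF// chart_mapK.
have inv_dom w : `|w - F u0| < rho ->
    [/\ dom (inv w), map (inv w) = w & chart_map c (inv w) = G w].
  move=> wr; have [Gr FGw] := FG w wr.
  have [q [cq qG qi _]] := Hr _ (rO _ Gr).
  have cG : chart_map c (inv w) = G w by rewrite /inv qi.
  split => //; last by rewrite /map cG.
  by split; rewrite ?cG ?FGw// /inv qi.
have map_cont q : dom q -> {for q, continuous map}.
  move=> [cq qr _]; apply: continuous_comp; first exact: chart_map_cont.
  by apply: smooth_at_continuous; apply: Fat; exact: rO.
have odom : open dom.
  rewrite openE => q Dq; have [cq qr qrho] := Dq.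
  have N1 : \forall x \near q, `|chart_map c x - u0| < r.
    apply: (@near_chart_map _ _ _ c q (fun u => `|u - u0| < r) cq).
    have : \forall u \near chart_map c q, ball u0 r u.
      by apply: open_near; [exact: ball_open|exact/ball_rV].
    by apply: filterS => u /ball_rV.
  have N2 : \forall x \near q, `|map x - F u0| < rho.
    apply: (@near_continuous _ _ map (fun w => `|w - F u0| < rho) q (map_cont q Dq)).
    have : \forall w \near map q, ball (F u0) rho w.
      by apply: open_near; [exact: ball_open|exact/ball_rV].
    by apply: filterS => w /ball_rV.
  by apply: filterS3 (near_dom cq) N1 N2 => x.
have imgE : map @` dom = ball (F u0) rho.
  apply/seteqP; split => [_ [q [_ _ qrho] <-]|w /ball_rV wr]; first exact/ball_rV.
  by have [Dw mw _] := inv_dom w wr; exists (inv w).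
have oimg : open (map @` dom) by rewrite imgE; exact: ball_open.
have inv_cont w : (map @` dom) w -> {for w, continuous inv}.
  move=> Iw; have wB : ball (F u0) rho w by rewrite -imgE.
  have wr := (ball_rV _ _ _).1 wB; have [[cw _ _] _ cG] := inv_dom w wr.
  apply: continuous_comp; first exact: smooth_on_continuous Gs wB.
  by apply: chart_inv_cont; rewrite -cG; exact: chart_img.
pose d := @Chart R n M dom map inv odom oimg mapK map_cont inv_cont.
have domG q : dom q -> G (map q) = chart_map c q.
  by move=> [cq qr qrho]; rewrite /map GF.
have Gat q : dom q -> smooth_at G (map q).
  move=> [cq qr qrho]; apply: (smooth_on_at _ Gs); first exact: ball_open.
  exact/ball_rV.
have rhoq q : dom q -> `|map q - F u0| < rho by move=> [].
have DGE q i : dom q -> 'D_(delta_mx 0 i) G (map q) = tcoord c (X i q).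
  move=> Dq; rewrite (DG i _ (rhoq q Dq)) (domG q Dq) /E field_in_map//.
  by case: Dq.
exists d; split.
- move=> e ae; split.
    apply: smooth_at_on => _ [q [Dq eq_] <-]; have [cq _ _] := Dq.
    apply: (@smooth_at_comp_rV _ _ _ _ G (chart_map e \o chart_inv c)); first exact: Gat.
    by rewrite (domG q Dq); exact: transition_smooth.
  apply: smooth_at_on => _ [q [Dq eq_] <-]; have [cq qr _] := Dq.
  apply: (@smooth_at_comp_rV _ _ _ _ (chart_map c \o chart_inv e) F).
    exact: transition_smooth.
  by rewrite /= (chart_mapK eq_); apply: Fat; exact: rO.
- by split=> //; rewrite subrr normr0.
- move=> q Dq; have [cq qr qrho] := Dq.
  have [q' [cq' q'q _ [fXq Pq]]] := Hr _ (rO _ qr).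
  have q'E : q' = q by rewrite -(chart_mapK cq') q'q chart_mapK.
  rewrite q'E in fXq Pq; split => //.
  + by move=> i; rewrite /= /map /F mxE (chart_mapK cq).
  + move=> i; rewrite /coord_field /=.
    rewrite -[LHS]/('D_(delta_mx 0 i)
      ((chart_map (chart_at q) \o chart_inv c) \o G) (map q)).
    have dGq := smooth_at_differentiable (Gat q Dq).
    rewrite (derive_comp _ dGq); last first.
      rewrite (domG q Dq); apply: smooth_at_differentiable.
      by apply: transition_smooth => //; [exact: chart_at_atlas|exact: chart_at_dom].
    rewrite (DGE q i Dq) (domG q Dq); exact: (tcoordK (X i q) ac cq).
  + move=> h hq; have dGq := smooth_at_differentiable (Gat q Dq).
    have hc : differentiable (h \o chart_inv c) (G (map q)).
      by rewrite (domG q Dq); apply: smooth_at_differentiable; apply/smfE.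
    split; first exact: (@differentiable_comp _ _ _ _ G (h \o chart_inv c)).
    move=> i; rewrite -[LHS]/('D_(delta_mx 0 i) ((h \o chart_inv c) \o G) (map q)).
    by rewrite (derive_comp _ dGq hc) (DGE q i Dq) (domG q Dq) ddE (differentialE _ ac cq hq).
- by exists rho; split=> // w /inv_dom[].
Unshelve. all: by end_near. Qed.

Lemma dd_locally_constant (f : M -> R) p :
  (forall q, smf f q) -> (forall q (v : tangent q), dd f q v = 0) ->
  \forall q \near p, f q = f p.
Proof.
move=> sf df; have ac := chart_at_atlas p; have cp := chart_at_dom p.
set c := chart_at p in ac cp.
have [r r0 Hr] := near_chart_ball cp (near_dom cp).
have nb : \forall q \near p, `|chart_map c q - chart_map c p| < r.
  apply: (@near_chart_map _ _ _ c p (fun u => `|u - chart_map c p| < r) cp).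
  have : \forall u \near chart_map c p, ball (chart_map c p) r u.
    by apply: open_near; [exact: ball_open|exact: ballxx].
  by apply: filterS => u /ball_rV.
apply: filterS2 nb (near_dom cp) => q qr cq.
have pr : `|chart_map c p - chart_map c p| < r by rewrite subrr normr0.
have D t : 0 <= t <= 1 -> exists x, [/\ chart_dom c x &
    chart_map c x = chart_map c p + t *: (chart_map c q - chart_map c p)].
  by move=> t01; have [x [cx xE _ _]] := Hr _ (ball_convex t01 pr qr); exists x.
have dft t : 0 <= t <= 1 -> differentiable (f \o chart_inv c)
    (chart_map c p + t *: (chart_map c q - chart_map c p)).
  move=> /D[x [cx <-]]; apply: smooth_at_differentiable; exact/smfE.
have [t t01] := mvt_line dft.
rewrite [chart_map c p + (_ - _)]addrC subrK /= (chart_mapK cq) (chart_mapK cp).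
have [x [cx <-]] := D t t01.
rewrite -(tuncoordK (chart_map c q - chart_map c p) ac cx).
rewrite -(differentialE _ ac cx (sf x)) -ddE df => /eqP.
by rewrite subr_eq0 => /eqP.
Qed.

(** The level set of f through p is open and closed. *)
Lemma dd_constant (f : M -> R) : connected [set: M] ->
  (forall q, smf f q) -> (forall q (v : tangent q), dd f q v = 0) ->
  forall p q, f p = f q.
Proof.
move=> Mconn sf df p.
have oE (P : R -> Prop) : open [set q | P (f q)].
  rewrite openE => q Pq; apply: filterS (dd_locally_constant q sf df) => x fx.
  by rewrite /= fx.
suff H : [set q | f p = f q] = setT.
  by move=> q; have : [set: M] q by []; rewrite -H.
apply: Mconn.
- by exists p.
- exists [set q | f p = f q]; last by rewrite setTI.
  exact: (oE (fun a => f p = a)).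
- exists [set q | f p = f q]; last by rewrite setTI.
  rewrite -[X in closed X]setCK; apply: open_closedC.
  exact: (oE (fun a => ~ f p = a)).
Qed.

(** Moving inside the ball to the point with the same k-th coordinate as q and
    the other coordinates of p does not change the value of h. *)
Lemma function_of_coordinate (c : chart R n M) (p : M) (rho : R) (h : M -> R)
    (k : 'I_n) : 0 < rho -> chart_dom c p ->
  (forall q, chart_dom c q -> `|chart_map c q - chart_map c p| < rho) ->
  (forall w, `|w - chart_map c p| < rho ->
     chart_dom c (chart_inv c w) /\ chart_map c (chart_inv c w) = w) ->
  (forall q, chart_dom c q -> differentiable (h \o chart_inv c) (chart_map c q) /\
     forall i, i != k -> 'D_(delta_mx 0 i) (h \o chart_inv c) (chart_map c q) = 0) ->
  exists m : R -> R, forall q, chart_dom c q -> h q = m (chart_map c q 0 k).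
Proof.
move=> rho0 cp domB Bdom dh; set u0 := chart_map c p in domB Bdom.
pose w (z : R) : 'rV[R]_n := \row_i if i == k then z else u0 0 i.
exists (fun z => h (chart_inv c (w z))) => q cq.
set u := chart_map c q; have ur : `|u - u0| < rho := domB q cq.
have wr : `|w (u 0 k) - u0| < rho.
  apply: norm_coord_lt => // i; rewrite !mxE; case: eqP => [->|_].
    by have := le_lt_trans (coord_norm_le (u - u0) k) ur; rewrite !mxE.
  by rewrite subrr normr0.
have D t : 0 <= t <= 1 -> exists2 x, chart_dom c x &
    chart_map c x = w (u 0 k) + t *: (u - w (u 0 k)).
  move=> t01; have [Dx xE] := Bdom _ (ball_convex t01 wr ur).
  by exists (chart_inv c (w (u 0 k) + t *: (u - w (u 0 k)))).
have dft t : 0 <= t <= 1 -> differentiable (h \o chart_inv c)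
    (w (u 0 k) + t *: (u - w (u 0 k))).
  by move=> /D[x cx <-]; have [] := dh x cx.
have [t t01] := mvt_line dft.
rewrite [w _ + (_ - _)]addrC subrK /= (chart_mapK cq).
have [x cx <-] := D t t01; have [dx Dx] := dh x cx.
rewrite (derive_basis _ dx) big1 => [/eqP|i _].
  by rewrite subr_eq0 => /eqP.
have [->|ik] := eqVneq i k; first by rewrite !mxE eqxx subrr scale0r.
by rewrite (Dx i ik) scaler0.
Qed.

End coordinates.

(** * Coordinates of an eigenframe *)

Lemma ord3_ind (P : 'I_3 -> Prop) : P 0 -> P 1 -> P 2 -> forall i, P i.
Proof.
move=> P0 P1 P2 [[|[|[|//]]] i3].
- by rewrite (_ : Ordinal i3 = 0)//; exact: val_inj.
- by rewrite (_ : Ordinal i3 = 1)//; exact: val_inj.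
- by rewrite (_ : Ordinal i3 = 2)//; exact: val_inj.
Qed.

Definition triple (A : Type) (a b c : A) (i : 'I_3) : A :=
  if i == 0 then a else if i == 1 then b else c.

Section conclusion.
Context {R : realType} {M : smooth_manifold R 3}.
Unset Implicit Arguments.
Variables (phi : endo_field M) (xi : vector_field M) (eta : one_form M).
Variable g : two_tensor M.
Variable nabla : vector_field M -> vector_field M -> vector_field M.
Variables kappa mu : M -> R.
Hypothesis Mak : almost_kenmotsu phi xi eta g.
Hypothesis LC : levi_civita g nabla.
Hypothesis Mkm : generalized_kappa_mu' phi xi eta kappa mu nabla.
Hypothesis kappa_lt : forall p, kappa p < -1.
Hypothesis dkappa_eta : forall (p : M) (u v : tangent p),
  wedge11 (differential kappa) eta p u v = 0.
Set Implicit Arguments.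

Let acm := ak_acm Mak.
Notation gl X := (smooth_field setT X).
Let lam q := Num.sqrt (-1 - kappa q).
Notation eigenframe E p := (eigenframe phi xi eta g kappa E p).

Let eqs E (q : M) := @eigenframe_eqs _ _ _ _ _ _ _ _ _ Mak LC Mkm kappa_lt dkappa_eta E q.

(** Along an eigenframe E, phi E the coefficients 1 + lam and 1 - lam of the
    brackets with xi are constant on the contact distribution, which is what the
    two linear equations for x and y need. *)
Lemma eigenframe_coordinates E (p : M) : gl E -> eigenframe E p ->
  exists x y : M -> R, \forall q \near p,
    [/\ smf x q, smf y q,
      forall v : tangent q, dd x q v = x q * (1 + lam q) * eta q v + g q (E q) v &
      forall v : tangent q,
        dd y q v = y q * (1 - lam q) * eta q v + g q (apply_endo phi E q) v].
Proof.
move=> HE EF; set E2 := apply_endo phi E; have HE2 : gl E2 := gl_phi Mak HE.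
have NF := near_eigenframe EF; have sl := smf_lam Mkm kappa_lt.
have con : \forall q \near p, [/\ g q (E q) (E q) = 1, g q (E q) (E2 q) = 0,
    eta q (E q) = 0, eta q (E2 q) = 0 & g q (E2 q) (E2 q) = 1].
  apply: filterS NF => q [F _]; have [e11 e22 e12 e10 e20] := frame_eqs Mak F.
  by split; rewrite ?(eta_g acm).
have dl (a : R) (q : M) (v : tangent q) : eta q v = 0 ->
    dd (fun x => 1 + a * lam x) q v = 0.
  move=> v0; have s1 := smf_cst (1 : R) q; have sa := smf_cst a q.
  rewrite (ddD v s1 (smfM sa (sl q))) (ddM v sa (sl q)) !dd_cst.
  by rewrite (dd_lam_contact Mak Mkm kappa_lt dkappa_eta v0) !mulr0 !addr0.
have sla (a : R) q : smf (fun x => 1 + a * lam x) q.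
  exact: (smfD (smf_cst 1 q) (smfM (smf_cst a q) (sl q))).
have span q : eigenframe E q -> forall v : tangent q,
    v = g q v (xi q) *: xi q + (g q v (E q) *: E q + (g q v (E2 q) *: E2 q + 0)).
  by move=> [F _] v; rewrite addr0 addrA; exact: (frame_expand Mak v F).
have br q : eigenframe E q -> [/\ lie xi E q = - (1 + 1 * lam q) *: E q,
    lie xi E2 q = - (1 + (-1) * lam q) *: E2 q, lie E E2 q = 0 & lie E2 E q = 0].
  move=> /(eqs HE)[b1 b2 b3 _]; rewrite mul1r mulN1r; split.
  - exact: b1.
  - exact: b2.
  - exact: b3.
  - by rewrite lieC b3 oppr0.
have [x Nx] : exists x : M -> R, \forall q \near p, smf x q /\
    forall v : tangent q, dd x q v = x q * (1 + 1 * lam q) * eta q v + g q (E q) v.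
  apply: (adapted_coordinate Mak HE HE2).
  - by near=> q; exact: sla.
  - by apply: filterS con => q [].
  - by apply: filterS con => q [_ _ e1 e2 _]; split; exact: dl.
  - apply: filterS NF => q /br[b1 b2 b3 _]; split.
    + exact: b1.
    + by exists (- (1 + (-1) * lam q)); exact: b2.
    + exact: b3.
  - by apply: filterS NF => q /span sq v; do 3 eexists; exact: sq.
have [y Ny] : exists y : M -> R, \forall q \near p, smf y q /\
    forall v : tangent q, dd y q v = y q * (1 + (-1) * lam q) * eta q v + g q (E2 q) v.
  apply: (adapted_coordinate Mak HE2 HE).
  - by near=> q; exact: sla.
  - by apply: filterS con => q [? ? ? ? ?]; split; rewrite // (gC acm).
  - by apply: filterS con => q [_ _ e1 e2 _]; split; exact: dl.
  - apply: filterS NF => q /br[b1 b2 _ b3]; split.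
    + exact: b2.
    + by exists (- (1 + 1 * lam q)); exact: b1.
    + exact: b3.
  - apply: filterS NF => q /span sq v.
    exists (g q v (xi q)), (g q v (E2 q)), (g q v (E q)).
    by rewrite addr0 [X in _ + X]addrC -[X in _ + X]addr0 -addrA; exact: sq.
exists x, y; apply: filterS2 Nx Ny => q [sx dx] [sy dy].
by split=> // v; [rewrite dx mul1r|rewrite dy mulN1r].
Unshelve. all: by end_near. Qed.

Lemma ddZ (f : M -> R) q a (v : tangent q) : smf f q -> dd f q (a *: v) = a * dd f q v.
Proof.
move=> sf; have d0 : dd f q 0 = 0.
  by have := ddP 1 0 0 sf; rewrite scaler0 addr0; lra.
by have := ddP a v 0 sf; rewrite addr0 d0 addr0.
Qed.

(** Where mu is not -2, kappa varies along xi and serves as third coordinate. *)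
Lemma dual_frame E (x y : M -> R) (q : M) : gl E -> eigenframe E q -> mu q <> -2 ->
  smf x q -> smf y q ->
  (forall v : tangent q, dd x q v = x q * (1 + lam q) * eta q v + g q (E q) v) ->
  (forall v : tangent q,
     dd y q v = y q * (1 - lam q) * eta q v + g q (apply_endo phi E q) v) ->
  let W := -2 * (kappa q + 1) * (mu q + 2) in
  let a := x q * (1 + lam q) in let b := y q * (1 - lam q) in
  let T := W^-1 *: (- a *: E q + (- b *: apply_endo phi E q + xi q)) in
  (forall i j, dd (triple x y kappa i) q (triple (E q) (apply_endo phi E q) T j) =
    (i == j)%:R) /\
  xi q = a *: E q + b *: apply_endo phi E q + W *: T.
Proof.
set E2 := apply_endo phi E => HE EF mu2 sx sy dx dy W a b T.
have [_ _ _ dk] := eqs HE EF; rewrite -/W in dk.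
have W0 : W != 0.
  have := kappa_lt q; rewrite /W !mulf_eq0 oppr_eq0 pnatr_eq0 /= => k.
  apply/negP => /orP[/eqP|/eqP] H; first by lra.
  by apply: mu2; lra.
have alg (V : zmodType) (u v w : V) : w = u + v + (- u + (- v + w)).
  by rewrite addrACA subrr add0r addrA subrr add0r.
split; last first.
  by rewrite scalerA divff// scale1r !scaleNr; exact: alg.
have [F _] := EF; have [e11 e22 e12 e10 e20] := frame_eqs Mak F.
have eE : eta q (E q) = 0 by rewrite (eta_g acm).
have eE2 : eta q (E2 q) = 0 by rewrite (eta_g acm).
have sk := smf_kappa Mkm q.
have dT f : smf f q ->
    dd f q T = W^-1 * (- a * dd f q (E q) + (- b * dd f q (E2 q) + dd f q (xi q))).
  by move=> sf; rewrite /T (ddZ _ _ sf) !(ddP _ _ _ sf).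
have dkE v : eta q v = 0 -> dd kappa q v = 0.
  by move=> v0; rewrite (dd_kappa Mak dkappa_eta) v0 mulr0.
have xE : dd x q (E q) = 1 by rewrite dx eE e11 mulr0 add0r.
have xE2 : dd x q (E2 q) = 0 by rewrite dx eE2 e12 mulr0 addr0.
have xX : dd x q (xi q) = a by rewrite dx (acm_eta_xi acm) e10 mulr1 addr0.
have yE : dd y q (E q) = 0 by rewrite dy eE (gC acm) e12 mulr0 addr0.
have yE2 : dd y q (E2 q) = 1 by rewrite dy eE2 e22 mulr0 add0r.
have yX : dd y q (xi q) = b by rewrite dy (acm_eta_xi acm) e20 mulr1 addr0.
have kE := dkE _ eE; have kE2 := dkE _ eE2.
by apply: ord3_ind; apply: ord3_ind; rewrite /triple /=
  ?(dT _ sx) ?(dT _ sy) ?(dT _ sk) ?xE ?xE2 ?xX ?yE ?yE2 ?yX ?kE ?kE2 ?dk //;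
  rewrite ?mulr1 ?mulr0 ?add0r ?addr0 ?mulVf// ?addNr ?mulr0.
Qed.
End conclusion.

Unset Implicit Arguments.

Theorem theorem5p1 (R : realType) (M : smooth_manifold R 3)
    (Mconn : connected [set: M])
    (phi : endo_field M) (xi : vector_field M) (eta : one_form M)
    (g : two_tensor M)
    (nabla : vector_field M -> vector_field M -> vector_field M)
    (kappa mu : M -> R)
    (Mak : almost_kenmotsu phi xi eta g)
    (nablaLC : levi_civita g nabla)
    (Mkm : generalized_kappa_mu' phi xi eta kappa mu nabla)
    (dkappa_eta : forall (p : M) (u v : tangent p),
       wedge11 (differential kappa) eta p u v = 0)
    (kappa_lt : forall p : M, kappa p < -1) :
  let lambda (p : M) : R := Num.sqrt (-1 - kappa p) in
  ((forall p : M, mu p = -2) -> forall p q : M, kappa p = kappa q)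
  /\
  ((forall p : M, mu p <> -2) ->
   forall p : M, exists (c : chart R 3 M) (X : vector_field M),
     let U : set M := chart_dom c in
     let x (q : M) : R := chart_map c q 0 0 in
     let y (q : M) : R := chart_map c q 0 1 in
     let z (q : M) : R := chart_map c q 0 2 in
     let phiX : vector_field M := apply_endo phi X in
     [/\ admissible_chart c, U p, smooth_field U X,
         (forall q, U q ->
            [/\ z q < -1,
                [/\ g q (xi q) (xi q) = 1, g q (X q) (X q) = 1,
                    g q (phiX q) (phiX q) = 1
                  & [/\ g q (xi q) (X q) = 0, g q (xi q) (phiX q) = 0
                      & g q (X q) (phiX q) = 0]],
                [/\ h'_eigenvector phi xi xi q, h'_eigenvector phi xi X q
                  & h'_eigenvector phi xi phiX q],
                h'_tensor phi xi X q = lambda q *: X q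
              & kappa q = z q])
       & (exists m : R -> R, forall q, U q -> mu q = m (z q)) /\
         exists f r : R -> R,
           [/\ smooth_on (z @` U) f, smooth_on (z @` U) r
             & forall q, U q ->
               let a : R := x q * (1 + Num.sqrt (-1 - z q)) + f (z q) in
               let b : R := y q * (1 - Num.sqrt (-1 - z q)) + r (z q) in
               [/\ X q = coord_field c 0 q,
                   phiX q = coord_field c 1 q
                 & xi q = a *: coord_field c 0 q + b *: coord_field c 1 q
                     - (2 * (z q + 1) * (mu q + 2)) *: coord_field c 2 q]]]).
Proof.
move=> lambda; have acm := ak_acm Mak.
have eqs E q := @eigenframe_eqs _ _ _ _ _ _ _ _ _ Mak nablaLC Mkm kappa_lt dkappa_eta E q.
split=> [mu2|mu2 p].
  apply: (dd_constant Mconn (smf_kappa Mkm)) => q v.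
  have [E [HE EF]] := exists_eigenframe Mak nablaLC Mkm kappa_lt q.
  have [_ _ _ dk] := eqs E q HE EF.
  by rewrite (dd_kappa Mak dkappa_eta) dk mu2 addNr mulr0 mul0r.
have [E [HE EF]] := exists_eigenframe Mak nablaLC Mkm kappa_lt p.
set E2 := apply_endo phi E; have HE2 : smooth_field setT E2 := gl_phi Mak HE.
have NF := near_eigenframe EF.
have [x [y Nxy]] := eigenframe_coordinates Mak nablaLC Mkm kappa_lt dkappa_eta HE EF.
(* W is xi(kappa) and T the third coordinate field *)
pose W q := -2 * (kappa q + 1) * (mu q + 2).
pose a q := x q * (1 + lambda q); pose b q := y q * (1 - lambda q).
pose T q := (W q)^-1 *: (- a q *: E q + (- b q *: E2 q + xi q)).
have W0 q : W q != 0.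
  have := kappa_lt q; rewrite /W !mulf_eq0 oppr_eq0 pnatr_eq0 /= => k.
  apply/negP => /orP[/eqP|/eqP] H; first by lra.
  by apply: (mu2 q); lra.
have sT q : smf x q -> smf y q -> smX T q.
  move=> sx sy; have s1 := smf_cst (1 : R) q.
  have sk := smf_kappa Mkm q; have sm := smf_mu Mkm q.
  have sl := smf_lam Mkm kappa_lt q.
  have sa := smfM sx (smfD s1 sl); have sb := smfM sy (smfB s1 sl).
  have sW := smfM (smfM (smf_cst (-2) q) (smfD sk s1)) (smfD sm (smf_cst 2 q)).
  exact: (smXZ (smfV (W0 q) sW) (smXD (smXZ (smfN sa) (gl_at q HE))
    (smXD (smXZ (smfN sb) (gl_at q HE2)) (gl_at q (gl_xi Mak))))).
pose X i : vector_field M := triple E E2 T i.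
have NX : \forall q \near p, forall i,
    [/\ smf (triple x y kappa i) q, smX (X i) q &
     forall j, dd (triple x y kappa i) q (X j q) = (i == j)%:R].
  apply: filterS2 NF Nxy => q Fq [sx sy dx dy].
  have [D _] := dual_frame Mak nablaLC Mkm kappa_lt dkappa_eta HE Fq (mu2 q) sx sy dx dy.
  have XE j : X j q = triple (E q) (E2 q) (T q) j by move: j; apply: ord3_ind.
  have sx' : forall i, smf (triple x y kappa i) q.
    apply: ord3_ind; rewrite /triple /=; first exact: sx.
      exact: sy.
    exact: (smf_kappa Mkm q).
  have sX' : forall i, smX (X i) q.
    apply: ord3_ind; rewrite /X /triple /=; first exact: (gl_at q HE).
      exact: (gl_at q HE2).
    exact: sT.
  by move=> i; split=> // j; rewrite XE; exact: D.
have NP : \forall q \near p, [/\ eigenframe phi xi eta g kappa E q,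
    xi q = a q *: E q + b q *: E2 q + W q *: T q,
    dd mu q (E q) = 0 & dd mu q (E2 q) = 0].
  apply: filterS2 NF Nxy => q Fq [sx sy dx dy].
  have [_ xiE] := dual_frame Mak nablaLC Mkm kappa_lt dkappa_eta HE Fq (mu2 q) sx sy dx dy.
  have [b1 b2 _ _] := eqs E q HE Fq.
  have N1 : \forall r \near q, eta r (E r) = 0.
    by apply: filterS (Fq.1) => r [].
  have N2 : \forall r \near q, eta r (E2 r) = 0.
    by near=> r; exact: (eta_phi acm).
  split.
  - exact: Fq.
  - exact: xiE.
  - exact: (eigenframe_mu Mak nablaLC Mkm kappa_lt dkappa_eta HE Fq HE N1 b1).
  - exact: (eigenframe_mu Mak nablaLC Mkm kappa_lt dkappa_eta HE Fq HE2 N2 b2).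
have [c [adm cp Hc [rho [rho0 domB Bdom]]]] := coordinates_of_frame NX NP.
exists c, E => U xc yc zc phiX; split.
- exact: adm.
- exact: cp.
- apply/smooth_fieldP; first exact: chart_dom_open.
  by move=> q _; exact: gl_at.
- move=> q Uq; have [[[F hE] xiE _ _] cf _ _] := Hc q Uq.
  have zk : zc q = kappa q by exact: cf.
  have [e11 e22 e12 e10 e20] := frame_eqs Mak F.
  have nz (v : tangent q) : g q v v = 1 -> v != 0.
    by move=> v1; apply/eqP => v0; move: v1; rewrite v0 (g0r acm); lra.
  have x1 : g q (xi q) (xi q) = 1 by exact: g_xi acm q.
  split.
  + by rewrite zk; exact: kappa_lt.
  + by split=> //; split=> //; rewrite (gC acm).
  + split.
    * split; first exact: nz.
      by exists 0; rewrite -hpE scale0r; exact: (hp_xi Mak).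
    * split; first exact: nz.
      by exists (lambda q); rewrite -hpE; exact: nbhs_singleton hE.
    * split; first exact: nz.
      by exists (- lambda q); rewrite -hpE; exact: (eigenframe_h' Mak HE).
  + by rewrite -hpE; exact: nbhs_singleton hE.
  + by rewrite zk.
- split.
    apply: (function_of_coordinate rho0 cp domB Bdom) => q Uq.
    have [[_ _ m1 m2] _ _ dh] := Hc q Uq; have [dm Dm] := dh mu (smf_mu Mkm q).
    split; first exact: dm.
    apply: ord3_ind => // _; rewrite Dm; first exact: m1.
    exact: m2.
  have s0 (A : set R) : smooth_on A (fun=> 0 : R) by move=> k; exact: Ck_cst.
  exists (fun=> 0), (fun=> 0); split; [exact: s0|exact: s0|] => q Uq.
  have [[_ xiE _ _] cf coordE _] := Hc q Uq.
  have zk : zc q = kappa q by exact: cf.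
  have xE : xc q = x q by exact: cf.
  have yE : yc q = y q by exact: cf.
  rewrite !addr0 zk xE yE !coordE; split.
  + by [].
  + by [].
  + by rewrite xiE /W -scaleNr /a /b !mulNr.
Unshelve. all: by end_near. Qed.
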